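(* Let $d\ge 2$, let $D\subset\mathbb{R}^d$ be a bounded convex polygonal domain each of whose bounding hyperplanes has a Diophantine normal vector, with boundary $\Gamma=\partial D$, and let $\alpha_*>0$ be such that $\pi/(1+\alpha_* )$ is the maximal angle between any two adjacent faces of $D$. Let $A=(A^{ij})_{1\le i,j\le d}$ be a real matrix-valued function on $\mathbb{R}^d$ which is uniformly elliptic, i.e. there is a constant $c>0$ with $c^{-1}|\xi|^2\le A^{ij}(x)\xi_i\xi_j\le c|\xi|^2$ for all $x,\xi\in\mathbb{R}^d$, and let $g:\mathbb{R}^d\to\mathbb{C}$ be $\mathbb{Z}^d$-periodic. Assume $g$ and all entries of $A$ are sufficiently smooth. Let $\mathcal{L}u=-\mathrm{div}(A(x)\nabla u)$ and $\overline g=\int_{\mathbb{T}^d}g(y)\,dy$. For $\varepsilon>0$ let $u_\varepsilon$ be the solution of $\mathcal{L}u_\varepsilon=0$ in $D$, $u_\varepsilon(x)=g(x/\varepsilon)$ on $\Gamma$, and let $u_0$ be the solution of $\mathcal{L}u_0=0$ in $D$, $u_0=\overline g$ on $\Gamma$. Set $$\gamma=\frac{(d-1)\min\{1,\alpha_*\}}{d-1+\min\{1,\alpha_*\}}.$$ Then for each $1\le p<\infty$ and each $\delta>0$ there exists a constant $C$ (depending on $p,D,\mathcal{L},\delta$ and on the fixed function $g$, but independent of $\varepsilon$) such that for all $0<\varepsilon\le 1$ $$\|u_\varepsilon-u_0\|_{L^p(D)}\le C\,\varepsilon^{\min\{\gamma,\frac1p\}-\delta}.$$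
   Context: A bounded convex polygonal domain is a bounded nonempty set $D=\bigcap_{j=1}^N\{x\in\mathbb{R}^d:\nu_j\cdot x>c_j\}$ with $c_j\in\mathbb{R}$ and unit vectors $\nu_j$; a ($(d-1)$-dimensional) face of $D$ is a flat portion of the boundary, $\{\nu_k\cdot x=c_k\}\cap\bigcap_{j\ne k}\{\nu_j\cdot x>c_j\}$. Angles between adjacent faces are the interior dihedral angles of $D$. A vector $\nu\in\mathbb{R}^d$ is Diophantine if there exist $0<\tau(\nu)<\infty$ and $C>0$ such that $|m\cdot\nu|>C|m|^{-\tau(\nu)}$ for all $m\in\mathbb{Z}^d\setminus\{0\}$, where $|m|=|m_1|+\dots+|m_d|$. ''Sufficiently smooth'' means of class $C^k$ for some $k$ depending only on $d$ and the Diophantine exponents $\tau(\nu_j)$ of the normals. Repeated indices are summed. *)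

(* Defs.v *)
From HB Require Import structures.
From mathcomp Require Import all_boot all_order all_algebra.
From mathcomp Require Import all_classical all_reals all_analysis.
From mathcomp.real_closed Require Import complex.

Set Implicit Arguments.
Unset Strict Implicit.
Unset Printing Implicit Defensive.

Import Order.TTheory GRing.Theory Num.Theory.
Import numFieldNormedType.Exports.

Local Open Scope classical_set_scope.
Local Open Scope ring_scope.

(** The d-dimensional Lebesgue measure lives on [d.-tuple R], which carries the
    product (Borel) sigma-algebra: the measure on [n.+1.-tuple R] is the image
    of [lebesgue_measure \x lebesgue_tuple n] under [(x, t) |-> x :: t]. *)
Section cons_measure.
Local Open Scope ereal_scope.
Context (R : realType) (n : nat).
Variable mu : {sigma_finite_measure set (n.-tuple R) -> \bar R}.

Definition tuple_cons (xt : measurableTypeR R * n.-tuple R) : n.+1.-tuple R :=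
  [the n.+1.-tuple R of xt.1 :: xt.2].

Definition tuple_uncons (t : n.+1.-tuple R) : measurableTypeR R * n.-tuple R :=
  (thead t, [tuple of behead t]).

Lemma measurable_tuple_cons : measurable_fun setT tuple_cons.
Proof.
exact: (measurable_cons measurable_fst measurable_snd).
Qed.

Lemma measurable_tuple_uncons : measurable_fun setT tuple_uncons.
Proof.
apply: measurable_fun_pair; last exact: measurable_behead.
exact: (@measurable_tnth _ R n.+1 ord0).
Qed.

Lemma tuple_consK : cancel tuple_cons tuple_uncons.
Proof. by move=> [x t]; congr pair; apply: val_inj. Qed.

Definition cons_measure : set (n.+1.-tuple R) -> \bar R :=
  pushforward (@lebesgue_measure R \x mu) tuple_cons.

Let cons_measure0 : cons_measure set0 = 0.
Proof. by rewrite /cons_measure /pushforward preimage_set0 measure0. Qed.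

Let cons_measure_ge0 A : 0 <= cons_measure A.
Proof. by rewrite /cons_measure /pushforward measure_ge0. Qed.

Let cons_measure_sigma_additive : semi_sigma_additive cons_measure.
Proof.
move=> F mF tF mUF; rewrite /cons_measure /pushforward preimage_bigcup.
apply: measure_semi_sigma_additive.
- by move=> i; rewrite -[X in measurable X]setTI; exact: measurable_tuple_cons.
- apply/trivIsetP => /= i j _ _ ij; rewrite -preimage_setI.
  by move/trivIsetP : tF => /(_ _ _ _ _ ij) ->//; rewrite preimage_set0.
- rewrite -preimage_bigcup -[X in measurable X]setTI.
  exact: measurable_tuple_cons.
Qed.

HB.instance Definition _ := isMeasure.Build _ _ _ cons_measure
  cons_measure0 cons_measure_ge0 cons_measure_sigma_additive.

Let cons_measure_sigma_finite : sigma_finite setT cons_measure.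
Proof.
have /sigma_finiteP[F [TF ndF Foo]] := sigma_finiteT (@lebesgue_measure R).
have /sigma_finiteP[G [TG ndG Goo]] := sigma_finiteT mu.
exists (fun i => tuple_uncons @^-1` (F i `*` G i)).
  rewrite -preimage_bigcup (_ : \bigcup_i _ = setT) ?preimage_setT//.
  rewrite -setXTT TF TG predeqE => -[x y]; split.
    by move=> [i _ []/= ? ?]; split; exists i.
  move=> [/= [i _ Fix] [k _ Gky]]; exists (maxn i k) => //; split.
  - by move: x Fix; exact/subsetPset/ndF/leq_maxl.
  - by move: y Gky; exact/subsetPset/ndG/leq_maxr.
move=> i; have [mF Fi] := Foo i; have [mG Gi] := Goo i; split.
  rewrite -[X in measurable X]setTI; apply: measurable_tuple_uncons => //.
  exact: measurableX.
rewrite /cons_measure /pushforward -comp_preimage.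
rewrite (_ : _ \o _ = id) ?preimage_id; last first.
  by apply/funext => x; exact: tuple_consK.
by rewrite product_measure1E// lte_mul_pinfty// ge0_fin_numE.
Qed.

HB.instance Definition _ := Measure_isSigmaFinite.Build _ _ _ cons_measure
  cons_measure_sigma_finite.

End cons_measure.

Fixpoint lebesgue_tuple (R : realType) (n : nat) :
    {sigma_finite_measure set (n.-tuple R) -> \bar R} :=
  match n with
  | 0 => \d_([tuple] : 0.-tuple R)
  | n'.+1 => cons_measure (lebesgue_tuple R n')
  end.

Section euclidean.
Context (R : realType) (d : nat).
Implicit Types (x y v : 'rV[R]_d) (D : set 'rV[R]_d).

Definition rV_of_tuple (t : d.-tuple R) : 'rV[R]_d := \row_i tnth t i.

Definition dot x y : R := \sum_i x 0 i * y 0 i.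

Definition basis_vec (i : 'I_d) : 'rV[R]_d := delta_mx 0 i.

Definition boundary D : set 'rV[R]_d := closure D `\` D°.

(** [m |-> |m_1| + ... + |m_d|] *)
Definition int_norm1 (m : 'rV[int]_d) : R := \sum_i `|(m 0 i)%:~R|.

Definition diophantine (tau : R) v : Prop :=
  0 < tau /\ exists2 C : R, 0 < C &
    forall m : 'rV[int]_d, m != 0 ->
      `|dot (map_mx intr m) v| > C * int_norm1 m `^ (- tau).

Definition Zd_periodic (T : Type) (g : 'rV[R]_d -> T) : Prop :=
  forall x (m : 'rV[int]_d), g (x + map_mx intr m) = g x.

(** [U] is meant to be open. *)
Fixpoint class_C (k : nat) (U : set 'rV[R]_d) (f : 'rV[R]_d -> R) : Prop :=
  match k with
  | 0 => forall x, U x -> {for x, continuous f}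
  | k'.+1 => (forall x, U x -> {for x, continuous f}) /\
      forall i, (forall x, U x -> derivable f x (basis_vec i)) /\
                class_C k' U (fun x => 'D_(basis_vec i) f x)
  end.

Section polygon.
Context (N : nat) (nu : 'I_N -> 'rV[R]_d) (c : 'I_N -> R).

Definition polygon : set 'rV[R]_d := [set x | forall j, dot (nu j) x > c j].

Definition face (k : 'I_N) : set 'rV[R]_d :=
  [set x | dot (nu k) x = c k /\ forall j, j != k -> dot (nu j) x > c j].

(** The last clause says that each hyperplane really bounds the domain; a
    half-space violating it can be dropped from the intersection. *)
Definition bounded_convex_polygonal : Prop :=
  [/\ forall j, dot (nu j) (nu j) = 1,
      polygon !=set0,
      bounded_set polygon &
      forall k, face k !=set0].

(** The (d-2)-dimensional piece of the boundary between two faces. *)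
Definition ridge (j k : 'I_N) : set 'rV[R]_d :=
  [set x | [/\ dot (nu j) x = c j, dot (nu k) x = c k &
              forall l, l != j -> l != k -> dot (nu l) x > c l]].

Definition adjacent (j k : 'I_N) : Prop := j != k /\ ridge j k !=set0.

(** The normals [nu j] point into the domain, so the interior dihedral angle
    is the supplement of the angle between the normals. *)
Definition dihedral_angle (j k : 'I_N) : R := pi - acos (dot (nu j) (nu k)).

Definition is_max_dihedral_angle (theta : R) : Prop :=
  (exists j k, adjacent j k /\ dihedral_angle j k = theta) /\
  (forall j k, adjacent j k -> dihedral_angle j k <= theta).

End polygon.

Section elliptic.
Variable A : 'rV[R]_d -> 'M[R]_d.

Definition uniformly_elliptic : Prop :=
  exists2 c : R, 0 < c & forall x xi,
    c^-1 * dot xi xi <= \sum_i \sum_j A x i j * xi 0 i * xi 0 j <= c * dot xi xi.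

Definition elliptic_op (u : 'rV[R]_d -> R) (x : 'rV[R]_d) : R :=
  - \sum_i 'D_(basis_vec i)
       (fun y => \sum_j A y i j * 'D_(basis_vec j) u y) x.

Definition real_dirichlet_solution D (phi u : 'rV[R]_d -> R) : Prop :=
  [/\ class_C 2 D u,
      {within closure D, continuous u},
      forall x, D x -> elliptic_op u x = 0 &
      forall x, boundary D x -> u x = phi x].

(** [A] is real, so the operator acts separately on real and imaginary parts. *)
Definition dirichlet_solution D (phi u : 'rV[R]_d -> R[i]) : Prop :=
  real_dirichlet_solution D (fun x => complex.Re (phi x))
                            (fun x => complex.Re (u x)) /\
  real_dirichlet_solution D (fun x => complex.Im (phi x))
                            (fun x => complex.Im (u x)).

End elliptic.

(** The average over the torus, computed on the fundamental cell [0, 1]^d. *)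
Definition unit_cube : set (d.-tuple R) :=
  [set t | forall i, 0 <= tnth t i <= 1].

Definition torus_mean (g : 'rV[R]_d -> R[i]) : R[i] :=
  Complex
    (Rintegral (lebesgue_tuple R d) unit_cube
       (fun t => complex.Re (g (rV_of_tuple t))))
    (Rintegral (lebesgue_tuple R d) unit_cube
       (fun t => complex.Im (g (rV_of_tuple t)))).

Definition Lp_norm (p : R) D (u : 'rV[R]_d -> R[i]) : \bar R :=
  Lnorm (lebesgue_tuple R d) p%:E
    ((fun t => (ComplexField.Normc.normc (u (rV_of_tuple t)))%:E)
       \_ (rV_of_tuple @^-1` D)).

End euclidean.

Definition gamma_exponent (R : realType) (d : nat) (alpha : R) : R :=
  (d%:R - 1) * Num.min 1 alpha / (d%:R - 1 + Num.min 1 alpha).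

(* Main.v *)
Require Import Defs.
From HB Require Import structures.
From mathcomp Require Import all_boot all_order all_algebra.
From mathcomp Require Import all_classical all_reals all_analysis.
From mathcomp.real_closed Require Import complex.
From mathcomp Require Import perm measurable_realfun.
From mathcomp Require Import ring lra zify.

Set Implicit Arguments.
Unset Strict Implicit.
Unset Printing Implicit Defensive.

Import Order.TTheory GRing.Theory Num.Theory.
Import numFieldNormedType.Exports.

Local Open Scope classical_set_scope.
Local Open Scope ring_scope.

(** Re and Im of [w = u_eps - u_0] solve [L w = 0] in [D] with boundary values
    [h (x / eps)], where [h] is periodic of mean zero.  Approximate [h] by a
    trigonometric polynomial without constant term.  Each mode [m] oscillates
    along the face [k] with frequency [|theta_tau| / eps], where the tangential
    part [theta_tau] of [2 pi m] is at least [C |m|^(- tau)] by the Diophantine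
    condition, so it is carried into [D] by a boundary layer corrector [F] of
    width comparable to [eps] with [F = O(eps / (d_k + eps))] and
    [L F = O(eps / (d_k + eps)^2)], [d_k] being the distance to the face [k].
    The sum of the correctors over all faces and modes misses the boundary data
    on the face [j] by [O(eps / (d_k + eps))], [k <> j].  Two barriers absorb
    these errors in the maximum principle: [ln (d_k + eps)], on which [L] is at
    least [C / (d_k + eps)^2], and, for each pair of faces, an almost
    [L]-harmonic function comparable to [1 / (d_j + d_k + eps)].  This gives
    [|w| <= C (eps ln (1 / eps) + \sum_k eps / (d_k + eps))], hence
    [|w| <= C eps^s (1 + \sum_k d_k^(- s))] for every [s < 1], and the right-hand
    side lies in [L^p(D)] as long as [s p < 1]. *)

(** * Twice differentiable functions of several variables *)

Section calculus.
Context (R : realType) (d : nat).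
Local Notation V := 'rV[R]_d.
Local Notation e_ := (@basis_vec R d).
Implicit Types (f g : V -> R) (x y v h : V) (U : set V).

(** What shapes the proof is uniformity over all frequencies at once. The constant of a corrector
    grows like a fixed power of [|m|], because the decay rate of its layer is proportional to a
    tangential frequency that may be small. Hence the data are approximated to accuracy [eps] by
    cosines whose coefficients, weighted by that power of [|m|], have a sum bounded independently of
    the accuracy; this is what fixes the smoothness. The second obstacle is the ridges, where the
    layer of one face meets another face. The exponential layers, whose rates depend on [m], are
    therefore all bounded by the single profile [eps / (d + eps)], and explicit barriers exist for
    that profile: the operator error [eps / (d + eps)^2] is of the kind a logarithm absorbs, at the
    price of [ln (1 / eps)], and the error on other faces is a multiple of what a Kelvin transform
    dominates. Distances are shifted by [eps] in the barriers, so these are twice differentiable on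
    a neighbourhood of the closed domain, ridges included, and the maximum principle asks only
    continuity of the solutions up to the boundary. *)

Lemma normrV_le (h : V) (r : R) :
  0 <= r -> (forall i, `|h 0 i| <= r) -> `|h| <= r.
Proof.
move=> r0 hr; rewrite /Num.Def.normr/= mx_normrE.
by apply: bigmax_le => // -[i j] _ /=; rewrite (ord1 i).
Qed.

Lemma coord_le_normrV (h : V) (i : 'I_d) : `|h 0 i| <= `|h|.
Proof.
rewrite [leRHS]/Num.Def.normr/= mx_normrE.
exact: (le_bigmax _ (fun p : 'I_1 * 'I_d => `|h p.1 p.2|) (ord0, i)).
Qed.

Definition dotl v x : R := dot v x.

Lemma dotl_is_linear v : linear (dotl v).
Proof.
move=> k x y; rewrite /dotl /dot -[k *: (\sum_i _)]/(k * (\sum_i _)) mulr_sumr -big_split /=.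
by apply: eq_bigr => i _; rewrite !mxE; ring.
Qed.
HB.instance Definition _ v :=
  GRing.isLinear.Build R V R _ (dotl v) (dotl_is_linear v).

Lemma dotl_continuous v : continuous (dotl v).
Proof.
move=> x; apply: differentiable_continuous.
have -> : dotl v = \sum_i (v 0 i \*o (fun y : V => y 0 i : R)).
  by apply/funext => y; rewrite /dotl /dot fct_sumE.
apply: differentiable_sum => i.
by apply: differentiableM => //; exact: differentiable_coord.
Qed.

(** The difference quotients of [f] restricted to a line are those of the directional derivative, so
    one-variable calculus applies along lines before total differentiability is known. *)
Lemma line_difference f x v (t : R) :
  (fun h : R => h^-1 *: (((fun s : R => f (x + s *: v)) \o shift t) (h *: (1 : R))
       - f (x + t *: v))) =
  (fun h : R => h^-1 *: ((f \o shift (x + t *: v)) (h *: v) - f (x + t *: v))).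
Proof.
apply/funext => h /=; congr (_ *: (f _ - _)).
by rewrite -[h *: 1]/(h * 1) mulr1 scalerDl addrCA.
Qed.

Lemma is_derive_line f x v (t : R) : derivable f (x + t *: v) v ->
  is_derive t (1 : R) (fun s : R => f (x + s *: v)) ('D_v f (x + t *: v)).
Proof.
move=> df; apply: DeriveDef.
  by rewrite /derivable line_difference.
by rewrite /derive line_difference.
Qed.

Lemma line_mvt f x v (s : R) :
  (forall t : R, `|t| <= `|s| -> derivable f (x + t *: v) v) ->
  exists2 t : R, `|t| <= `|s| & f (x + s *: v) - f x = s * 'D_v f (x + t *: v).
Proof.
move=> df; have fx0 : f x = f (x + 0 *: v) by rewrite scale0r addr0.
have [s0|s0] := leP 0 s.
- have H (t : R) : t \in `]0, s[ -> is_derive t (1 : R)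
      (fun s : R => f (x + s *: v)) ('D_v f (x + t *: v)).
    rewrite in_itv /= => /andP[t0 ts]; apply: is_derive_line; apply: df.
    by rewrite !ger0_norm ?(ltW t0)// ltW.
  have C : {within `[0, s], continuous (fun s : R => f (x + s *: v))}.
    apply: continuous_in_subspaceT => t; rewrite inE /= in_itv /= => /andP[t0 ts].
    apply: differentiable_continuous; apply/derivable1_diffP.
    apply: ex_derive; apply: is_derive_line; apply: df.
    by rewrite !ger0_norm.
  have [t] := MVT_segment s0 H C.
  rewrite in_itv /= => /andP[t0 ts] E; exists t; first by rewrite !ger0_norm.
  by rewrite fx0 E subr0 mulrC.
- have H (t : R) : t \in `]s, 0[ -> is_derive t (1 : R)
      (fun s : R => f (x + s *: v)) ('D_v f (x + t *: v)).
    rewrite in_itv /= => /andP[t0 ts]; apply: is_derive_line; apply: df.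
    by rewrite !ltr0_norm// lerN2 ltW.
  have C : {within `[s, 0], continuous (fun s : R => f (x + s *: v))}.
    apply: continuous_in_subspaceT => t; rewrite inE /= in_itv /= => /andP[t0 ts].
    apply: differentiable_continuous; apply/derivable1_diffP.
    apply: ex_derive; apply: is_derive_line; apply: df.
    by rewrite ler0_norm// ler0_norm ?lerN2// ltW.
  have [t] := MVT_segment (ltW s0) H C.
  rewrite in_itv /= => /andP[t0 ts] E; exists t.
    by rewrite ler0_norm// ler0_norm ?lerN2// ltW.
  by rewrite fx0 -opprB E sub0r mulrN opprK mulrC.
Qed.

(** The points [x + trunc h k] form a staircase from [x] to [x + h] with one step per coordinate
    axis. In the sup norm they stay within distance [|h|] of [x]. *)
Let trunc (h : V) (k : nat) : V := \row_i (if (i < k)%N then h 0 i else 0).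

Let truncS (h : V) (i : 'I_d) : trunc h i.+1 = trunc h i + h 0 i *: e_ i.
Proof.
apply/rowP => j; rewrite !mxE ltnS leq_eqVlt eqxx /=.
have [->|ji] := eqVneq j i; first by rewrite eqxx ltnn/= mulr1 add0r.
by move: ji; rewrite -val_eqE => /negbTE ->; rewrite mulr0 addr0.
Qed.

(** Telescope along the staircase [trunc] and apply the mean value theorem on each step; continuity
    of the partial derivatives at [x] controls the intermediate points. *)
Lemma C1_first_order f x (eta : R) : 0 < eta ->
  (forall i, \forall y \near x, derivable f y (e_ i)) ->
  (forall i, {for x, continuous ('D_(e_ i) f)}) ->
  \forall h \near (0 : V),
    `|f (x + h) - f x - \sum_i h 0 i * 'D_(e_ i) f x| <= eta * `|h|.
Proof.
move=> eta0 df cf.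
(* The tolerance is shared as [eta / d.+1], which also makes sense for [d = 0]. *)
have d1 : 0 < d.+1%:R :> R by [].
pose P (i : 'I_d) y := derivable f y (e_ i) /\
    `|'D_(e_ i) f y - 'D_(e_ i) f x| <= eta / d.+1%:R.
have PN (i : 'I_d) : \forall y \near x, P i y.
  apply: filterI; first exact: df.
  have /cvgrPdist_le := cf i => /(_ (eta / d.+1%:R) (divr_gt0 eta0 d1)).
  by move=> H; near=> y; rewrite distrC; near: y; exact: H.
have := @filter_forall _ _ P (nbhs x) (nbhs_filter x) PN.
move=> /nbhs_ballP[r /= r0 Hr].
near=> h; have hr : `|h| < r.
  by near: h; apply/nbhs_ballP; exists r => //= h; rewrite -ball_normE/= sub0r normrN.
have E0 : trunc h 0 = 0 by apply/rowP => j; rewrite !mxE.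
have Ed : trunc h d = h by apply/rowP => j; rewrite !mxE ltn_ord.
have -> : f (x + h) - f x = \sum_(i < d) (f (x + trunc h i.+1) - f (x + trunc h i)).
  have fx0 : f x = f (x + trunc h 0) by rewrite E0 addr0.
  have := telescope_sumr (fun k => f (x + trunc h k)) (leq0n d).
  by rewrite big_mkord /= Ed fx0 => ->.
rewrite -sumrB (le_trans (ler_norm_sum _ _ _))//.
have bnd (i : 'I_d) : `|f (x + trunc h i.+1) - f (x + trunc h i) -
    h 0 i * 'D_(e_ i) f x| <= eta / d.+1%:R * `|h|.
  have B (t : R) : `|t| <= `|h 0 i| -> ball x r (x + trunc h i + t *: e_ i).
    move=> th; rewrite -ball_normE/= !opprD !addrA subrr add0r -opprD normrN.
    apply: le_lt_trans hr; apply: normrV_le => // j; rewrite !mxE eqxx/=.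
    have [->|ji] := eqVneq j i.
      by rewrite ltnn add0r mulr1 (le_trans th)// coord_le_normrV.
    by rewrite mulr0 addr0; case: ifP; rewrite ?normr0// coord_le_normrV.
  have [t th] : exists2 t : R, `|t| <= `|h 0 i| & f (x + trunc h i + h 0 i *: e_ i) -
      f (x + trunc h i) = h 0 i * 'D_(e_ i) f (x + trunc h i + t *: e_ i).
    by apply: line_mvt => t /B /Hr /(_ i)[].
  rewrite truncS addrA => ->; rewrite -mulrBr normrM mulrC.
  apply: ler_pM => //; last exact: coord_le_normrV.
  by have [_] := Hr _ (B _ th) i.
rewrite (le_trans (ler_sum _ (fun i _ => bnd i)))//.
rewrite sumr_const card_ord -[leLHS]mulr_natl.
have aux (a b c k : R) : a * (b / c * k) = a / c * (b * k) by ring.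
rewrite aux.
rewrite ler_piMl// ?mulr_ge0 ?(ltW eta0)//.
by rewrite ler_pdivrMr// mul1r ler_nat.
Unshelve. all: by end_near. Qed.

Let gradv f x : V := \row_i 'D_(e_ i) f x.

Lemma C1_diff f x :
  (forall i, \forall y \near x, derivable f y (e_ i)) ->
  (forall i, {for x, continuous ('D_(e_ i) f)}) ->
  differentiable f x.
Proof.
move=> df cf.
have Hlin : f \o shift x = cst (f x) + dotl (gradv f x) +o_ (0 : V) id.
  apply/eqaddoP => eta eta0.
  near=> h.
  have H : `|f (x + h) - f x - \sum_i h 0 i * 'D_(e_ i) f x| <= eta * `|h|.
    by near: h; exact: C1_first_order.
  rewrite /= -[X in `|X|]/(f (h + x) - (f x + dotl (gradv f x) h)) opprD addrA addrC addrC.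
  rewrite [h + x]addrC; apply: le_trans H; rewrite le_eqVlt; apply/orP; left; apply/eqP.
  congr (`|_ - _|); rewrite /dotl /dot; apply: eq_bigr => i _.
  by rewrite mxE mulrC.
have E := diff_unique (@dotl_continuous (gradv f x)) Hlin.
apply/diff_locallyP; split; first by rewrite E; exact: dotl_continuous.
by rewrite E.
Unshelve. all: by end_near. Qed.

Lemma rV_basis v : v = \sum_i v 0 i *: e_ i.
Proof. exact: row_sum_delta. Qed.

Lemma derive_sum_partial f x v : differentiable f x ->
  'D_v f x = \sum_i v 0 i * 'D_(e_ i) f x.
Proof.
move=> df; rewrite deriveE// {1}(rV_basis v) linear_sum; apply: eq_bigr => i _.
by rewrite linearZ /= deriveE.
Qed.

End calculus.
HB.lock Definition grad (R : realType) (d : nat) (f : 'rV[R]_d -> R) (x : 'rV[R]_d) :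
  'rV[R]_d := \row_i 'D_(basis_vec R i) f x.
HB.lock Definition hess (R : realType) (d : nat) (f : 'rV[R]_d -> R) (x : 'rV[R]_d) :
  'M[R]_d := \matrix_(i, j) 'D_(basis_vec R i) ('D_(basis_vec R j) f) x.
Arguments grad [R d]. 
Arguments hess [R d].

(** * The class of twice differentiable functions and its rules *)

Section C2.
Context (R : realType) (d : nat).
Local Notation V := 'rV[R]_d.
Local Notation e_ := (@basis_vec R d).
Implicit Types (f g : V -> R) (x y v h : V) (U : set V).

(** Continuity of the second derivatives is not part of this class: total differentiability of [f]
    and of its partial derivatives passes through sums, products and compositions, and already makes
    the Hessian symmetric. *)
Definition C2 U f := forall x, U x ->
  differentiable f x /\ forall i, differentiable ('D_(e_ i) f) x.

Definition outer (u v : V) : 'M[R]_d := \matrix_(i, j) (u 0 i * v 0 j).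

Lemma gradE f x i : grad f x 0 i = 'D_(e_ i) f x.
Proof. by rewrite grad.unlock mxE. Qed.

Lemma hessE f x i j : hess f x i j = 'D_(e_ i) ('D_(e_ j) f) x.
Proof. by rewrite hess.unlock mxE. Qed.

Lemma outerE u v i j : outer u v i j = u 0 i * v 0 j.
Proof. by rewrite /outer mxE. Qed.

Lemma near_open U x : open U -> U x -> \forall y \near x, U y.
Proof. by move=> oU Ux; apply: open_nbhs_nbhs. Qed.

Lemma class_C1_differentiable U f : open U -> class_C 1 U f ->
  forall x, U x -> differentiable f x.
Proof.
move=> oU [_ df] x Ux; apply: C1_diff => i.
  by near=> y; have [+ _] := df i; apply; near: y; exact: near_open.
by have [_ /= c] := df i; exact: c.
Unshelve. all: by end_near. Qed.

Lemma class_C2_C2 U f : open U -> class_C 2 U f -> C2 U f.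
Proof.
move=> oU [cf df] x Ux; split; last first.
  by move=> i; have [_ c] := df i; exact: (class_C1_differentiable oU c).
apply: (class_C1_differentiable oU _ Ux); split => // i.
by have [? [c _]] := df i; split.
Qed.

Lemma C2_sub U U' f : U' `<=` U -> C2 U f -> C2 U' f.
Proof. by move=> UU cf x /UU /cf. Qed.

Lemma C2_continuous U f x : C2 U f -> U x -> {for x, continuous f}.
Proof. by move=> cf /cf[/differentiable_continuous]. Qed.

(** Differentiability is local. The partial derivatives of a product or of a composite are given by
    a formula only on the open set [U], that is, only near [x]. *)
Lemma near_eq_differentiable f g x : differentiable f x ->
  {near x, f =1 g} -> differentiable g x.
Proof.
move=> df fg.
have E : g \o shift x = cst (g x) + 'd f x +o_ (0 : V) id.
  apply/eqaddoP => eta eta0; near=> h.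
  have -> : (g \o shift x - (cst (g x) + 'd f x)) h =
            (f \o shift x - (cst (f x) + 'd f x)) h.
    rewrite /= -![(_ - _ : _ -> _) _]/(_ - _) -![(_ + _ : _ -> _) _]/(_ + _) /cst /=.
    congr (_ - (_ + _)); last by rewrite (nbhs_singleton fg).
    apply/esym; near: h; move: (fg); rewrite (near_shift 0 x).
    by apply: filterS => h /=; rewrite subr0.
  near: h; move: eta eta0; apply/eqaddoP.
  by have /diff_locallyP[] := df.
apply/diff_locallyP; have E' := diff_unique (diff_continuous df) E.
by split; rewrite E' => //; exact: diff_continuous.
Unshelve. all: by end_near. Qed.

Section rules.
Variable U : set V.
Hypothesis oU : open U.

Lemma C2_cst (k : R) : C2 U (cst k).
Proof.
move=> x _; split => // i.
have -> : 'D_(e_ i) (cst k : V -> R) = cst 0 by apply/funext => y; exact: derive_cst.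
exact: differentiable_cst.
Qed.

Lemma grad_cst (k : R) x : grad (cst k) x = 0.
Proof. by apply/rowP => i; rewrite gradE derive_cst mxE. Qed.

Lemma hess_cst (k : R) x : hess (cst k) x = 0.
Proof.
apply/matrixP => i j; rewrite hessE [RHS]mxE.
have -> : 'D_(e_ j) (cst k : V -> R) = cst 0 by apply/funext => y; exact: derive_cst.
exact: derive_cst.
Qed.

Lemma derive_dotl v i x : 'D_(e_ i) (dotl v) x = v 0 i.
Proof.
rewrite deriveE; last exact/linear_differentiable/dotl_continuous.
rewrite diff_lin; last exact: dotl_continuous.
transitivity (dot v (e_ i)) => //.
rewrite /dot (bigD1 i)//= mxE !eqxx mulr1 big1 ?addr0// => j ji.
by rewrite mxE (negbTE ji) andbF mulr0.
Qed.

Lemma derive_dotl_fun v i : 'D_(e_ i) (dotl v) = cst (v 0 i).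
Proof. by apply/funext => x; exact: derive_dotl. Qed.

Lemma C2_dotl v : C2 U (dotl v).
Proof.
move=> x _; split; first exact/linear_differentiable/dotl_continuous.
by move=> i; rewrite derive_dotl_fun; exact: differentiable_cst.
Qed.

Lemma grad_dotl v x : grad (dotl v) x = v.
Proof. by apply/rowP => i; rewrite gradE derive_dotl. Qed.

Lemma hess_dotl v x : hess (dotl v) x = 0.
Proof.
by apply/matrixP => i j; rewrite hessE derive_dotl_fun derive_cst mxE.
Qed.

Lemma C2_derivable f x v : C2 U f -> U x -> derivable f x v.
Proof. by move=> cf /cf[df _]; exact: diff_derivable. Qed.

Lemma C2_derivable2 f x v i : C2 U f -> U x -> derivable ('D_(e_ i) f) x v.
Proof. by move=> cf /cf[_ df]; exact: diff_derivable. Qed.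

Lemma near_derivD f g i x : C2 U f -> C2 U g -> U x ->
  {near x, 'D_(e_ i) f + 'D_(e_ i) g =1 'D_(e_ i) (f + g)}.
Proof.
move=> cf cg Ux; near=> y.
have Uy : U y by near: y; exact: near_open.
by rewrite deriveD//; exact: C2_derivable.
Unshelve. all: by end_near. Qed.

Lemma C2D f g : C2 U f -> C2 U g -> C2 U (f + g).
Proof.
move=> cf cg x Ux; have [df ddf] := cf _ Ux; have [dg ddg] := cg _ Ux.
split; first exact: differentiableD.
by move=> i; apply: near_eq_differentiable (near_derivD i cf cg Ux); exact: differentiableD.
Qed.

Lemma gradD f g x : C2 U f -> C2 U g -> U x -> grad (f + g) x = grad f x + grad g x.
Proof.
move=> cf cg Ux; apply/rowP => i; rewrite [RHS]mxE (gradE (f + g)) (gradE f) (gradE g).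
by rewrite deriveD//; exact: C2_derivable.
Qed.

Lemma hessD f g x : C2 U f -> C2 U g -> U x -> hess (f + g) x = hess f x + hess g x.
Proof.
move=> cf cg Ux; apply/matrixP => i j; rewrite [RHS]mxE (hessE (f + g)) (hessE f) (hessE g).
rewrite -(near_eq_derive _ (near_derivD j cf cg Ux)) deriveD//; exact: C2_derivable2.
Qed.

Lemma near_derivM f g i x : C2 U f -> C2 U g -> U x ->
  {near x, f * 'D_(e_ i) g + g * 'D_(e_ i) f =1 'D_(e_ i) (f * g)}.
Proof.
move=> cf cg Ux; near=> y.
have Uy : U y by near: y; exact: near_open.
by rewrite deriveM//; exact: C2_derivable.
Unshelve. all: by end_near. Qed.

Let hessM_aux (a b p q r s t k : R) :
  a *: p + q *: r + (b *: s + t *: k) = a * p + b * s + (r * q + k * t).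
Proof. by rewrite /GRing.scale /=; ring. Qed.

Let hess_comp_aux (a b p q r : R) : a *: p + q *: (b * r) = a * p + b * (r * q).
Proof. by rewrite /GRing.scale /=; ring. Qed.

Lemma C2M f g : C2 U f -> C2 U g -> C2 U (f * g).
Proof.
move=> cf cg x Ux; have [df ddf] := cf _ Ux; have [dg ddg] := cg _ Ux.
split; first exact: differentiableM.
move=> i; apply: near_eq_differentiable (near_derivM i cf cg Ux).
by apply: differentiableD; exact: differentiableM.
Qed.

Lemma gradM f g x : C2 U f -> C2 U g -> U x ->
  grad (f * g) x = f x *: grad g x + g x *: grad f x.
Proof.
move=> cf cg Ux; apply/rowP => i; rewrite [RHS]mxE [X in _ = X + _]mxE.
rewrite [X in _ = _ + X]mxE (gradE (f * g)) (gradE f) (gradE g).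
by rewrite deriveM//; exact: C2_derivable.
Qed.

Lemma hessM f g x : C2 U f -> C2 U g -> U x ->
  hess (f * g) x = f x *: hess g x + g x *: hess f x +
    (outer (grad f x) (grad g x) + outer (grad g x) (grad f x)).
Proof.
move=> cf cg Ux; apply/matrixP => i j.
rewrite [RHS]mxE [X in _ = X + _]mxE [X in _ = X + _ + _]mxE [X in _ = _ + X + _]mxE.
rewrite [X in _ = _ + X]mxE outerE outerE (gradE f) (gradE g) (gradE f) (gradE g).
rewrite (hessE (f * g)) (hessE f) (hessE g).
have [df ddf] := cf _ Ux; have [dg ddg] := cg _ Ux.
rewrite -(near_eq_derive _ (near_derivM j cf cg Ux)).
rewrite deriveD; [|exact/diff_derivable/differentiableM..].
rewrite !deriveM; [|exact: diff_derivable..].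
exact: hessM_aux.
Qed.

Section comp.
Variables (h h1 h2 : R -> R) (f : V -> R).
Hypothesis cf : C2 U f.
Hypothesis dh : forall x, U x -> is_derive (f x) (1 : R) h (h1 (f x)).
Hypothesis dh1 : forall x, U x -> is_derive (f x) (1 : R) h1 (h2 (f x)).

Lemma differentiable_comp1 x : U x -> differentiable (h \o f) x.
Proof.
move=> Ux; have [df _] := cf Ux; apply: differentiable_comp => //.
by apply/derivable1_diffP; apply: ex_derive; exact: dh.
Qed.

Lemma derive_comp1 x v : U x -> 'D_v (h \o f) x = h1 (f x) * 'D_v f x.
Proof.
move=> Ux; have [df _] := cf Ux.
have dhf : differentiable h (f x).
  by apply/derivable1_diffP; apply: ex_derive; exact: dh.
rewrite deriveE; last exact: differentiable_comp1.
transitivity ('d h (f x) ('d f x v)); first by rewrite diff_comp.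
have := congr1 (fun k : R -> R => k ('d f x v)) (diff1E dhf).
rewrite derive1E (@derive_val _ _ _ _ _ _ _ (dh Ux)) => ->.
by rewrite (deriveE _ df) [LHS]mulrC.
Qed.

Lemma near_derive_comp i x : U x ->
  {near x, (h1 \o f) * 'D_(e_ i) f =1 'D_(e_ i) (h \o f)}.
Proof.
move=> Ux; near=> y; have Uy : U y by near: y; exact: near_open.
by rewrite derive_comp1.
Unshelve. all: by end_near. Qed.

End comp.

Section comp2.
Variables (h h1 h2 : R -> R) (f : V -> R).
Hypothesis cf : C2 U f.
Hypothesis dh : forall x, U x -> is_derive (f x) (1 : R) h (h1 (f x)).
Hypothesis dh1 : forall x, U x -> is_derive (f x) (1 : R) h1 (h2 (f x)).

(** The derivatives of [h] are required only at the values of [f] on [U]; this admits the inverse,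
    the square root and the logarithm. *)
Lemma C2_comp : C2 U (h \o f).
Proof.
move=> x Ux; split; first exact: (differentiable_comp1 cf dh).
move=> i; apply: near_eq_differentiable (near_derive_comp cf dh i Ux).
apply: differentiableM; first exact: (differentiable_comp1 cf dh1).
by have [_] := cf Ux.
Qed.

Lemma grad_comp x : U x -> grad (h \o f) x = h1 (f x) *: grad f x.
Proof.
by move=> Ux; apply/rowP => i; rewrite [RHS]mxE (gradE (h \o f)) (gradE f) (derive_comp1 cf dh).
Qed.

Lemma hess_comp x : U x -> hess (h \o f) x =
  h1 (f x) *: hess f x + h2 (f x) *: outer (grad f x) (grad f x).
Proof.
move=> Ux; apply/matrixP => i j.
rewrite [RHS]mxE [X in _ = X + _]mxE [X in _ = _ + X]mxE outerE (gradE f) (gradE f).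
rewrite (hessE (h \o f)) (hessE f).
have [df ddf] := cf Ux.
rewrite -(near_eq_derive _ (near_derive_comp cf dh j Ux)).
rewrite deriveM; [|exact/diff_derivable/(differentiable_comp1 cf dh1)|exact: diff_derivable].
rewrite (derive_comp1 cf dh1)//; exact: hess_comp_aux.
Qed.

End comp2.
End rules.
End C2.
(** * The elliptic operator *)

Section elliptic_rules.
Context (R : realType) (d : nat).
Local Notation V := 'rV[R]_d.
Local Notation e_ := (@basis_vec R d).
Variable A : V -> 'M[R]_d.
Hypothesis dA : forall i j x, differentiable (fun y => A y i j) x.
Implicit Types (f g : V -> R) (x y u v w : V) (U : set V) (H : 'M[R]_d).

(** The first order coefficients of the operator once it is written in non-divergence form. *)
Definition divA x : V := \row_j \sum_i 'D_(e_ i) (fun y => A y i j) x.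
Definition trA x H : R := \sum_i \sum_j A x i j * H i j.
(** The bilinear form of the symmetric part of [A], which need not be symmetric itself. It is the
    cross term of the product rule, since the Hessian of a product contributes
    [outer u v + outer v u]. *)
Definition qA x v w : R :=
  \sum_i \sum_j A x i j * ((v 0 i * w 0 j + w 0 i * v 0 j) / 2).

Lemma qAC x v w : qA x v w = qA x w v.
Proof.
by apply: eq_bigr => i _; apply: eq_bigr => j _; rewrite [X in X / 2]addrC.
Qed.

Lemma qADl x u v w : qA x (u + v) w = qA x u w + qA x v w.
Proof.
rewrite /qA -big_split /=; apply: eq_bigr => i _; rewrite -big_split /=.
by apply: eq_bigr => j _; rewrite !mxE; field.
Qed.

Lemma qAZl x k v w : qA x (k *: v) w = k * qA x v w.
Proof.
rewrite /qA mulr_sumr; apply: eq_bigr => i _; rewrite mulr_sumr.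
by apply: eq_bigr => j _; rewrite !mxE; field.
Qed.

Lemma qA0l x w : qA x 0 w = 0.
Proof. by rewrite -(scale0r (0 : V)) qAZl mul0r. Qed.

Lemma qADr x u v w : qA x w (u + v) = qA x w u + qA x w v.
Proof. by rewrite qAC qADl !(qAC x w). Qed.

Lemma qAZr x k v w : qA x w (k *: v) = k * qA x w v.
Proof. by rewrite qAC qAZl (qAC x w). Qed.

Lemma qANl x v w : qA x (- v) w = - qA x v w.
Proof. by rewrite -scaleN1r qAZl mulN1r. Qed.

Lemma qANr x v w : qA x v (- w) = - qA x v w.
Proof. by rewrite -scaleN1r qAZr mulN1r. Qed.

Lemma trAD x H H' : trA x (H + H') = trA x H + trA x H'.
Proof.
rewrite /trA -big_split /=; apply: eq_bigr => i _; rewrite -big_split /=.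
by apply: eq_bigr => j _; rewrite mxE mulrDr.
Qed.

Lemma trAZ x k H : trA x (k *: H) = k * trA x H.
Proof.
rewrite /trA mulr_sumr; apply: eq_bigr => i _; rewrite mulr_sumr.
by apply: eq_bigr => j _; rewrite mxE mulrCA.
Qed.

Lemma trA0 x : trA x 0 = 0.
Proof. by rewrite -(scale0r 0) trAZ mul0r. Qed.

Lemma trA_outer x u v : trA x (outer u v + outer v u) = 2 * qA x u v.
Proof.
rewrite /trA /qA mulr_sumr; apply: eq_bigr => i _; rewrite mulr_sumr.
by apply: eq_bigr => j _; rewrite mxE !outerE; field.
Qed.

Lemma trA_outer1 x u : trA x (outer u u) = qA x u u.
Proof.
rewrite /trA /qA; apply: eq_bigr => i _.
by apply: eq_bigr => j _; rewrite !outerE; field.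
Qed.

Lemma dotDr u v w : dot u (v + w) = dot u v + dot u w.
Proof. by rewrite /dot -big_split /=; apply: eq_bigr => i _; rewrite mxE mulrDr. Qed.

Lemma dotZr k u v : dot u (k *: v) = k * dot u v.
Proof. by rewrite /dot mulr_sumr; apply: eq_bigr => i _; rewrite mxE mulrCA. Qed.

Lemma dotC u v : dot u v = dot v u.
Proof. by apply: eq_bigr => i _; rewrite mulrC. Qed.

Lemma dotDl u v w : dot (u + v) w = dot u w + dot v w.
Proof. by rewrite dotC dotDr !(dotC w). Qed.

Lemma dotZl k u v : dot (k *: u) v = k * dot u v.
Proof. by rewrite dotC dotZr dotC. Qed.

Lemma dot0r u : dot u 0 = 0.
Proof. by rewrite -(scale0r 0) dotZr mul0r. Qed.

Lemma elliptic_opE U f x : C2 U f -> U x ->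
  elliptic_op A f x = - (dot (divA x) (grad f x) + trA x (hess f x)).
Proof.
move=> cf Ux; have [df ddf] := cf _ Ux.
rewrite /elliptic_op; congr (- _).
have D i j : derivable ((fun y => A y i j) * ('D_(e_ j) f)) x (e_ i).
  by apply: diff_derivable; exact: differentiableM.
have E i : 'D_(e_ i) (fun y => \sum_j A y i j * 'D_(e_ j) f y) x =
  \sum_j (A x i j * 'D_(e_ i) ('D_(e_ j) f) x +
         'D_(e_ j) f x * 'D_(e_ i) (fun y => A y i j) x).
  have -> : (fun y => \sum_j A y i j * 'D_(e_ j) f y) =
     \sum_j ((fun y => A y i j) * ('D_(e_ j) f)).
    by apply/funext => y; rewrite fct_sumE.
  rewrite derive_sum//; apply: eq_bigr => j _.
  by rewrite deriveM//; exact: diff_derivable.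
under eq_bigr do rewrite E big_split /=.
rewrite big_split /= addrC; congr (_ + _).
  rewrite exchange_big /=; apply: eq_bigr => j _.
  by rewrite gradE /divA mxE mulrC mulr_sumr.
by apply: eq_bigr => i _; apply: eq_bigr => j _; rewrite hessE.
Qed.

Section rules.
Variable U : set V.
Hypothesis oU : open U.

Lemma elliptic_opD f g x : C2 U f -> C2 U g -> U x ->
  elliptic_op A (f + g) x = elliptic_op A f x + elliptic_op A g x.
Proof.
move=> cf cg Ux; rewrite (elliptic_opE cf Ux) (elliptic_opE cg Ux).
rewrite (elliptic_opE (C2D oU cf cg) Ux) (gradD cf cg Ux) (hessD oU cf cg Ux).
by rewrite dotDr trAD; ring.
Qed.

Lemma elliptic_op_cst k x : U x -> elliptic_op A (cst k) x = 0.
Proof.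
move=> Ux; rewrite (elliptic_opE (@C2_cst _ _ U k) Ux) grad_cst hess_cst.
by rewrite dot0r trA0 addr0 oppr0.
Qed.

Lemma elliptic_op_dotl v x : U x -> elliptic_op A (dotl v) x = - dot (divA x) v.
Proof.
move=> Ux; rewrite (elliptic_opE (@C2_dotl _ _ U v) Ux) grad_dotl hess_dotl.
by rewrite trA0 addr0.
Qed.

Lemma elliptic_opM f g x : C2 U f -> C2 U g -> U x ->
  elliptic_op A (f * g) x = f x * elliptic_op A g x + g x * elliptic_op A f x -
    2 * qA x (grad f x) (grad g x).
Proof.
move=> cf cg Ux; rewrite (elliptic_opE cf Ux) (elliptic_opE cg Ux).
rewrite (elliptic_opE (C2M oU cf cg) Ux) (gradM cf cg Ux) (hessM oU cf cg Ux).
by rewrite dotDr !dotZr trAD trA_outer trAD !trAZ; ring.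
Qed.

Lemma elliptic_opZ k f x : C2 U f -> U x ->
  elliptic_op A (cst k * f) x = k * elliptic_op A f x.
Proof.
move=> cf Ux; rewrite (elliptic_opM (@C2_cst _ _ U k) cf Ux).
by rewrite (elliptic_op_cst _ Ux) grad_cst qA0l /cst; ring.
Qed.

Lemma elliptic_op_comp (h h1 h2 : R -> R) f x : C2 U f ->
  (forall x, U x -> is_derive (f x) (1 : R) h (h1 (f x))) ->
  (forall x, U x -> is_derive (f x) (1 : R) h1 (h2 (f x))) -> U x ->
  elliptic_op A (h \o f) x = h1 (f x) * elliptic_op A f x -
    h2 (f x) * qA x (grad f x) (grad f x).
Proof.
move=> cf dh dh1 Ux; rewrite (elliptic_opE cf Ux).
rewrite (elliptic_opE (C2_comp oU cf dh dh1) Ux).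
rewrite (grad_comp cf dh Ux) (hess_comp oU cf dh dh1 Ux).
by rewrite !dotZr trAD !trAZ trA_outer1; ring.
Qed.

End rules.
End elliptic_rules.
(** Gaussian elimination in place of the spectral theorem: [a] is a positive multiple of a rank-one
    square plus a form in the remaining variables that is again positive definite, and induction
    applies to the latter. *)
Lemma trace_mul_le0 (R : realFieldType) (n : nat) (a H : 'I_n -> 'I_n -> R) :
  (forall i j, a i j = a j i) ->
  (forall xi : 'I_n -> R, (exists i, xi i != 0) ->
     0 < \sum_i \sum_j a i j * (xi i * xi j)) ->
  (forall xi : 'I_n -> R, \sum_i \sum_j H i j * (xi i * xi j) <= 0) ->
  \sum_i \sum_j a i j * H i j <= 0.
Proof.
elim: n a H => [|n IH] a H asym apos Hneg; first by rewrite big_ord0.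
have a00 : 0 < a ord0 ord0.
  have := apos (fun i => (i == ord0)%:R); rewrite (bigD1 ord0)//= (bigD1 ord0)//=.
  rewrite !big1 ?addr0 ?eqxx ?mulr1.
  - by apply; exists ord0; rewrite eqxx oner_eq0.
  - by move=> i /negbTE ->; rewrite big1// => j _; rewrite mul0r mulr0.
  - by move=> i /negbTE ->; rewrite !mulr0.
pose b (i j : 'I_n.+1) := a i j - a i ord0 * a ord0 j / a ord0 ord0.
have b0 j : b ord0 j = 0 by rewrite /b; field; rewrite gt_eqF.
have b0' i : b i ord0 = 0 by rewrite /b; field; rewrite gt_eqF.
have bE (F : 'I_n.+1 -> 'I_n.+1 -> R) : \sum_i \sum_j b i j * F i j =
   \sum_i \sum_j b (lift ord0 i) (lift ord0 j) * F (lift ord0 i) (lift ord0 j).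
  rewrite big_ord_recl big1 ?add0r; last by move=> j _; rewrite b0 mul0r.
  apply: eq_bigr => i _; rewrite big_ord_recl b0' mul0r add0r.
  by apply: eq_bigr.
have aE (F : 'I_n.+1 -> 'I_n.+1 -> R) : \sum_i \sum_j a i j * F i j =
   (a ord0 ord0)^-1 * (\sum_i \sum_j F i j * (a ord0 i * a ord0 j)) +
   \sum_i \sum_j b i j * F i j.
  rewrite mulr_sumr -big_split /=; apply: eq_bigr => i _.
  rewrite mulr_sumr -big_split /=; apply: eq_bigr => j _.
  rewrite /b (asym i ord0); field; by rewrite gt_eqF.
rewrite aE bE -[leRHS]addr0 lerD//.
  by rewrite mulr_ge0_le0// invr_ge0 ltW.
apply: IH.
- by move=> i j; rewrite /b (asym (lift _ _)) !(asym _ ord0); ring.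
- move=> xi [i xi0].
  pose s := \sum_j a ord0 (lift ord0 j) * xi j.
  (* This coordinate annihilates the rank-one part, so the value of [a] at [xi'] is the value of [b]
     at [xi]. *)
  pose xi' (i : 'I_n.+1) := if unlift ord0 i is Some j then xi j else - s / a ord0 ord0.
  have xiS j : xi' (lift ord0 j) = xi j by rewrite /xi' liftK.
  have := apos xi'; rewrite aE bE.
  have -> : \sum_i \sum_j xi' i * xi' j * (a ord0 i * a ord0 j) =
     (\sum_i a ord0 i * xi' i) ^+ 2.
    rewrite expr2 mulr_suml; apply: eq_bigr => k _; rewrite mulr_sumr.
    by apply: eq_bigr => j _; ring.
  have -> : \sum_i a ord0 i * xi' i = 0.
    rewrite big_ord_recl; under eq_bigr do rewrite xiS.
    rewrite -/s /xi' unlift_none; field; by rewrite gt_eqF.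
  rewrite expr0n mulr0 add0r.
  under eq_bigr do under eq_bigr do rewrite !xiS.
  by apply; exists (lift ord0 i); rewrite xiS.
- move=> xi.
  pose xi' (i : 'I_n.+1) := if unlift ord0 i is Some j then xi j else 0.
  have xiS j : xi' (lift ord0 j) = xi j by rewrite /xi' liftK.
  have x0 : xi' ord0 = 0 by rewrite /xi' unlift_none.
  have := Hneg xi'; rewrite big_ord_recl big1 ?add0r; last first.
    by move=> j _; rewrite x0 mul0r mulr0.
  under eq_bigr do rewrite big_ord_recl x0 !mulr0 add0r.
  by under eq_bigr do under eq_bigr do rewrite !xiS.
Qed.

(** * Symmetry of the Hessian and necessary conditions at a maximum *)

Section second_order.
Context (R : realType) (d : nat).
Local Notation V := 'rV[R]_d.
Local Notation e_ := (@basis_vec R d).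
Implicit Types (f g : V -> R) (x y u v w : V) (U : set V).

Lemma diff_first_order f x (eta : R) : 0 < eta -> differentiable f x ->
  \forall h \near (0 : V), `|f (x + h) - f x - \sum_i h 0 i * 'D_(e_ i) f x| <= eta * `|h|.
Proof.
move=> eta0 df; have /diff_locallyP[_ E] := df.
have /eqaddoP/(_ eta eta0) := E; apply: filterS => h /=.
rewrite -![(_ - _ : _ -> _) _]/(_ - _) -![(_ + _ : _ -> _) _]/(_ + _) /cst /=.
rewrite [h + x]addrC opprD addrA => H; apply: le_trans H.
by rewrite -(derive_sum_partial _ df) deriveE.
Qed.

Lemma normr_basis_vec (i : 'I_d) : `|e_ i| <= 1.
Proof.
by apply: normrV_le => // j; rewrite mxE normr_nat lern1 leq_b1.
Qed.

Lemma near0_ball (P : V -> Prop) : (\forall h \near (0 : V), P h) ->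
  exists2 r : R, 0 < r & forall h, `|h| < r -> P h.
Proof.
move=> /nbhs_ballP[r /= r0 Hr]; exists r => // h hr; apply: Hr.
by rewrite -ball_normE /= sub0r normrN.
Qed.

Lemma translate_quotient f x a v :
  (fun h : R => h^-1 *: (((fun y => f (y + a)) \o shift x) (h *: v) - f (x + a))) =
  (fun h : R => h^-1 *: ((f \o shift (x + a)) (h *: v) - f (x + a))).
Proof. by apply/funext => h /=; rewrite addrA. Qed.

Lemma derive_translate f x a v : 'D_v (fun y => f (y + a)) x = 'D_v f (x + a).
Proof. by rewrite /derive translate_quotient. Qed.

Lemma derivable_translate f x a v :
  derivable f (x + a) v -> derivable (fun y => f (y + a)) x v.
Proof. by rewrite /derivable translate_quotient. Qed.

(** The mean value theorem in the direction [e_ i], applied to [g y = f (y + t *: e_ j) - f y],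
    reduces the second difference to an increment of ['D_(e_ i) f], which is expanded to first order
    at [x]. *)
Lemma second_difference U f x i j (eta : R) : open U -> C2 U f -> U x -> 0 < eta ->
  exists2 r : R, 0 < r & forall t : R, 0 < t < r ->
    `|f (x + t *: e_ i + t *: e_ j) - f (x + t *: e_ i) - (f (x + t *: e_ j) - f x)
      - t ^+ 2 * 'D_(e_ j) ('D_(e_ i) f) x| <= eta * t ^+ 2.
Proof.
move=> oU cf Ux eta0.
have [df ddf] := cf _ Ux.
(* The two points of expansion lie at distance at most [2 * t] and [t] from [x], hence [3 * t] in
   total. *)
have eta3 : 0 < eta / 3 by rewrite divr_gt0.
have [r1 r10 H1] := near0_ball (diff_first_order eta3 (ddf i)).
have [r2 r20 H2] : exists2 r2 : R, 0 < r2 & forall h, `|h| < r2 -> U (x + h).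
  apply: near0_ball; have := near_open oU Ux.
  rewrite (near_shift 0 x); apply: filterS => h /=.
  by rewrite subr0 addrC.
exists (Num.min r1 r2 / 2) => [|t /andP[t0 tr]].
  by rewrite divr_gt0// lt_min r10.
have [tr1 tr2] : 2 * t < r1 /\ 2 * t < r2.
  have : 2 * t < Num.min r1 r2 by rewrite mulrC -ltr_pdivlMr.
  by rewrite lt_min => /andP[].
have nti k (s : R) : `|s| <= t -> `|s *: e_ k| <= t.
  by move=> st; rewrite normrZ (le_trans _ st)// ler_piMr// normr_basis_vec.
have nt2 k l (s s' : R) : `|s| <= t -> `|s'| <= t -> `|s *: e_ k + s' *: e_ l| <= 2 * t.
  by move=> s1 s2; rewrite (le_trans (ler_normD _ _))// mulr_natl mulr2n lerD// nti.
have tt : `|t| <= t by rewrite ger0_norm// ltW.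
pose g y := f (y + t *: e_ j) - f y.
have dg (s : R) : `|s| <= t -> derivable g (x + s *: e_ i) (e_ i) /\
   'D_(e_ i) g (x + s *: e_ i) =
     'D_(e_ i) f (x + s *: e_ i + t *: e_ j) - 'D_(e_ i) f (x + s *: e_ i).
  move=> st.
  have Da : derivable f (x + s *: e_ i) (e_ i).
    apply: (C2_derivable cf); apply: (H2 (s *: e_ i)); apply: le_lt_trans tr2.
    by rewrite (le_trans (nti _ _ st))// ler_peMl// ?ltW// ltr1n.
  have Db : derivable f (x + s *: e_ i + t *: e_ j) (e_ i).
    apply: (C2_derivable cf); rewrite -addrA.
    by apply: (H2 (s *: e_ i + t *: e_ j)); apply: le_lt_trans tr2; exact: nt2.
  have Dc := derivable_translate Db.
  split; first exact: derivableB.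
  by rewrite /g (deriveB Dc Da) derive_translate.
have [s st E] := @line_mvt R d g x (e_ i) t (fun s st => (dg s (le_trans st tt)).1).
have {}st := le_trans st tt.
rewrite /g in E; rewrite -/(g _).
have -> : f (x + t *: e_ i + t *: e_ j) - f (x + t *: e_ i) -
   (f (x + t *: e_ j) - f x) = g (x + t *: e_ i) - g x by [].
rewrite [g _ - g _]E (dg _ st).2.
have B (h : V) : `|h| <= 2 * t -> `|'D_(e_ i) f (x + h) - 'D_(e_ i) f x -
    \sum_k h 0 k * 'D_(e_ k) ('D_(e_ i) f) x| <= eta / 3 * `|h|.
  by move=> ht; apply: H1; exact: le_lt_trans tr1.
have nt1 : `|s *: e_ i| <= t by exact: nti.
have B1 := B _ (nt2 i j s t st tt).
have B2 := B (s *: e_ i) (le_trans nt1 _).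
have S : \sum_k (s *: e_ i + t *: e_ j) 0 k * 'D_(e_ k) ('D_(e_ i) f) x -
    \sum_k (s *: e_ i) 0 k * 'D_(e_ k) ('D_(e_ i) f) x = t * 'D_(e_ j) ('D_(e_ i) f) x.
  rewrite -sumrB (bigD1 j)//= big1 ?addr0.
    by rewrite !mxE !eqxx /=; ring.
  by move=> k kj; rewrite !mxE !eqxx /= (negbTE kj) mulr0 addr0 subrr.
have t2 : t <= 2 * t by rewrite ler_peMl// ?ltW// ltr1n.
move: {B2} (B2 t2) B1 S.
set X := \sum_k _; set Y := \sum_k _; set D2 := 'D_(e_ j) _ x.
rewrite addrA.
move: ('D_(e_ i) f (x + s *: e_ i + t *: e_ j)) => P.
move: ('D_(e_ i) f (x + s *: e_ i)) => Q.
move: ('D_(e_ i) f x) X Y D2 => Z X Y D2 B2 B1 S.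
have -> : t * (P - Q) - t ^+ 2 * D2 = t * ((P - Z - Y) - (Q - Z - X)).
  by rewrite expr2 -mulrA -S; ring.
rewrite normrM (gtr0_norm t0) expr2 mulrCA ler_pM2l//.
apply: (le_trans (ler_normB _ _)).
have C1 := nt2 i j s t st tt.
apply: (le_trans (lerD B1 B2)); rewrite -mulrDr -mulrA ler_pM2l//.
rewrite mulrC ler_pdivrMr// mulrC.
apply: (le_trans (lerD C1 nt1)); rewrite le_eqVlt; apply/orP; left; apply/eqP; ring.
Qed.

(** The second difference is symmetric in [i] and [j], and after division by [t ^+ 2] it tends to
    either mixed derivative (Young's theorem). *)
Lemma hess_sym U f x i j : open U -> C2 U f -> U x -> hess f x i j = hess f x j i.
Proof.
move=> oU cf Ux; rewrite !hessE.
set a := derive _ _ _; set b := derive _ _ _.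
suff H (eta : R) : 0 < eta -> `|a - b| <= eta * 2.
  apply/eqP; rewrite -subr_eq0 -normr_le0; apply/ler_addgt0Pr => e0 e00.
  by rewrite add0r (le_trans (H _ (divr_gt0 e00 (ltr0Sn _ 1))))// divfK.
move=> eta0.
have [r r0 H] := second_difference j i oU cf Ux eta0.
have [s s0 H'] := second_difference i j oU cf Ux eta0.
pose t := Num.min r s / 2.
have t0 : 0 < t by rewrite divr_gt0// lt_min r0.
have trs : t < Num.min r s by rewrite ltr_pdivrMr// ltr_pMr ?lt_min ?r0// ltr1n.
move: trs; rewrite lt_min => /andP[tr ts].
have := H t; rewrite t0 tr => /(_ isT).
have := H' t; rewrite t0 ts => /(_ isT).
rewrite -/a -/b [x + _ + _]addrAC.
clearbody a b; clear H H'.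
move: (f (x + _ + _)) (f (x + _)) (f (x + _)) (f x) => p q k l.
have t2 : 0 < t ^+ 2 by rewrite exprn_gt0.
rewrite !ler_norml => /andP[A1 A2] /andP[A3 A4].
apply/andP; split; rewrite -(ler_pM2l t2); lra.
Qed.

Lemma line_mvt_pos f x v (s : R) : 0 < s ->
  (forall t : R, 0 <= t <= s -> derivable f (x + t *: v) v) ->
  exists2 t : R, 0 < t < s & f (x + s *: v) - f x = s * 'D_v f (x + t *: v).
Proof.
move=> s0 df; have fx0 : f x = f (x + 0 *: v) by rewrite scale0r addr0.
have H (t : R) : t \in `]0, s[ -> is_derive t (1 : R)
    (fun s : R => f (x + s *: v)) ('D_v f (x + t *: v)).
  rewrite in_itv /= => /andP[t0 ts]; apply: is_derive_line; apply: df.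
  by rewrite !ltW.
have C : {within `[0, s], continuous (fun s : R => f (x + s *: v))}.
  apply: continuous_in_subspaceT => t; rewrite inE /= in_itv /= => ts.
  apply: differentiable_continuous; apply/derivable1_diffP.
  by apply: ex_derive; apply: is_derive_line; apply: df.
have [t] := MVT s0 H C.
rewrite in_itv /= => ts E; exists t; first by [].
by rewrite fx0 E subr0 mulrC.
Qed.

Let frac_lt (m n : R) : 0 < m -> 0 <= n -> m / (n + 1) * n < m.
Proof.
move=> m0 n0; have n1 : 0 < n + 1 by rewrite ltr_wpDl.
by rewrite mulrAC ltr_pdivrMr// ltr_pM2l// ltrDl.
Qed.

(** By linearity of the differential it is enough to exclude a positive derivative in each
    direction; a first order expansion at a small step does so. *)
Lemma interior_max_grad U f x : open U -> C2 U f -> U x ->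
  (forall y, U y -> f y <= f x) -> forall v, 'D_v f x = 0.
Proof.
move=> oU cf Ux fmax v.
suff H u : 'D_u f x <= 0.
  apply/eqP; rewrite eq_le H /=.
  have [df _] := cf _ Ux.
  by have := H (- v); rewrite !deriveE// linearN oppr_le0.
have [df _] := cf _ Ux.
rewrite leNgt; apply/negP => D0.
pose eta := 'D_u f x / (2 * (`|u| + 1)).
have u1 : 0 < `|u| + 1 by rewrite ltr_wpDl.
have eta0 : 0 < eta by rewrite divr_gt0// mulr_gt0.
have [r1 r10 H1] := near0_ball (diff_first_order eta0 df).
have [r2 r20 H2] : exists2 r2 : R, 0 < r2 & forall h, `|h| < r2 -> U (x + h).
  apply: near0_ball; have := near_open oU Ux.
  rewrite (near_shift 0 x); apply: filterS => h /=.
  by rewrite subr0 addrC.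
pose t := Num.min r1 r2 / (`|u| + 1).
have r12 : 0 < Num.min r1 r2 by rewrite lt_min r10.
have t0 : 0 < t by rewrite divr_gt0.
have tu : `|t *: u| < Num.min r1 r2.
  by rewrite normrZ gtr0_norm//; exact: frac_lt.
move: tu; rewrite lt_min => /andP[/H1 A1 /H2 /fmax A2].
have S : \sum_i (t *: u) 0 i * 'D_(e_ i) f x = t * 'D_u f x.
  rewrite (derive_sum_partial _ df) mulr_sumr; apply: eq_bigr => i _.
  by rewrite mxE mulrA.
move: A1; rewrite S normrZ (gtr0_norm t0) ler_norml => /andP[A1 _].
have A3 : eta * `|u| <= 'D_u f x / 2.
  rewrite /eta invfM mulrA -mulrA ler_piMr ?divr_ge0 ?(ltW D0)//.
  by rewrite mulrC ler_pdivrMr// mul1r lerDl.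
have : t * (eta * `|u|) <= t * ('D_u f x / 2) by rewrite ler_pM2l.
have : 0 < t * 'D_u f x by rewrite mulr_gt0.
lra.
Qed.

(** This avoids a second order Taylor formula. On [U], [psi] is the derivative of [f] along [v], and
    it vanishes at [x]. If the form were positive at [xi], [psi] would be positive on a short open
    ray from [x], and by the mean value theorem [f] would exceed its maximum. *)
Lemma interior_max_hess U f x (xi : 'I_d -> R) : open U -> C2 U f -> U x ->
  (forall y, U y -> f y <= f x) ->
  \sum_i \sum_j hess f x i j * (xi i * xi j) <= 0.
Proof.
move=> oU cf Ux fmax; have D0 := interior_max_grad oU cf Ux fmax.
have [df ddf] := cf _ Ux.
pose v : V := \row_i xi i.
pose psi := \sum_i (cst (xi i) * 'D_(e_ i) f).
have dcm i : differentiable (cst (xi i) * 'D_(e_ i) f) x.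
  by apply: differentiableM.
have dpsi : differentiable psi x by apply: differentiable_sum.
have psiE y : U y -> psi y = 'D_v f y.
  move=> /cf[dfy _]; rewrite (derive_sum_partial _ dfy) /psi fct_sumE.
  by apply: eq_bigr => i _; rewrite mxE.
have psi0 : psi x = 0 by rewrite psiE.
have <- : 'D_v psi x = \sum_i \sum_j hess f x i j * (xi i * xi j).
  rewrite (derive_sum_partial _ dpsi); apply: eq_bigr => i _.
  rewrite /psi derive_sum; last by move=> j; exact: diff_derivable.
  rewrite mulr_sumr; apply: eq_bigr => j _.
  rewrite deriveM ?derive_cst//; last exact: diff_derivable.
  by rewrite mxE hessE scaler0 addr0 -[cst _ _ *: _]/(xi j * _); ring.
rewrite leNgt; apply/negP => P0.
pose eta := 'D_v psi x / (2 * (`|v| + 1)).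
have u1 : 0 < `|v| + 1 by rewrite ltr_wpDl.
have eta0 : 0 < eta by rewrite divr_gt0// mulr_gt0.
have [r1 r10 H1] := near0_ball (diff_first_order eta0 dpsi).
have [r2 r20 H2] : exists2 r2 : R, 0 < r2 & forall h, `|h| < r2 -> U (x + h).
  apply: near0_ball; have := near_open oU Ux.
  rewrite (near_shift 0 x); apply: filterS => h /=.
  by rewrite subr0 addrC.
pose t := Num.min r1 r2 / (`|v| + 1).
have r12 : 0 < Num.min r1 r2 by rewrite lt_min r10.
have t0 : 0 < t by rewrite divr_gt0.
have tu (s : R) : 0 <= s <= t -> `|s *: v| < Num.min r1 r2.
  move=> /andP[s0 st]; rewrite normrZ ger0_norm//.
  apply: (@le_lt_trans _ _ (t * `|v|)); first by rewrite ler_wpM2r.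
  exact: frac_lt.
have tU (s : R) : 0 <= s <= t -> U (x + s *: v).
  by move=> /tu; rewrite lt_min => /andP[_ /H2].
have [s /andP[s0 st] E] := @line_mvt_pos f x v t t0
   (fun s hs => C2_derivable cf (tU s hs)).
have st' : 0 <= s <= t by rewrite !ltW.
have : f (x + t *: v) <= f x by apply: fmax; apply: tU; rewrite lexx ltW.
rewrite -subr_le0 E pmulr_rle0// -psiE; last exact: tU.
apply/negP; rewrite -ltNge.
have := tu _ st'; rewrite lt_min => /andP[/H1 A1 _].
have S : \sum_i (s *: v) 0 i * 'D_(e_ i) psi x = s * 'D_v psi x.
  rewrite (derive_sum_partial _ dpsi) mulr_sumr; apply: eq_bigr => i _.
  by rewrite [(s *: v) 0 i]mxE mulrA.
move: A1; rewrite S psi0 normrZ (gtr0_norm s0) ler_norml => /andP[A1 _].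
have A3 : eta * `|v| <= 'D_v psi x / 2.
  rewrite /eta invfM mulrA -mulrA ler_piMr ?divr_ge0 ?(ltW P0)//.
  by rewrite mulrC ler_pdivrMr// mul1r lerDl.
have : s * (eta * `|v|) <= s * ('D_v psi x / 2) by rewrite ler_pM2l.
have : 0 < s * 'D_v psi x by rewrite mulr_gt0.
lra.
Qed.

End second_order.

(** * The maximum principle *)

Section max_principle.
Context (R : realType) (d : nat).
Local Notation V := 'rV[R]_d.
Variable A : V -> 'M[R]_d.
Hypothesis dA : forall i j x, differentiable (fun y => A y i j) x.
Variable c : R.
Hypothesis c0 : 0 < c.
Hypothesis Aell : forall x (xi : V), c^-1 * dot xi xi <= qA A x xi xi.

Lemma dot_gt0 (v : V) : v != 0 -> 0 < dot v v.
Proof.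
move=> v0; have [i vi] : exists i, v 0 i != 0.
  apply/existsP; apply: contraNT v0; rewrite negb_exists => /forallP H.
  by apply/eqP/rowP => i; rewrite mxE; apply/eqP; have := H i; rewrite negbK.
rewrite /dot (bigD1 i)//= ltr_pwDl//.
  by rewrite lt_def -expr2 sqr_ge0 sqrf_eq0 vi.
by apply: sumr_ge0 => j _; rewrite -expr2 sqr_ge0.
Qed.

(** The gradient vanishes at the maximum, and only the symmetric part [a] of [A] pairs with the
    symmetric Hessian; [trace_mul_le0] then gives the sign. *)
Lemma interior_max_elliptic (U : set V) f x : open U -> C2 U f -> U x ->
  (forall y, U y -> f y <= f x) -> 0 <= elliptic_op A f x.
Proof.
move=> oU cf Ux fmax; rewrite (elliptic_opE dA cf Ux).
have -> : grad f x = 0.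
  by apply/rowP => i; rewrite gradE (interior_max_grad oU cf Ux fmax) mxE.
rewrite dot0r add0r oppr_ge0.
pose a i j := (A x i j + A x j i) / 2.
have -> : trA A x (hess f x) = \sum_i \sum_j a i j * hess f x i j.
  transitivity (\sum_i \sum_j (A x i j / 2 * hess f x i j) +
                \sum_i \sum_j (A x j i / 2 * hess f x i j)).
    rewrite [X in _ + X]exchange_big /= -big_split /=; apply: eq_bigr => i _.
    rewrite -big_split /=; apply: eq_bigr => j _.
    by rewrite (hess_sym j i oU cf Ux); field.
  rewrite -big_split /=; apply: eq_bigr => i _.
  by rewrite -big_split /=; apply: eq_bigr => j _; rewrite /a; field.
apply: trace_mul_le0.
- by move=> i j; rewrite /a addrC.
- move=> xi [i xi0]; pose v : V := \row_i xi i.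
  have v0 : v != 0 by apply: contra_neq xi0 => /rowP/(_ i); rewrite !mxE.
  have := Aell x v; have := dot_gt0 v0.
  rewrite -(pmulr_rgt0 (dot v v) (_ : 0 < c^-1)) ?invr_gt0//.
  move=> /lt_le_trans H /H; suff -> : qA A x v v = \sum_i \sum_j a i j * (xi i * xi j) by [].
  transitivity (\sum_i \sum_j (A x i j / 2 * (xi i * xi j)) +
                \sum_i \sum_j (A x j i / 2 * (xi i * xi j))).
    rewrite [X in _ + X]exchange_big /= -big_split /=; apply: eq_bigr => k _.
    by rewrite -big_split /=; apply: eq_bigr => j _; rewrite !mxE; field.
  rewrite -big_split /=; apply: eq_bigr => k _.
  by rewrite -big_split /=; apply: eq_bigr => j _; rewrite /a; field.
- by move=> xi; apply: interior_max_hess oU cf Ux fmax.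
Qed.

Lemma bounded_closure (D : set V) : bounded_set D -> bounded_set (closure D).
Proof.
move=> [M [Mr HM]]; exists (M + 2); split; first exact: num_real.
move=> y My x cx.
have [z [Dz]] := cx _ (nbhsx_ballx x 1 ltr01).
rewrite -ball_normE /= => xz.
have zM : `|z| <= M + 1 by apply: HM => //; rewrite ltrDl.
apply: ltW; apply: le_lt_trans My.
rewrite -(subrK z x) (le_trans (ler_normD _ _))//.
by rewrite (_ : M + 2 = 1 + (M + 1)); [rewrite lerD// ltW|ring].
Qed.

(** As the differential inequality is strict, a maximum inside [D] contradicts
    [interior_max_elliptic] directly. In the application the strictness comes from the barriers. *)
Lemma max_principle (D : set V) w : open D -> bounded_set D -> C2 D w ->
  {within closure D, continuous w} ->
  (forall x, D x -> elliptic_op A w x < 0) ->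
  (forall x, boundary D x -> w x <= 0) ->
  forall x, D x -> w x <= 0.
Proof.
move=> oD bD cw ctw Lw wb x Dx.
have cD : compact (closure D).
  apply: bounded_closed_compact; last exact: closed_closure.
  exact: bounded_closure.
have [|y] := EVT_max_rV _ cD ctw; first by exists x; exact: subset_closure.
rewrite inE => cy ymax.
have xy : w x <= w y by apply: ymax; rewrite inE; exact: subset_closure.
have [Dy|nDy] := pselect (D y).
  have := Lw _ Dy; rewrite ltNge (interior_max_elliptic oD cw Dy)// => z Dz.
  by apply: ymax; rewrite inE; exact: subset_closure.
apply: (le_trans xy); apply: wb; split => //.
by rewrite (interior_id _).1.
Qed.

End max_principle.
(** * Order bounds that are uniform in a parameter *)

Section is_derive_powers.
Context (R : realType).

Lemma is_derive_invf (f : R -> R) (y df : R) : f y != 0 ->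
  is_derive y (1 : R) f df ->
  is_derive y (1 : R) (fun z => (f z)^-1) (- (f y) ^- 2 * df).
Proof.
move=> fy0 Df; have D : derivable f y 1 by exact: ex_derive.
apply: DeriveDef; first exact: derivableV.
by rewrite deriveV// derive_val.
Qed.

Lemma is_derive_inv (y : R) : y != 0 -> is_derive y (1 : R) GRing.inv (- (y ^- 2)).
Proof.
move=> y0; have := @is_derive_invf id y 1 y0 (is_derive_id _ _).
by rewrite mulr1.
Qed.

Lemma is_derive_inv2 (y : R) : y != 0 ->
  is_derive y (1 : R) (fun y => - (y ^- 2)) (2 * y ^- 3).
Proof.
move=> y0; have y20 : y ^+ 2 != 0 by rewrite expf_neq0.
have D2 : is_derive y (1 : R) (fun z : R => z ^+ 2) (2 * y).
  apply: DeriveDef; first exact: exprn_derivable.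
  by rewrite exp_derive /= expr1 -[LHS]/(_ * _) mulr1.
have := @is_deriveN _ _ _ _ _ _ _ (@is_derive_invf (fun z => z ^+ 2) y _ y20 D2).
rewrite (_ : - (- _ * _) = 2 * y ^- 3)//.
by field.
Qed.

Lemma is_derive_sqrtV (y : R) : 0 < y ->
  is_derive y (1 : R) (fun y => (2 * Num.sqrt y)^-1)
   (- ((2 * Num.sqrt y) ^- 2 * (2 * (2 * Num.sqrt y)^-1))).
Proof.
move=> y0; have s0 : 2 * Num.sqrt y != 0 by rewrite mulf_neq0// gt_eqF// sqrtr_gt0.
have Ds : is_derive y (1 : R) (fun y : R => 2 * Num.sqrt y) (2 * (2 * Num.sqrt y)^-1).
  exact: (@is_deriveZ _ _ _ Num.sqrt 2 y 1 _ (is_derive1_sqrt y0)).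
by have := @is_derive_invf (fun y : R => 2 * Num.sqrt y) y _ s0 Ds; rewrite mulNr.
Qed.

End is_derive_powers.

Section order_bounds.
Context (R : realType) (d : nat) (I : Type).
Local Notation V := 'rV[R]_d.
Variables (D : set V) (r : I -> V -> R).
Hypothesis r_ge0 : forall i x, D x -> 0 <= r i x.
Hypothesis r_bnd : exists K : R, forall i x, D x -> r i x <= K.
Implicit Types (F G : I -> V -> R).

(** [F] is [O(r^n)] on [D], uniformly in the index; [r] will be the distance to a
    face or to a ridge, and the index a direction or a value of [eps]. *)
Definition ord (n : nat) F := exists K : R, forall i x, D x -> `|F i x| <= K * r i x ^+ n.

Lemma ord_ge0 n F : ord n F ->
  exists2 K : R, 0 <= K & forall i x, D x -> `|F i x| <= K * r i x ^+ n.
Proof.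
move=> [K HK]; exists `|K| => // i x Dx; apply: (le_trans (HK _ _ Dx)).
by rewrite ler_wpM2r ?exprn_ge0 ?r_ge0 ?ler_norm.
Qed.

Lemma ord_eq n F G : (forall i x, D x -> F i x = G i x) -> ord n F -> ord n G.
Proof. by move=> E [K HK]; exists K => i x Dx; rewrite -E// HK. Qed.

Lemma ordD n F G : ord n F -> ord n G -> ord n (fun i x => F i x + G i x).
Proof.
move=> [K HK] [L HL]; exists (K + L) => i x Dx.
by rewrite (le_trans (ler_normD _ _))// mulrDl lerD ?HK ?HL.
Qed.

Lemma ordN n F : ord n F -> ord n (fun i x => - F i x).
Proof. by move=> [K HK]; exists K => i x Dx; rewrite normrN HK. Qed.

Lemma ordB n F G : ord n F -> ord n G -> ord n (fun i x => F i x - G i x).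
Proof. by move=> oF oG; apply: ordD => //; exact: ordN. Qed.

Lemma ordM m n F G : ord m F -> ord n G -> ord (m + n) (fun i x => F i x * G i x).
Proof.
move=> /ord_ge0[K K0 HK] /ord_ge0[L L0 HL]; exists (K * L) => i x Dx.
by rewrite normrM exprD mulrACA ler_pM// ?HK ?HL.
Qed.

Lemma ordM0 n F G : ord 0 F -> ord n G -> ord n (fun i x => F i x * G i x).
Proof. exact: ordM. Qed.

Lemma ord_cst (k : R) : ord 0 (fun _ _ => k).
Proof. by exists `|k| => i x _; rewrite expr0 mulr1. Qed.

Lemma ordW m n F : (n <= m)%N -> ord m F -> ord n F.
Proof.
move=> nm /ord_ge0[K K0 HK]; have [L HL] := r_bnd.
exists (K * (`|L| ^+ (m - n))) => i x Dx; apply: (le_trans (HK _ _ Dx)).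
rewrite -mulrA ler_wpM2l// -(subnK nm) exprD addnK.
rewrite ler_wpM2r ?exprn_ge0 ?r_ge0// lerXn2r ?nnegrE ?r_ge0//.
by rewrite (le_trans (HL _ _ Dx))// ler_norm.
Qed.

Lemma ord_sum (J : finType) n (F : J -> I -> V -> R) :
  (forall j, ord n (F j)) -> ord n (fun i x => \sum_j F j i x).
Proof.
move=> oF; have /choice[K HK] : forall j, exists K, forall i x, D x -> `|F j i x| <= K * r i x ^+ n.
  by move=> j; exact: oF.
exists (\sum_j K j) => i x Dx; rewrite (le_trans (ler_norm_sum _ _ _))//.
by rewrite mulr_suml ler_sum// => j _; exact: HK.
Qed.

Lemma ord_inv F (k : R) : 0 < k -> (forall i x, D x -> k <= F i x) ->
  ord 0 (fun i x => (F i x)^-1).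
Proof.
move=> k0 kF; exists k^-1 => i x Dx; rewrite expr0 mulr1.
have F0 : 0 < F i x by rewrite (lt_le_trans k0)// kF.
by rewrite ger0_norm ?invr_ge0 ?(ltW F0)// lef_pV2 ?posrE// kF.
Qed.

Definition vord n (u : I -> V -> V) := forall k, ord n (fun i x => u i x 0 k).

Lemma vordD n u v : vord n u -> vord n v -> vord n (fun i x => u i x + v i x).
Proof.
move=> ou ov k; apply: (@ord_eq _ (fun i x => u i x 0 k + v i x 0 k)).
  by move=> i x _; rewrite mxE.
exact: ordD.
Qed.

Lemma vordZ m n F v : ord m F -> vord n v -> vord (m + n) (fun i x => F i x *: v i x).
Proof.
move=> oF ov k; apply: (@ord_eq _ (fun i x => F i x * v i x 0 k)).
  by move=> i x _; rewrite mxE.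
exact: ordM.
Qed.

Lemma ord_dot m n u v : vord m u -> vord n v -> ord (m + n) (fun i x => dot (u i x) (v i x)).
Proof. by move=> ou ov; apply: ord_sum => k; exact: ordM. Qed.

Section with_A.
Variable A : V -> 'M[R]_d.
Hypothesis oA : forall k l, ord 0 (fun _ x => A x k l).

Lemma ord_qA m n u v : vord m u -> vord n v ->
  ord (m + n) (fun i x => qA A x (u i x) (v i x)).
Proof.
move=> ou ov; apply: ord_sum => k; apply: ord_sum => l; apply: ordM0 => //.
rewrite -[(m + n)%N]addn0; apply: ordM; last exact: ord_cst.
by apply: ordD; [|rewrite addnC]; exact: ordM.
Qed.

Lemma ord_trA n (H : I -> V -> 'M[R]_d) : (forall k l, ord n (fun i x => H i x k l)) ->
  ord n (fun i x => trA A x (H i x)).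
Proof. by move=> oH; apply: ord_sum => k; apply: ord_sum => l; exact: ordM0. Qed.

End with_A.

(** Order 0 means bounded on [D] uniformly in the index. The class is stable under the operations
    that build the phases of the correctors and the quadratic form of the ridge barrier. *)
Definition ub2 F := [/\ forall i, C2 setT (F i), ord 0 F,
  vord 0 (fun i x => grad (F i) x) &
  forall k l, ord 0 (fun i x => hess (F i) x k l)].

Lemma ub2_C2 F : ub2 F -> forall i, C2 setT (F i). Proof. by case. Qed.
Lemma ub2_ord F : ub2 F -> ord 0 F. Proof. by case. Qed.
Lemma ub2_grad F : ub2 F -> vord 0 (fun i x => grad (F i) x). Proof. by case. Qed.

Lemma ub2_cst (k : I -> R) : ord 0 (fun i _ => k i) -> ub2 (fun i => cst (k i)).
Proof.
move=> ok; split => //.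
- by move=> i; exact: C2_cst.
- move=> l; apply: (@ord_eq _ (fun _ _ => 0)); last exact: ord_cst.
  by move=> i x _; rewrite grad_cst mxE.
- move=> l m; apply: (@ord_eq _ (fun _ _ => 0)); last exact: ord_cst.
  by move=> i x _; rewrite hess_cst mxE.
Qed.

Lemma ub2_dotl (v : I -> V) : bounded_set D -> vord 0 (fun i _ => v i) ->
  ub2 (fun i => dotl (v i)).
Proof.
move=> [M [_ HM]] ov; split => //.
- by move=> i; exact: C2_dotl.
- have oX : vord 0 (fun _ x => x).
    move=> k; exists (M + 1) => i x Dx; rewrite expr0 mulr1.
    by rewrite (le_trans (coord_le_normrV _ _))// HM// ltrDl.
  exact: (ord_dot ov oX).
- move=> l; apply: (@ord_eq _ (fun i _ => v i 0 l)); last exact: ov.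
  by move=> i x _; rewrite grad_dotl.
- move=> l m; apply: (@ord_eq _ (fun _ _ => 0)); last exact: ord_cst.
  by move=> i x _; rewrite hess_dotl mxE.
Qed.

Lemma ub2D F G : ub2 F -> ub2 G -> ub2 (fun i => F i + G i).
Proof.
move=> [cF oF gF hF] [cG oG gG hG]; split.
- by move=> i; apply: C2D => //; exact: openT.
- exact: ordD.
- move=> l; apply: (@ord_eq _ (fun i x => grad (F i) x 0 l + grad (G i) x 0 l)).
    by move=> i x _; rewrite (gradD (cF i) (cG i))// mxE.
  exact: ordD.
- move=> l m; apply: (@ord_eq _ (fun i x => hess (F i) x l m + hess (G i) x l m)).
    by move=> i x _; rewrite (hessD openT (cF i) (cG i))// mxE.
  exact: ordD.
Qed.

Lemma ub2M F G : ub2 F -> ub2 G -> ub2 (fun i => F i * G i).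
Proof.
move=> [cF oF gF hF] [cG oG gG hG]; split.
- by move=> i; apply: C2M => //; exact: openT.
- exact: ordM0.
- move=> l; apply: (@ord_eq _
    (fun i x => F i x * grad (G i) x 0 l + G i x * grad (F i) x 0 l)).
    by move=> i x _; rewrite (gradM (cF i) (cG i))// !mxE.
  by apply: ordD; exact: ordM0.
- move=> l m; apply: (@ord_eq _ (fun i x => F i x * hess (G i) x l m +
      G i x * hess (F i) x l m + (grad (F i) x 0 l * grad (G i) x 0 m +
      grad (G i) x 0 l * grad (F i) x 0 m))).
    move=> i x _; rewrite (hessM openT (cF i) (cG i))//.
    rewrite [in RHS]mxE [X in _ = X + _]mxE [X in _ = X + _ + _]mxE.
    by rewrite [X in _ = _ + X + _]mxE [X in _ = _ + X]mxE !outerE.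
  by apply: ordD; apply: ordD; exact: ordM0.
Qed.

Lemma ub2_sum (J : finType) (F : J -> I -> V -> R) : (forall j, ub2 (F j)) ->
  ub2 (fun i => \sum_j F j i).
Proof.
move=> uF.
suff H (s : seq J) : ub2 (fun i => \sum_(j <- s) F j i).
  by have := H (index_enum J).
elim: s => [|j s IH].
  have -> : (fun i : I => \sum_(j <- [::]) F j i) = (fun=> cst 0).
    by apply/funext => i; rewrite big_nil.
  by apply: ub2_cst; exact: ord_cst.
have -> : (fun i : I => \sum_(j <- j :: s) F j i) =
    (fun i => F j i + \sum_(j <- s) F j i).
  by apply/funext => i; rewrite big_cons.
exact: ub2D.
Qed.

Lemma ub2_comp (h h1 h2 : R -> R) F : ub2 F ->
  (forall i x, is_derive (F i x) (1 : R) h (h1 (F i x))) ->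
  (forall i x, is_derive (F i x) (1 : R) h1 (h2 (F i x))) ->
  ord 0 (fun i x => h (F i x)) -> ord 0 (fun i x => h1 (F i x)) ->
  ord 0 (fun i x => h2 (F i x)) -> ub2 (fun i => h \o F i).
Proof.
move=> [cF oF gF hF] dh dh1 oh oh1 oh2; split; last 2 first.
- move=> l; apply: (@ord_eq _ (fun i x => h1 (F i x) * grad (F i) x 0 l)).
    by move=> i x _; rewrite (grad_comp (cF i) (fun x _ => dh i x))// mxE.
  exact: ordM0.
- move=> l m; apply: (@ord_eq _ (fun i x => h1 (F i x) * hess (F i) x l m +
      h2 (F i x) * (grad (F i) x 0 l * grad (F i) x 0 m))).
    move=> i x _; rewrite (hess_comp openT (cF i) (fun x _ => dh i x)
      (fun x _ => dh1 i x))//.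
    by rewrite [in RHS]mxE [X in _ = X + _]mxE [X in _ = _ + X]mxE outerE.
  by apply: ordD; apply: ordM0 => //; exact: ordM0.
- by move=> i; apply: (C2_comp openT (cF i)).
- exact: oh.
Qed.

Lemma ub2_inv F (k : R) : 0 < k -> (forall i x, k <= F i x) -> ub2 F ->
  ub2 (fun i => GRing.inv \o F i).
Proof.
move=> k0 kF uF.
have F0 i x : F i x != 0 by rewrite gt_eqF// (lt_le_trans k0).
have oV : ord 0 (fun i x => (F i x)^-1) by apply: (ord_inv k0).
apply: (ub2_comp (h1 := fun y => - (y ^- 2)) (h2 := fun y => 2 * y ^- 3)) => //.
- by move=> i x; exact: is_derive_inv.
- by move=> i x; exact: is_derive_inv2.
- apply: ordN; apply: (@ord_eq _ (fun i x => (F i x)^-1 * (F i x)^-1)).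
    by move=> i x _; rewrite expr2 invfM.
  exact: ordM0.
- apply: ordM0; first exact: ord_cst.
  apply: (@ord_eq _ (fun i x => (F i x)^-1 * ((F i x)^-1 * (F i x)^-1))).
    by move=> i x _; rewrite !exprS expr0 mulr1 !invfM.
  by apply: ordM0 => //; exact: ordM0.
Qed.

Lemma ub2_sqrt F (k : R) : 0 < k -> (forall i x, k <= F i x) -> ub2 F ->
  ub2 (fun i => Num.sqrt \o F i).
Proof.
move=> k0 kF uF.
have F0 i x : 0 < F i x by rewrite (lt_le_trans k0).
have s0 : 0 < Num.sqrt k by rewrite sqrtr_gt0.
have sF i x : D x -> 2 * Num.sqrt k <= 2 * Num.sqrt (F i x).
  by move=> _; rewrite ler_pM2l// ler_wsqrtr.
have oV : ord 0 (fun i x => (2 * Num.sqrt (F i x))^-1).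
  by apply: (ord_inv _ sF); rewrite mulr_gt0.
apply: (ub2_comp (h1 := fun y => (2 * Num.sqrt y)^-1)
  (h2 := fun y => - ((2 * Num.sqrt y) ^- 2 * (2 * (2 * Num.sqrt y)^-1)))) => //.
- by move=> i x; exact: is_derive1_sqrt.
- by move=> i x; exact: is_derive_sqrtV.
- have [L HL] := ub2_ord uF; exists (1 + L) => i x Dx; rewrite expr0 mulr1.
  rewrite ger0_norm ?sqrtr_ge0//.
  have FL : F i x <= L.
    by have := HL i x Dx; rewrite expr0 mulr1; apply: le_trans; exact: ler_norm.
  have L0 : 0 <= L by rewrite (le_trans _ FL)// ltW.
  rewrite -[leRHS]ger0_norm ?addr_ge0// -sqrtr_sqr ler_wsqrtr//.
  rewrite (le_trans FL)// expr2; nra.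
- apply: ordN; apply: (@ord_eq _ (fun i x => (2 * Num.sqrt (F i x))^-1 *
    (2 * Num.sqrt (F i x))^-1 * (2 * (2 * Num.sqrt (F i x))^-1))).
    by move=> i x _; rewrite expr2 !invfM.
  apply: ordM0; first exact: ordM0.
  by apply: ordM0 => //; exact: ord_cst.
Qed.

Section elliptic_ord.
Variable A : V -> 'M[R]_d.
Hypothesis uA : forall k l, ub2 (fun (_ : I) x => A x k l).
Hypothesis dA : forall i j x, differentiable (fun y => A y i j) x.

Let oA k l : ord 0 (fun _ x => A x k l) := ub2_ord (uA k l).

Lemma ord_divA : vord 0 (fun _ x => divA A x).
Proof.
move=> l; apply: (@ord_eq _ (fun _ x => \sum_k grad (fun y => A y k l) x 0 k)).
  by move=> i x _; rewrite /divA mxE; apply: eq_bigr => k _; rewrite gradE.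
by apply: ord_sum => k; have [_ _ + _] := uA k l; exact.
Qed.

Lemma ord_elliptic F : ub2 F -> ord 0 (fun i x => elliptic_op A (F i) x).
Proof.
move=> [cF oF gF hF].
apply: (@ord_eq _ (fun i x => - (dot (divA A x) (grad (F i) x) + trA A x (hess (F i) x)))).
  by move=> i x _; rewrite (elliptic_opE dA (cF i)).
apply: ordN; apply: ordD; first exact: (ord_dot ord_divA gF).
exact: (ord_trA oA).
Qed.

Lemma ub2_qA (u v : I -> V) : vord 0 (fun i _ => u i) -> vord 0 (fun i _ => v i) ->
  ub2 (fun i x => qA A x (u i) (v i)).
Proof.
move=> ou ov.
have -> : (fun i x => qA A x (u i) (v i)) = (fun i => \sum_k \sum_l
    ((fun x => A x k l) * cst ((u i 0 k * v i 0 l + v i 0 k * u i 0 l) / 2))).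
  apply/funext => i; apply/funext => x; rewrite /qA fct_sumE.
  by apply: eq_bigr => k _; rewrite fct_sumE.
apply: ub2_sum => k; apply: ub2_sum => l; apply: ub2M => //; apply: ub2_cst.
apply: (@ordM 0 0); last exact: ord_cst.
by apply: ordD; exact: ordM0 (ou _) (ov _) || exact: ordM0 (ov _) (ou _).
Qed.

End elliptic_ord.
End order_bounds.
(** * Boundary layer correctors and barriers *)

Section barriers.
Context (R : realType) (d : nat).
Local Notation V := 'rV[R]_d.
Variable A : V -> 'M[R]_d.
Hypothesis A2 : forall k l, C2 setT (fun x => A x k l).
Variable c : R.
Hypothesis c0 : 0 < c.
Hypothesis Aell : forall x (xi : V), c^-1 * dot xi xi <= qA A x xi xi.
Hypothesis Aup : forall x (xi : V), qA A x xi xi <= c * dot xi xi.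
Variable D : set V.
Hypothesis bD : bounded_set D.
Hypothesis AD : forall k l, exists K : R, forall x, D x ->
  [/\ `|A x k l| <= K, forall m, `|grad (fun x => A x k l) x 0 m| <= K &
      forall m n, `|hess (fun x => A x k l) x m n| <= K].

Let dA i j x : differentiable (fun y => A y i j) x.
Proof. by have [] := A2 i j (I : setT x). Qed.

Lemma ub2_coef (I : Type) (r : I -> V -> R) k l : ub2 D r (fun _ x => A x k l).
Proof.
have [K HK] := AD k l; split => //.
- by exists K => i x Dx; rewrite expr0 mulr1; have [] := HK _ Dx.
- by move=> m; exists K => i x Dx; rewrite expr0 mulr1; have [] := HK _ Dx.
- by move=> m n; exists K => i x Dx; rewrite expr0 mulr1; have [] := HK _ Dx.
Qed.

Let oA (I : Type) (r : I -> V -> R) k l : ord D r 0 (fun _ x => A x k l) :=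
  ub2_ord (ub2_coef r k l).

Lemma coord_le_unit (v : V) k : dot v v = 1 -> `|v 0 k| <= 1.
Proof.
move=> v1; have : v 0 k ^+ 2 <= 1.
  rewrite -v1 /dot (bigD1 k)//= -expr2 lerDl sumr_ge0// => j _.
  by rewrite -expr2 sqr_ge0.
by rewrite -sqrtr_sqr => H; rewrite -[leRHS]sqrtr1 ler_wsqrtr.
Qed.

Lemma vord_unit (I : Type) (r : I -> V -> R) (v : I -> V) :
  (forall i, dot (v i) (v i) = 1) -> vord D r 0 (fun i _ => v i).
Proof.
by move=> v1 k; exists 1 => i x _; rewrite expr0 mulr1 coord_le_unit.
Qed.

(** The triangle inequality for the formula of [elliptic_corrector]: [X] and [Y] are the operator on
    the phase and on the decay, [P] and [Q] the two eikonal defects, [q] the distance to the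
    face. *)
Let corrector_arith (L q s f X Y P Q K1 K2 K3 K4 : R) : 0 < L -> 0 <= q -> 0 <= K3 -> 0 <= K4 ->
  `|s| <= 1 -> `|f| <= 1 -> `|X| <= K1 -> `|Y| <= K2 -> `|P| <= K3 * q ->
  `|Q| <= K4 * q ->
  `|L * (- s * X - f * Y) + L ^+ 2 * (f * P - 2 * (s * Q))| <=
    (K1 + K2 + K3 + 2 * K4) * (L + L ^+ 2 * q).
Proof.
move=> L0 q0 K30 K40 s1 f1 HX HY HP HQ.
have M1 (u v k : R) : `|u| <= 1 -> `|v| <= k -> `|u * v| <= k.
  move=> u1 vk; rewrite normrM -[leRHS]mul1r.
  exact: ler_pM.
have K10 : 0 <= K1 by apply: le_trans HX.
have K20 : 0 <= K2 by apply: le_trans HY.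
have E1 : `|L * (- s * X - f * Y)| <= L * (K1 + K2).
  rewrite normrM (gtr0_norm L0) ler_pM2l// (le_trans (ler_normB _ _))// lerD ?M1//.
  by rewrite normrN.
have E2 : `|L ^+ 2 * (f * P - 2 * (s * Q))| <= L ^+ 2 * (K3 * q + 2 * (K4 * q)).
  rewrite normrM ger0_norm ?sqr_ge0// ler_wpM2l ?sqr_ge0//.
  rewrite (le_trans (ler_normB _ _))// lerD//; first exact: M1.
  by rewrite normrM ger0_norm// ler_pM2l//; exact: M1.
apply: (le_trans (ler_normD _ _)); apply: (le_trans (lerD E1 E2)).
have L2 : 0 <= L ^+ 2 by rewrite sqr_ge0.
have : 0 <= (L ^+ 2 * q) * (K1 + K2).
  by apply: mulr_ge0; [exact: mulr_ge0|exact: addr_ge0].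
have : 0 <= L * (K3 + 2 * K4) by rewrite mulr_ge0 ?(ltW L0)// addr_ge0// mulr_ge0.
lra.
Qed.

(** * The boundary layer corrector of one face *)

Section corrector.
Variables (nu : V) (k0 : R).
Hypothesis nu1 : dot nu nu = 1.
Hypothesis pD : forall x, D x -> k0 < dot nu x.

Let p : V -> R := dotl nu + cst (- k0).
(** Indexing by all tangential unit directions makes the order bounds, hence the constant of the
    corrector, independent of the direction; the Fourier modes supply infinitely many of them. *)
Let T := {om : V | dot om om = 1 /\ dot om nu = 0}.
Let r (_ : T) x := p x.
Let om (i : T) : V := sval i.

Let pE x : p x = dot nu x - k0. Proof. by []. Qed.

Let r_ge0 i x : D x -> 0 <= r i x.
Proof. by move=> Dx; rewrite /r pE subr_ge0 ltW// pD. Qed.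

Let u_dotl (v : T -> V) : vord D r 0 (fun i _ => v i) -> ub2 D r (fun i => dotl (v i)).
Proof. exact: ub2_dotl. Qed.

Let ov_nu : vord D r 0 (fun _ _ => nu). Proof. exact: (vord_unit _ (fun=> nu1)). Qed.

Let ov_om : vord D r 0 (fun i _ => om i).
Proof. by apply: vord_unit => -[i []]. Qed.

Let up : ub2 D r (fun _ => p).
Proof.
by apply: ub2D => //; [exact: u_dotl|apply: ub2_cst; exact: ord_cst].
Qed.

Let r_bnd : exists K, forall i x, D x -> r i x <= K.
Proof.
have [K HK] := ub2_ord up; exists K => i x Dx.
by have := HK i x Dx; rewrite expr0 mulr1; apply: le_trans; exact: ler_norm.
Qed.

Let a x := qA A x nu nu.
Let b (i : T) x := qA A x (om i) nu.
Let e (i : T) x := qA A x (om i) (om i).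

Let a_ge x : c^-1 <= a x.
Proof. by have := Aell x nu; rewrite nu1 mulr1. Qed.

Let a_le x : a x <= c.
Proof. by have := Aup x nu; rewrite nu1 mulr1. Qed.

Let a_gt0 x : 0 < a x. Proof. by rewrite (lt_le_trans _ (a_ge x))// invr_gt0. Qed.

Let ua : ub2 D r (fun _ => a).
Proof. exact: (ub2_qA r_ge0 (ub2_coef r) ov_nu ov_nu). Qed.
Let ub : ub2 D r b.
Proof. exact: (ub2_qA r_ge0 (ub2_coef r) ov_om ov_nu). Qed.
Let ue : ub2 D r e.
Proof. exact: (ub2_qA r_ge0 (ub2_coef r) ov_om ov_om). Qed.

Let aV : V -> R := GRing.inv \o a.
Let uaV : ub2 D r (fun _ => aV).
Proof.
by apply: (@ub2_inv _ _ _ _ _ r_ge0 _ c^-1) => //; rewrite invr_gt0.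
Qed.

(** For frozen coefficients [exp (- L (M p)) * cos (L (om.x - N p))] solves
    the equation exactly: [- N + i M] is the root of [a z^2 + 2 b z + e] with
    positive imaginary part. *)
Let N (i : T) : V -> R := b i * aV.
Let uN : ub2 D r N. Proof. exact: (ub2M r_ge0 ub uaV). Qed.

Let um1 : ub2 D r (fun _ => cst (-1)).
Proof. exact: (ub2_cst (ord_cst D r (-1))). Qed.

(** This is [(a e - b^2) / a^2], the square of the imaginary part of the root. *)
Let G (i : T) : V -> R := (e i + cst (-1) * (b i * N i)) * aV.
Let uG : ub2 D r G.
Proof.
exact: (ub2M r_ge0 (ub2D ue (ub2M r_ge0 um1 (ub2M r_ge0 ub uN))) uaV).
Qed.

Let NE i x : N i x * a x = b i x.
Proof. by rewrite /N /aV /= mulrVK// ?unitfE gt_eqF. Qed.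

Let GE i x : G i x * a x = e i x - b i x * N i x.
Proof.
transitivity ((e i x + (-1) * (b i x * N i x)) * aV x * a x) => //.
by rewrite /aV /= mulrVK ?mulN1r// unitfE gt_eqF.
Qed.

(** [G * a] is the value of the form at [om - N nu]. That vector has squared length [1 + N^2 >= 1],
    so ellipticity bounds the value below by [c^-1], and [a <= c] gives the claim. *)
Let G_ge i x : c^-1 ^+ 2 <= G i x.
Proof.
have om1 : dot (om i) (om i) = 1 := (svalP i).1.
have om0 : dot (om i) nu = 0 := (svalP i).2.
have := Aell x (om i - N i x *: nu).
have -> : dot (om i - N i x *: nu) (om i - N i x *: nu) = 1 + N i x ^+ 2.
  rewrite -scaleNr dotDr dotZr !dotDl !dotZl om1 om0 nu1.
  by rewrite dotC om0; ring.
rewrite -scaleNr qADl !qADr !qAZl !qAZr (qAC A x nu).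
rewrite -/(a x) -/(b i x) -/(e i x).
have -> : e i x + - N i x * b i x + (- N i x * b i x + - N i x * (- N i x * a x)) =
   G i x * a x by rewrite GE -(NE i x); ring.
move=> H; have : c^-1 <= G i x * a x.
  by apply: le_trans H; rewrite ler_peMr ?invr_ge0 ?(ltW c0)// lerDl sqr_ge0.
move=> {}H; rewrite -(ler_pM2r (a_gt0 x)); apply: le_trans H.
rewrite expr2 -mulrA ler_piMr ?invr_ge0 ?(ltW c0)//.
by rewrite mulrC ler_pdivrMr// mul1r.
Qed.

Let M (i : T) : V -> R := Num.sqrt \o G i.
Let uM : ub2 D r M.
Proof.
by apply: (@ub2_sqrt _ _ _ _ _ r_ge0 _ (c^-1 ^+ 2)) => //; rewrite exprn_gt0// invr_gt0.
Qed.

Let M_ge i x : c^-1 <= M i x.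
Proof.
have : Num.sqrt (c^-1 ^+ 2) <= M i x by rewrite ler_wsqrtr.
by rewrite sqrtr_sqr ger0_norm// invr_ge0 ltW.
Qed.

Let ME i x : M i x ^+ 2 * a x = e i x - b i x * N i x.
Proof. by rewrite sqr_sqrtr ?GE// (le_trans _ (G_ge i x))// exprn_ge0// invr_ge0 ltW. Qed.

Let rho (i : T) : V -> R := M i * p.
Let phi (i : T) : V -> R := dotl (om i) + cst (-1) * (N i * p).

Let urho : ub2 D r rho. Proof. exact: (ub2M r_ge0 uM up). Qed.
Let uphi : ub2 D r phi.
Proof.
exact: (ub2D (u_dotl ov_om) (ub2M r_ge0 um1 (ub2M r_ge0 uN up))).
Qed.

Let Tx (x : V) : (setT : set V) x. Proof. by []. Qed.

Let grad_p x : grad p x = nu.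
Proof.
rewrite (gradD (@C2_dotl _ _ setT nu) (@C2_cst _ _ setT _) (Tx x)).
by rewrite grad_dotl grad_cst addr0.
Qed.

Let grad_rho i x : grad (rho i) x = M i x *: nu + p x *: grad (M i) x.
Proof. by rewrite (gradM (ub2_C2 uM i) (ub2_C2 up i) (Tx x)) grad_p. Qed.

Let grad_phi i x : grad (phi i) x = om i - (N i x *: nu + p x *: grad (N i) x).
Proof.
have uNp : ub2 D r (fun i => N i * p) := ub2M r_ge0 uN up.
have c1 := @C2_cst _ _ (@setT V) (-1 : R).
rewrite (gradD (@C2_dotl _ _ setT (om i)) (C2M openT c1 (ub2_C2 uNp i)) (Tx x)).
rewrite (gradM c1 (ub2_C2 uNp i) (Tx x)) (gradM (ub2_C2 uN i) (ub2_C2 up i) (Tx x)).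
by rewrite grad_dotl grad_cst scaler0 addr0 scaleN1r grad_p.
Qed.

Let qrr i x := qA A x (grad (rho i) x) (grad (rho i) x).
Let qff i x := qA A x (grad (phi i) x) (grad (phi i) x).
Let qrf i x := qA A x (grad (rho i) x) (grad (phi i) x).

Let o_p : ord D r 1 (fun _ => p).
Proof. by exists 1 => i x Dx; rewrite mul1r expr1 ger0_norm//; exact: r_ge0. Qed.

(** With [M] and [N] frozen, the eikonal system holds exactly: the forms at [grad phi] and
    [grad rho] agree, and the mixed form vanishes. The derivatives of [M] and [N] enter the true
    gradients only with a factor [p]; [X] below is the resulting bounded quotient. *)
Let ord_eik : ord D r 1 (fun i x => qff i x - qrr i x).
Proof.
pose gM i x := grad (M i) x; pose gN i x := grad (N i) x.
have oM := ub2_ord uM; have oN := ub2_ord uN.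
have vM : vord D r 0 gM := ub2_grad uM; have vN : vord D r 0 gN := ub2_grad uN.
have oq u v (hu : vord D r 0 u) (hv : vord D r 0 v) : ord D r 0 (fun i x => qA A x (u i x) (v i x)).
  exact: (ord_qA r_ge0 (@oA T r) hu hv).
pose X i x := (p x * qA A x (gN i x) (gN i x) - 2 * qA A x (om i) (gN i x)) +
   (2 * (N i x * qA A x nu (gN i x)) -
    (2 * (M i x * qA A x nu (gM i x)) + p x * qA A x (gM i x) (gM i x))).
apply: (@ord_eq _ _ _ _ _ _ (fun i x => p x * X i x)).
  move=> i x Dx; rewrite /qff /qrr grad_rho grad_phi.
  rewrite -/(gM i x) -/(gN i x).
  rewrite !(qADl, qADr, qANl, qANr, qAZl, qAZr).
  rewrite !(qAC A x (gM i x) nu) !(qAC A x (gN i x) nu) !(qAC A x (gN i x) (om i)).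
  rewrite !(qAC A x nu (om i)) -/(a x) -/(b i x) -/(e i x) /X.
  have -> : e i x = M i x ^+ 2 * a x + b i x * N i x by rewrite ME subrK.
  by rewrite -(NE i x); ring.
apply: (@ordM _ _ _ _ _ r_ge0 1 0) => //.
have op0 : ord D r 0 (fun _ => p) by exact: ub2_ord up.
have o2 := @ord_cst _ _ T D r 2.
apply: ordD; first apply: ordB.
- by apply: ordM0 => //; exact: oq.
- by apply: ordM0 => //; exact: oq.
apply: ordB; first by apply: ordM0 => //; apply: ordM0 => //; exact: oq.
apply: ordD; first by apply: ordM0 => //; apply: ordM0 => //; exact: oq.
by apply: ordM0 => //; exact: oq.
Qed.

Let ord_eik2 : ord D r 1 qrf.
Proof.
pose gM i x := grad (M i) x; pose gN i x := grad (N i) x.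
have oM := ub2_ord uM; have oN := ub2_ord uN.
have vM : vord D r 0 gM := ub2_grad uM; have vN : vord D r 0 gN := ub2_grad uN.
have oq u v (hu : vord D r 0 u) (hv : vord D r 0 v) : ord D r 0 (fun i x => qA A x (u i x) (v i x)).
  exact: (ord_qA r_ge0 (@oA T r) hu hv).
pose X i x := qA A x (gM i x) (om i) - (M i x * qA A x nu (gN i x)) -
   (N i x * qA A x nu (gM i x)) - p x * qA A x (gM i x) (gN i x).
apply: (@ord_eq _ _ _ _ _ _ (fun i x => p x * X i x)).
  move=> i x Dx; rewrite /qrf grad_rho grad_phi.
  rewrite -/(gM i x) -/(gN i x).
  rewrite !(qADl, qADr, qANl, qANr, qAZl, qAZr).
  rewrite !(qAC A x (gM i x) nu) !(qAC A x nu (om i)) -/(a x) -/(b i x) /X.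
  by rewrite -(NE i x); ring.
apply: (@ordM _ _ _ _ _ r_ge0 1 0) => //.
have op0 : ord D r 0 (fun _ => p) by exact: ub2_ord up.
apply: ordB; first apply: ordB; first apply: ordB.
- exact: oq.
- by apply: ordM0 => //; exact: oq.
- by apply: ordM0 => //; exact: oq.
- by apply: ordM0 => //; exact: oq.
Qed.

Let Fe (L : R) i : V -> R := expR \o (cst (- L) * rho i).
Let Fc (L th : R) i : V -> R := cos \o (cst L * phi i + cst th).

Let C2e L i : C2 setT (cst (- L) * rho i).
Proof. by apply: C2M; [exact: openT|exact: C2_cst|exact: (ub2_C2 urho)]. Qed.
Let C2c L th i : C2 setT (cst L * phi i + cst th).
Proof.
apply: C2D; [exact: openT| |exact: C2_cst].
by apply: C2M; [exact: openT|exact: C2_cst|exact: (ub2_C2 uphi)].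
Qed.

Let is_derive_sinN (x : R) :
  is_derive x (1 : R) (fun y : R => - sin y) ((fun y : R => - cos y) x).
Proof. exact: is_deriveN. Qed.

Let is_derive_cosN (x : R) :
  is_derive x (1 : R) cos ((fun y : R => - sin y) x).
Proof. exact: is_derive_cos. Qed.

Let is_derive_expRid (x : R) : is_derive x (1 : R) expR (expR x).
Proof. exact: is_derive_expR. Qed.

Let C2Fe L i : C2 setT (Fe L i).
Proof.
exact: (C2_comp (h1 := expR) (h2 := expR) openT (C2e L i)
  (fun x _ => is_derive_expRid _) (fun x _ => is_derive_expRid _)).
Qed.

Let C2Fc L th i : C2 setT (Fc L th i).
Proof.
exact: (C2_comp (h1 := fun y : R => - sin y) (h2 := fun y : R => - cos y)
  openT (C2c L th i) (fun x _ => is_derive_cosN _) (fun x _ => is_derive_sinN _)).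
Qed.

Let grad_e L i x : grad (cst (- L) * rho i) x = - L *: grad (rho i) x.
Proof.
rewrite (gradM (@C2_cst _ _ setT (- L)) (ub2_C2 urho i) (Tx x)).
by rewrite grad_cst scaler0 addr0.
Qed.

Let grad_c L th i x : grad (cst L * phi i + cst th) x = L *: grad (phi i) x.
Proof.
have cL := @C2_cst _ _ (@setT V) L.
rewrite (gradD (C2M openT cL (ub2_C2 uphi i)) (@C2_cst _ _ setT _) (Tx x)).
rewrite (gradM cL (ub2_C2 uphi i) (Tx x)).
by rewrite !grad_cst scaler0 !addr0.
Qed.

(** The bracket multiplied by [L ^+ 2] consists of the two eikonal defects only. This gains a factor
    [p] over the size [L ^+ 2] of the second derivatives of the corrector. *)
Lemma elliptic_corrector L th i x :
  elliptic_op A (Fe L i * Fc L th i) x = Fe L i x * (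
    L * (- sin (L * phi i x + th) * elliptic_op A (phi i) x
         - Fc L th i x * elliptic_op A (rho i) x) +
    L ^+ 2 * (Fc L th i x * (qff i x - qrr i x)
       - 2 * (sin (L * phi i x + th) * qrf i x))).
Proof.
rewrite (elliptic_opM dA openT (C2Fe L i) (C2Fc L th i) (Tx x)).
rewrite (elliptic_op_comp (h1 := expR) (h2 := expR) dA openT (C2e L i) (fun x _ => is_derive_expRid _)
   (fun x _ => is_derive_expRid _) (Tx x)).
rewrite (elliptic_op_comp (h1 := fun y : R => - sin y) (h2 := fun y : R => - cos y)
   dA openT (C2c L th i) (fun x _ => is_derive_cosN _)
   (fun x _ => is_derive_sinN _) (Tx x)).
rewrite (grad_comp (h1 := expR) (C2e L i) (fun x _ => is_derive_expRid _) (Tx x)).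
rewrite (grad_comp (h1 := fun y : R => - sin y) (C2c L th i) (fun x _ => is_derive_cosN _) (Tx x)).
rewrite (elliptic_opZ dA openT _ (ub2_C2 urho i) (Tx x)).
have cL := C2M openT (@C2_cst _ _ (@setT V) L) (ub2_C2 uphi i).
rewrite (elliptic_opD dA openT cL (@C2_cst _ _ setT th) (Tx x)).
rewrite (elliptic_opZ dA openT _ (ub2_C2 uphi i) (Tx x)).
rewrite (elliptic_op_cst dA _ (Tx x)) grad_e grad_c !(qAZl, qAZr).
rewrite -/(qrr i x) -/(qff i x) -/(qrf i x).
have E1 : expR ((cst (- L) * rho i) x) = Fe L i x by [].
have E2 : cos ((cst L * phi i + cst th) x) = Fc L th i x by [].
have E3 : sin ((cst L * phi i + cst th) x) = sin (L * phi i x + th) by [].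
rewrite E1 E2 E3.
move: (qrr i x) (qff i x) (qrf i x) (Fe L i x) (Fc L th i x) (sin _).
move: (elliptic_op A (phi i) x) (elliptic_op A (rho i) x) => *.
by ring.
Qed.

(** The constant depends neither on the direction nor on [L] and [th]. The size of [F] is bounded in
    the whole closed half-space because it is needed on the other faces as well; the operator only
    matters inside [D]. *)
Lemma corrector_exists : exists2 C, 0 <= C & forall (omega : V) (L th : R),
  dot omega omega = 1 -> dot omega nu = 0 -> 0 < L ->
  exists F, [/\ C2 setT F,
    forall x, k0 <= dot nu x -> `|F x| <= expR (- (L / c * (dot nu x - k0))),
    forall x, dot nu x = k0 -> F x = cos (L * dot omega x + th) &
    forall x, D x -> `|elliptic_op A F x| <=
      C * expR (- (L / c * (dot nu x - k0))) * (L + L ^+ 2 * (dot nu x - k0))].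
Proof.
have [K1 K10 H1] := ord_ge0 r_ge0 (ord_elliptic r_ge0 (ub2_coef r) dA uphi).
have [K2 K20 H2] := ord_ge0 r_ge0 (ord_elliptic r_ge0 (ub2_coef r) dA urho).
have [K3 K30 H3] := ord_ge0 r_ge0 ord_eik.
have [K4 K40 H4] := ord_ge0 r_ge0 ord_eik2.
exists (K1 + K2 + K3 + 2 * K4) => [|w L th w1 w0 L0]; first by rewrite !addr_ge0// mulr_ge0.
pose i : T := exist _ w (conj w1 w0).
(* The rate [L / c] comes from [M >= c^-1]. *)
have Fe_le x : k0 <= dot nu x -> `|Fe L i x| <= expR (- (L / c * (dot nu x - k0))).
  move=> px; rewrite ger0_norm ?expR_ge0// ler_expR mulNr lerN2 -mulrA ler_pM2l//.
  by apply: ler_pM; rewrite ?invr_ge0 ?(ltW c0) ?subr_ge0// M_ge.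
exists (Fe L i * Fc L th i); split.
- exact: (C2M openT (C2Fe L i) (C2Fc L th i)).
- move=> x /Fe_le H; rewrite -[leRHS]mulr1 normrM ler_pM//.
  by rewrite /Fc /= ler_norml cos_geN1 cos_le1.
- move=> x px; have p0 : p x = 0 by rewrite pE px subrr.
  have -> : (Fe L i * Fc L th i) x = expR (- L * (M i x * p x)) *
     cos (L * (dot w x + (-1) * (N i x * p x)) + th) by [].
  by rewrite p0 !mulr0 expR0 mul1r addr0.
- move=> x Dx; rewrite elliptic_corrector normrM.
  have px : k0 <= dot nu x by rewrite ltW// pD.
  rewrite [X in _ <= X * _]mulrC -[leRHS]mulrA.
  apply: ler_pM; [exact: normr_ge0|exact: normr_ge0|exact: Fe_le|].
  have s1 : `|sin (L * phi i x + th)| <= 1 by rewrite ler_norml sin_geN1 sin_le1.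
  have c1 : `|Fc L th i x| <= 1 by rewrite ler_norml cos_geN1 cos_le1.
  have {}H1 := H1 i x Dx; have {}H2 := H2 i x Dx.
  have {}H3 := H3 i x Dx; have {}H4 := H4 i x Dx.
  rewrite expr0 mulr1 in H1; rewrite expr0 mulr1 in H2.
  rewrite expr1 /r pE in H3; rewrite expr1 /r pE in H4.
  by apply: corrector_arith => //; rewrite subr_ge0.
Qed.

End corrector.
Lemma open_halfspace (nu : V) (k : R) : open [set x : V | k < dot nu x].
Proof.
rewrite (_ : [set x | _] = dotl nu @^-1` [set t | k < t])//.
by apply: open_comp => [x _|]; [exact: dotl_continuous|exact: open_gt].
Qed.

(** * The logarithmic barrier of one face *)

Section log_barrier.
Variables (nu : V) (k0 : R).
Hypothesis nu1 : dot nu nu = 1.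
Hypothesis pD : forall x, D x -> k0 < dot nu x.

Let is_derive_log (mu t : R) : 0 < mu -> 0 < t ->
  is_derive t (1 : R) (fun t => ln (1 - expR (- (mu * t)))) (mu / (expR (mu * t) - 1)).
Proof.
move=> mu0 t0; have mt : 0 < mu * t by exact: mulr_gt0.
have e1 : 0 < 1 - expR (- (mu * t)) by rewrite subr_gt0 -[ltRHS]expR0 ltr_expR oppr_lt0.
have D1 : is_derive t (1 : R) (fun t : R => - (mu * t)) (- mu).
  apply: (is_derive_eq (@is_deriveN _ _ _ _ _ _ _
    (@is_deriveZ _ _ _ id mu t (1 : R) _ (is_derive_id _ _)))).
  by congr (- _); exact: mulr1.
have D2 : is_derive t (1 : R) (fun t : R => expR (- (mu * t)))
    (expR (- (mu * t)) * - mu).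
  exact: (@is_derive1_comp _ expR (fun t : R => - (mu * t)) _ _ _ _ D1).
have D3 : is_derive t (1 : R) (fun t : R => 1 - expR (- (mu * t)))
    (0 - expR (- (mu * t)) * - mu).
  exact: (@is_deriveB _ _ _ (cst (1 : R)) _ _ _ _ _ (is_derive_cst _ _ _) D2).
have D4 := @is_derive1_comp _ (@ln R) (fun t : R => 1 - expR (- (mu * t))) _ _ _
  (is_derive1_ln e1) D3.
rewrite (_ : mu / _ = (1 - expR (- (mu * t)))^-1 * (0 - expR (- (mu * t)) * - mu))//.
rewrite expRN; field.
by rewrite gt_eqF ?expR_gt0//= gt_eqF// subr_gt0 -[ltLHS]expR0 ltr_expR.
Qed.

Let is_derive_log2 (mu t : R) : 0 < mu -> 0 < t ->
  is_derive t (1 : R) (fun t => mu / (expR (mu * t) - 1))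
    (- (mu ^+ 2 * expR (mu * t) / (expR (mu * t) - 1) ^+ 2)).
Proof.
move=> mu0 t0; have mt : 0 < mu * t by exact: mulr_gt0.
have e1 : expR (mu * t) - 1 != 0.
  by rewrite gt_eqF// subr_gt0 -[ltLHS]expR0 ltr_expR.
have D1 : is_derive t (1 : R) (fun t : R => mu * t) mu.
  apply: (is_derive_eq (@is_deriveZ _ _ _ id mu t (1 : R) _ (is_derive_id _ _))).
  exact: mulr1.
have D2 : is_derive t (1 : R) (fun t : R => expR (mu * t)) (expR (mu * t) * mu).
  exact: (@is_derive1_comp _ expR (fun t : R => mu * t) _ _ _ _ D1).
have D3 : is_derive t (1 : R) (fun t : R => expR (mu * t) - 1)
    (expR (mu * t) * mu - 0).
  exact: (@is_deriveB _ _ _ _ (cst (1 : R)) _ _ _ _ D2 (is_derive_cst _ _ _)).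
have D4 := @is_derive_invf _ (fun t : R => expR (mu * t) - 1) t _ e1 D3.
have D5 := @is_deriveZ _ _ _ _ mu _ _ _ D4.
rewrite (_ : - _ = mu * (- (expR (mu * t) - 1) ^- 2 * (expR (mu * t) * mu - 0)))//.
by field.
Qed.

(** The barrier is [ln (1 - exp (- mu (d + eps)))] up to a constant, with [mu] so large
    that the second derivative absorbs the first order terms of the operator. *)
Lemma log_barrier : exists2 k : R * R, 0 < k.1 /\ 0 < k.2 &
  forall eps : R, 0 < eps <= 1 -> exists S,
  [/\ C2 [set x : V | k0 - eps < dot nu x] S,
    forall x, k0 <= dot nu x -> 0 <= S x <= ln (k.2 / eps) &
    forall x, D x -> k.1 / (dot nu x - k0 + eps) ^+ 2 <= elliptic_op A S x].
Proof.
pose r (_ : unit) (_ : V) : R := 1.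
have r_ge0 i x : D x -> 0 <= r i x by [].
have r_bnd : exists K, forall i x, D x -> r i x <= K by exists 1.
have ov : vord D r 0 (fun _ _ => nu) by exact: (vord_unit _ (fun=> nu1)).
have [K K0 HK] := ord_ge0 r_ge0 (ord_dot r_ge0 (ord_divA (ub2_coef r)) ov).
have [P P0 HP] := ord_ge0 r_ge0 (ub2_ord (ub2_dotl r_ge0 bD ov)).
(* [K] bounds the drift [dot (divA x) nu]. The choice yields [K <= mu / (2 * c)], which lets half of
   the second order term absorb the first order one. *)
pose mu := 2 * c * K + 1.
have mu0 : 0 < mu by rewrite ltr_wpDl// !mulr_ge0// ltW.
have muK : K <= mu / (2 * c).
  by rewrite ler_pdivlMr ?mulr_gt0// /mu mulrC lerDl.
(* An upper bound on [D] for [expR (mu * t)] at [t = dot nu x - k0 + eps], using [eps <= 1]. *)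
pose Em := expR (mu * (P + `|k0| + 1)).
exists ((2 * c * Em)^-1, (1 + mu) / mu) => /=.
  by split; [rewrite invr_gt0 !mulr_gt0 ?expR_gt0|rewrite divr_gt0// addr_gt0].
move=> eps /andP[e0 e1].
pose h (t : R) := ln (1 - expR (- (mu * t))).
pose h1 (t : R) := mu / (expR (mu * t) - 1).
pose h2 (t : R) := - (mu ^+ 2 * expR (mu * t) / (expR (mu * t) - 1) ^+ 2).
pose p : V -> R := dotl nu + cst (eps - k0).
have pE x : p x = dot nu x - k0 + eps by rewrite -addrA [- k0 + _]addrC.
pose U := [set x : V | k0 - eps < dot nu x].
have oU : open U by exact: open_halfspace.
have Up x : U x -> 0 < p x by rewrite pE /U/= => H; lra.
have cp : C2 U p by apply: C2D => //; [exact: C2_dotl|exact: C2_cst].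
have dh x : U x -> is_derive (p x) (1 : R) h (h1 (p x)).
  by move=> /Up; exact: is_derive_log.
have dh1 x : U x -> is_derive (p x) (1 : R) h1 (h2 (p x)).
  by move=> /Up; exact: is_derive_log2.
have ch : C2 U (h \o p) by exact: (C2_comp oU cp dh dh1).
have emono (s t : R) : 0 < s -> s <= t -> h s <= h t.
  move=> s0 st; rewrite /h ler_ln ?posrE ?subr_gt0 -?[ltRHS]expR0 ?ltr_expR ?oppr_lt0
    ?mulr_gt0//; last exact: lt_le_trans st.
  by rewrite lerD2l lerN2 ler_expR lerN2 ler_pM2l.
have h_le0 t : 0 < t -> h t <= 0.
  by move=> t0; rewrite /h ln_le0// gerBl expR_ge0.
exists (h \o p + cst (- h eps)); split.
- by apply: C2D => //; exact: C2_cst.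
- move=> x px; have pe : eps <= p x by rewrite pE lerDr subr_ge0.
  have -> : (h \o p + cst (- h eps)) x = h (p x) - h eps by [].
  rewrite subr_ge0 emono//=.
  apply: (@le_trans _ _ (- h eps)).
    by rewrite gerDr h_le0// (lt_le_trans e0).
  have me : 0 < mu * eps by exact: mulr_gt0.
  (* From [1 - exp (- y) >= y / (1 + y)] and [eps <= 1]; this is the origin of the constant
     [(1 + mu) / mu]. *)
  have E : mu * eps / (1 + mu) <= 1 - expR (- (mu * eps)).
    have H := expR_ge1Dx (mu * eps).
    apply: (@le_trans _ _ (1 - (1 + mu * eps)^-1)); last first.
      by rewrite lerD2l lerN2 expRN lef_pV2 ?posrE ?expR_gt0// addr_gt0.
    have -> : 1 - (1 + mu * eps)^-1 = mu * eps / (1 + mu * eps).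
      by field; rewrite gt_eqF// addr_gt0.
    have q1 : 0 < 1 + mu * eps by rewrite addr_gt0.
    have q2 : 0 < 1 + mu by rewrite addr_gt0.
    rewrite (ler_pM2l me) lef_pV2 ?posrE// lerD2l.
    by rewrite ler_piMr// ltW.
  have E0 : 0 < mu * eps / (1 + mu) by rewrite divr_gt0// addr_gt0.
  have E1 : 0 < 1 - expR (- (mu * eps)) by exact: lt_le_trans E.
  have E2 : 0 < (1 + mu) / mu / eps by rewrite !divr_gt0// addr_gt0.
  rewrite /h -lnV ?posrE// ler_ln ?posrE ?invr_gt0//.
  have -> : (1 + mu) / mu / eps = (mu * eps / (1 + mu))^-1.
    by rewrite invf_div invfM mulrA.
  by rewrite lef_pV2 ?posrE.
- move=> x Dx; have Ux : U x by rewrite /U/=; have := pD Dx; lra.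
  have pe : eps < p x by rewrite pE ltrDr subr_gt0 pD.
  have px0 : 0 < p x by exact: lt_trans pe.
  rewrite (elliptic_opD dA oU ch (@C2_cst _ _ U (- h eps)) Ux).
  rewrite (elliptic_op_cst dA _ Ux) addr0.
  rewrite (elliptic_op_comp dA oU cp dh dh1 Ux).
  rewrite (elliptic_opD dA oU (@C2_dotl _ _ U nu) (@C2_cst _ _ U _) Ux).
  rewrite (elliptic_op_cst dA _ Ux) addr0 (elliptic_op_dotl dA _ Ux).
  rewrite (gradD (@C2_dotl _ _ U nu) (@C2_cst _ _ U _) Ux) grad_dotl grad_cst addr0.
  have {}HK : `|dot (divA A x) nu| <= K by have := HK tt x Dx; rewrite expr0 mulr1.
  have HP' : p x <= P + `|k0| + 1.
    have := HP tt x Dx; rewrite expr0 mulr1 => H.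
    have := ler_norm (dot nu x); have := ler_norm (- k0); rewrite normrN.
    have : `|dot nu x| <= P by []. 
    by rewrite pE; lra.
  have HA : c^-1 <= qA A x nu nu by have := Aell x nu; rewrite nu1 mulr1.
  rewrite -pE; move: (qA A x nu nu) HA (dot (divA A x) nu) HK px0 HP' => a HA z HK px0 HP'.
  move: (p x) px0 HP' => t t0 tP.
  rewrite /h1 /h2 mulNr opprK.
  have mt : 0 < mu * t by exact: mulr_gt0.
  pose E := expR (mu * t); rewrite -/E.
  have E1 : 1 < E by rewrite /E -[ltLHS]expR0 ltr_expR.
  have EEm : E <= Em by rewrite ler_expR ler_pM2l.
  have F0 : 0 < E - 1 by rewrite subr_gt0.
  have F1 : E - 1 <= mu * t * E.
    have := expR_ge1Dx (- (mu * t)); rewrite expRN -/E => H.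
    have : (1 - mu * t) * E <= 1 by rewrite -ler_pdivlMr ?div1r// (lt_trans _ E1).
    by rewrite mulrBl mul1r; lra.
  have HzK : z <= K by rewrite (le_trans (ler_norm z)).
  have E0 : 0 < E by exact: lt_trans E1.
  have c20 : 0 < 2 * c by rewrite mulr_gt0.
  (* The intermediate quantity is half of the guaranteed second order term. It dominates
     [k.1 / t ^+ 2] through [E - 1 <= mu * t * E] and [E <= Em], and it also dominates the first
     order term ([G1]), so that [G2] leaves one copy of it. *)
  apply: (@le_trans _ _ (mu ^+ 2 * E / (E - 1) ^+ 2 / (2 * c))).
    have Em0 : 0 < Em by exact: lt_le_trans EEm.
    have -> : (2 * c * Em)^-1 / t ^+ 2 = (Em * t ^+ 2)^-1 / (2 * c).
      by field; rewrite !gt_eqF.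
    have t20 : 0 < t ^+ 2 by rewrite exprn_gt0.
    have E20 : 0 < (E - 1) ^+ 2 by rewrite exprn_gt0.
    have Et0 : 0 < Em * t ^+ 2 by rewrite mulr_gt0.
    have mu20 : 0 < mu ^+ 2 * E by rewrite mulr_gt0// exprn_gt0.
    rewrite ler_pM2r ?invr_gt0// -[leLHS]div1r ler_pdivrMr// mulrAC ler_pdivlMr// mul1r.
    apply: (@le_trans _ _ ((mu * t * E) ^+ 2)).
      by rewrite lerXn2r// nnegrE ltW// mulr_gt0.
    have -> : (mu * t * E) ^+ 2 = mu ^+ 2 * E * (E * t ^+ 2) by ring.
    by rewrite (ler_pM2l mu20) (ler_pM2r t20).
  have G1 : mu / (E - 1) * z <= mu ^+ 2 * E / (E - 1) ^+ 2 / (2 * c).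
    apply: (@le_trans _ _ (mu / (E - 1) * (mu / (2 * c)))).
      by rewrite ler_pM2l ?divr_gt0// (le_trans HzK).
    have -> : mu ^+ 2 * E / (E - 1) ^+ 2 / (2 * c) =
       mu / (E - 1) * (mu / (2 * c)) * (E / (E - 1)).
      by field; rewrite !gt_eqF.
    rewrite ler_peMr ?mulr_ge0 ?invr_ge0 ?ltW// ltr_pdivlMr// mul1r.
    by rewrite ltrBlDr ltrDl.
  have G2 : 2 * (mu ^+ 2 * E / (E - 1) ^+ 2 / (2 * c)) <=
      mu ^+ 2 * E / (E - 1) ^+ 2 * a.
    have -> : 2 * (mu ^+ 2 * E / (E - 1) ^+ 2 / (2 * c)) =
       mu ^+ 2 * E / (E - 1) ^+ 2 * c^-1 by field; rewrite !gt_eqF.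
    by rewrite ler_pM2l// divr_gt0 ?mulr_gt0 ?exprn_gt0.
  move: G1 G2; set W := mu ^+ 2 * E / (E - 1) ^+ 2 / (2 * c).
  set Y := _ * a; rewrite mulrN; lra.
Qed.

End log_barrier.

(** * The barrier of a pair of faces *)

Section ridge_barrier.
Variables (nu nu' : V) (k k' : R).
Hypotheses (nu1 : dot nu nu = 1) (nu1' : dot nu' nu' = 1).
Hypothesis nuN : dot nu nu' < 1.
Hypotheses (pD : forall x, D x -> k < dot nu x) (pD' : forall x, D x -> k' < dot nu' x).

(** Here the index is [eps], and orders are counted in [r], the sum of the two shifted distances;
    every bound is thus uniform in [eps]. *)
Let T := {eps : R | 0 < eps <= 1}.
Let P (i : T) : V -> R := dotl nu + cst (sval i - k).
Let P' (i : T) : V -> R := dotl nu' + cst (sval i - k').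
Let s (i : T) : V -> R := P i + P' i.
Let r (i : T) (x : V) : R := s i x.

Let PE i x : P i x = dot nu x - k + sval i.
Proof. by rewrite -addrA [- k + _]addrC. Qed.
Let PE' i x : P' i x = dot nu' x - k' + sval i.
Proof. by rewrite -addrA [- k' + _]addrC. Qed.

Let T_gt0 (i : T) : 0 < sval i. Proof. by have /andP[] := svalP i. Qed.

Let P_gt0 i x : D x -> 0 < P i x.
Proof. by move=> /pD ?; rewrite PE addr_gt0// ?subr_gt0//; exact: T_gt0. Qed.
Let P_gt0' i x : D x -> 0 < P' i x.
Proof. by move=> /pD' ?; rewrite PE' addr_gt0// ?subr_gt0//; exact: T_gt0. Qed.

Let r_ge0 i x : D x -> 0 <= r i x.
Proof. by move=> Dx; rewrite ltW// addr_gt0 ?P_gt0 ?P_gt0'. Qed.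

Let ov : vord D r 0 (fun _ _ => nu). Proof. exact: (vord_unit _ (fun=> nu1)). Qed.
Let ov' : vord D r 0 (fun _ _ => nu'). Proof. exact: (vord_unit _ (fun=> nu1')). Qed.

Let ub2_shift (m : R) : ub2 D r (fun i : T => cst (sval i - m)).
Proof.
apply: ub2_cst; exists (1 + `|m|) => i x Dx; rewrite expr0 mulr1.
rewrite (le_trans (ler_normB _ _))// lerD2r (gtr0_norm (T_gt0 i)).
by have /andP[] := svalP i.
Qed.

Let uP : ub2 D r P. Proof. exact: (ub2D (ub2_dotl r_ge0 bD ov) (ub2_shift k)). Qed.
Let uP' : ub2 D r P'. Proof. exact: (ub2D (ub2_dotl r_ge0 bD ov') (ub2_shift k')). Qed.
Let us : ub2 D r s. Proof. exact: (ub2D uP uP'). Qed.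

Let r_bnd : exists K : R, forall i x, D x -> r i x <= K.
Proof.
have [K HK] := ub2_ord us; exists K => i x Dx.
by have := HK i x Dx; rewrite expr0 mulr1; apply: le_trans; exact: ler_norm.
Qed.

Let oP : ord D r 1 P.
Proof.
exists 1 => i x Dx; rewrite mul1r expr1 (gtr0_norm (P_gt0 i Dx)).
by rewrite /r /s -[leRHS]/(P i x + P' i x) lerDl (ltW (P_gt0' i Dx)).
Qed.
Let oP' : ord D r 1 P'.
Proof.
exists 1 => i x Dx; rewrite mul1r expr1 (gtr0_norm (P_gt0' i Dx)).
by rewrite /r /s -[leRHS]/(P i x + P' i x) lerDr (ltW (P_gt0 i Dx)).
Qed.
Let os : ord D r 1 s.
Proof. by exists 1 => i x Dx; rewrite mul1r expr1 ger0_norm//; exact: r_ge0. Qed.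

Let a x := qA A x nu nu.
Let b x := qA A x nu nu'.
Let e x := qA A x nu' nu'.
Let ua : ub2 D r (fun _ => a).
Proof. exact: (ub2_qA r_ge0 (ub2_coef r) ov ov). Qed.
Let ub : ub2 D r (fun _ => b).
Proof. exact: (ub2_qA r_ge0 (ub2_coef r) ov ov'). Qed.
Let ue : ub2 D r (fun _ => e).
Proof. exact: (ub2_qA r_ge0 (ub2_coef r) ov' ov'). Qed.

(** In the two variables [P] and [P'], the form [Q] is the squared distance to
    the ridge for the metric of [A^-1], up to the factor [Dt]. Hence, for frozen
    coefficients, [s / Q] is the Kelvin transform of a linear function and is
    harmonic; the remainder is one order better than each of the second derivatives. *)
Let Q1 (i : T) : V -> R := (e : V -> R) * (P i * P i).
Let Q2 (i : T) : V -> R := cst (-2) * ((b : V -> R) * (P i * P' i)).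
Let Q3 (i : T) : V -> R := (a : V -> R) * (P' i * P' i).
Let Q (i : T) : V -> R := Q1 i + Q2 i + Q3 i.

Let Tx (x : V) : (setT : set V) x. Proof. by []. Qed.

Let cP i := ub2_C2 uP i.
Let cP' i := ub2_C2 uP' i.
(** [a] does not depend on the index; [eps = 1] selects one member of the constant family. *)
Let ca : C2 setT (a : V -> R).
Proof. exact: (ub2_C2 ua (exist _ 1 (introT andP (conj ltr01 (lexx 1))))). Qed.
Let cb : C2 setT (b : V -> R).
Proof. exact: (ub2_C2 ub (exist _ 1 (introT andP (conj ltr01 (lexx 1))))). Qed.
Let ce : C2 setT (e : V -> R).
Proof. exact: (ub2_C2 ue (exist _ 1 (introT andP (conj ltr01 (lexx 1))))). Qed.
Let c2 : C2 (setT : set V) (cst (-2) : V -> R) := @C2_cst _ _ setT (-2).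

Let cQ1 i : C2 setT (Q1 i). Proof. exact: (C2M openT ce (C2M openT (cP i) (cP i))). Qed.
Let cQ2' i : C2 setT ((b : V -> R) * (P i * P' i)).
Proof. exact: (C2M openT cb (C2M openT (cP i) (cP' i))). Qed.
Let cQ2 i : C2 setT (Q2 i). Proof. exact: (C2M openT c2 (cQ2' i)). Qed.
Let cQ3 i : C2 setT (Q3 i). Proof. exact: (C2M openT ca (C2M openT (cP' i) (cP' i))). Qed.
Let cQ i : C2 setT (Q i).
Proof. exact: (C2D openT (C2D openT (cQ1 i) (cQ2 i)) (cQ3 i)). Qed.

Let QE i x : Q i x = e x * (P i x * P i x) + (-2) * (b x * (P i x * P' i x)) +
  a x * (P' i x * P' i x).
Proof. by []. Qed.

Let grad_P i x : grad (P i) x = nu.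
Proof.
rewrite (gradD (@C2_dotl _ _ setT nu) (@C2_cst _ _ setT _) (Tx x)).
by rewrite grad_dotl grad_cst addr0.
Qed.
Let grad_P' i x : grad (P' i) x = nu'.
Proof.
rewrite (gradD (@C2_dotl _ _ setT nu') (@C2_cst _ _ setT _) (Tx x)).
by rewrite grad_dotl grad_cst addr0.
Qed.
Let grad_s i x : grad (s i) x = nu + nu'.
Proof. by rewrite (gradD (cP i) (cP' i) (Tx x)) grad_P grad_P'. Qed.

(** The gradient of [Q] splits into the part with [a], [b], [e] frozen, of order 1, and the part
    [gE] carrying their derivatives, of order 2. *)
Let gT i x := (2 * (e x * P i x - b x * P' i x)) *: nu +
              (2 * (a x * P' i x - b x * P i x)) *: nu'.
Let gE i x := (P i x * P i x) *: grad e x + ((-2) * (P i x * P' i x)) *: grad b x +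
              (P' i x * P' i x) *: grad a x.

Let grad_Q i x : grad (Q i) x = gT i x + gE i x.
Proof.
rewrite (gradD (C2D openT (cQ1 i) (cQ2 i)) (cQ3 i) (Tx x)).
rewrite (gradD (cQ1 i) (cQ2 i) (Tx x)).
rewrite (gradM ce (C2M openT (cP i) (cP i)) (Tx x)) (gradM (cP i) (cP i) (Tx x)).
rewrite (gradM c2 (cQ2' i) (Tx x)) (gradM cb (C2M openT (cP i) (cP' i)) (Tx x)).
rewrite (gradM (cP i) (cP' i) (Tx x)).
rewrite (gradM ca (C2M openT (cP' i) (cP' i)) (Tx x)) (gradM (cP' i) (cP' i) (Tx x)).
rewrite grad_cst grad_P grad_P' /gT /gE.
have -> : (P i * P i) x = P i x * P i x by [].
have -> : (P' i * P' i) x = P' i x * P' i x by [].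
have -> : (P i * P' i) x = P i x * P' i x by [].
apply/rowP => l; rewrite !mxE /cst.
move: (P i x) (P' i x) (a x) (b x) (e x) (nu 0 l) (nu' 0 l) => *.
move: (grad a x 0 l) (grad b x 0 l) (grad e x 0 l) => *.
ring.
Qed.

(** The Gram determinant of [nu] and [nu'] for the form of [A]. *)
Let Dt x := a x * e x - b x ^+ 2.

Let oa : ord D r 0 (fun _ => a) := ub2_ord ua.
Let ob : ord D r 0 (fun _ => b) := ub2_ord ub.
Let oe : ord D r 0 (fun _ => e) := ub2_ord ue.
Let ok (m : R) : ord D r 0 (fun (_ : T) (_ : V) => m). Proof. exact: ord_cst. Qed.

Let vT : vord D r 1 gT.
Proof.
apply: vordD.
  apply: (@vordZ _ _ _ _ _ r_ge0 1 0) => //; apply: ordM0 => //.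
  by apply: ordB; exact: ordM0.
apply: (@vordZ _ _ _ _ _ r_ge0 1 0) => //; apply: ordM0 => //.
by apply: ordB; exact: ordM0.
Qed.

Let vE : vord D r 2 gE.
Proof.
have oPP := ordM r_ge0 oP oP; have oPP' := ordM r_ge0 oP oP'.
have oP'P' := ordM r_ge0 oP' oP'.
apply: vordD; first apply: vordD.
- exact: (@vordZ _ _ _ _ _ r_ge0 2 0 _ _ oPP (ub2_grad ue)).
- by apply: (@vordZ _ _ _ _ _ r_ge0 2 0 _ _ _ (ub2_grad ub)); exact: ordM0.
- exact: (@vordZ _ _ _ _ _ r_ge0 2 0 _ _ oP'P' (ub2_grad ua)).
Qed.

Let oqA m n u v (hu : vord D r m u) (hv : vord D r n v) :
  ord D r (m + n) (fun i x => qA A x (u i x) (v i x)).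
Proof. exact: (ord_qA r_ge0 (@oA T r) hu hv). Qed.

Let qQQ i x := qA A x (grad (Q i) x) (grad (Q i) x).
Let qsQ i x := qA A x (grad (s i) x) (grad (Q i) x).

(** For frozen coefficients the identity is exact, as for the gradient of a squared distance; what
    remains contains [gE] at least once. *)
Let ord_qQQ : ord D r 3 (fun i x => qQQ i x - 4 * (Dt x * Q i x)).
Proof.
apply: (@ord_eq _ _ _ _ _ _ (fun i x => 2 * qA A x (gT i x) (gE i x) +
   qA A x (gE i x) (gE i x))).
  move=> i x Dx; rewrite /qQQ grad_Q.
  have sq u v : qA A x (u + v) (u + v) = qA A x u u + 2 * qA A x u v + qA A x v v.
    by rewrite qADl !qADr (qAC A x v u); ring.
  rewrite (sq (gT i x)).
  have -> : qA A x (gT i x) (gT i x) = 4 * (Dt x * Q i x).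
    rewrite /gT !(qADl, qADr, qAZl, qAZr) (qAC A x nu' nu) -/(a x) -/(b x) -/(e x).
    rewrite QE /Dt.
    by move: (P i x) (P' i x) (a x) (b x) (e x) => *; ring.
  by move: (qA A x (gT i x) (gE i x)) (qA A x (gE i x) (gE i x)) (Dt x * _) => *; ring.
apply: ordD; first by apply: ordM0 => //; exact: (oqA vT vE).
by apply: (ordW r_ge0 r_bnd _ (oqA vE vE)).
Qed.

Let ord_qsQ : ord D r 2 (fun i x => qsQ i x - 2 * (Dt x * s i x)).
Proof.
apply: (@ord_eq _ _ _ _ _ _ (fun i x => qA A x (nu + nu') (gE i x))).
  move=> i x Dx; rewrite /qsQ grad_Q grad_s (qADr A x (gT i x)).
  have -> : qA A x (nu + nu') (gT i x) = 2 * (Dt x * s i x).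
    rewrite /gT !(qADl, qADr, qAZl, qAZr) (qAC A x nu' nu) -/(a x) -/(b x) -/(e x).
    rewrite /s /Dt -[(P i + P' i) x]/(P i x + P' i x).
    by move: (P i x) (P' i x) (a x) (b x) (e x) => *; ring.
  by move: (qA A x (nu + nu') (gE i x)) (Dt x * _) => *; ring.
exact: (oqA (vordD ov ov') vE).
Qed.

Let LP i x := elliptic_op A (P i) x.
Let LP' i x := elliptic_op A (P' i) x.
Let La x := elliptic_op A a x.
Let Lb x := elliptic_op A b x.
Let Le x := elliptic_op A e x.
Let oLP : ord D r 0 LP. Proof. exact: (ord_elliptic r_ge0 (ub2_coef r) dA uP). Qed.
Let oLP' : ord D r 0 LP'. Proof. exact: (ord_elliptic r_ge0 (ub2_coef r) dA uP'). Qed.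
Let oLs : ord D r 0 (fun i x => elliptic_op A (s i) x).
Proof. exact: (ord_elliptic r_ge0 (ub2_coef r) dA us). Qed.
Let oLa : ord D r 0 (fun _ => La). Proof. exact: (ord_elliptic r_ge0 (ub2_coef r) dA ua). Qed.
Let oLb : ord D r 0 (fun _ => Lb). Proof. exact: (ord_elliptic r_ge0 (ub2_coef r) dA ub). Qed.
Let oLe : ord D r 0 (fun _ => Le). Proof. exact: (ord_elliptic r_ge0 (ub2_coef r) dA ue). Qed.

Let LQ_rest i x : R :=
  P i x * (2 * (e x * LP i x) + P i x * Le x - 4 * qA A x (grad e x) nu) +
  (P i x * ((-2) * (b x * LP' i x) - 2 * (P' i x * Lb x) + 4 * qA A x (grad b x) nu') +
   P' i x * ((-2) * (b x * LP i x) + 4 * qA A x (grad b x) nu)) +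
  P' i x * (2 * (a x * LP' i x) + P' i x * La x - 4 * qA A x (grad a x) nu').

Let LQE i x : elliptic_op A (Q i) x = LQ_rest i x - 4 * Dt x.
Proof.
rewrite (elliptic_opD dA openT (C2D openT (cQ1 i) (cQ2 i)) (cQ3 i) (Tx x)).
rewrite (elliptic_opD dA openT (cQ1 i) (cQ2 i) (Tx x)).
rewrite (elliptic_opM dA openT ce (C2M openT (cP i) (cP i)) (Tx x)).
rewrite (elliptic_opM dA openT (cP i) (cP i) (Tx x)) (gradM (cP i) (cP i) (Tx x)).
rewrite (elliptic_opZ dA openT _ (cQ2' i) (Tx x)).
rewrite (elliptic_opM dA openT cb (C2M openT (cP i) (cP' i)) (Tx x)).
rewrite (elliptic_opM dA openT (cP i) (cP' i) (Tx x)) (gradM (cP i) (cP' i) (Tx x)).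
rewrite (elliptic_opM dA openT ca (C2M openT (cP' i) (cP' i)) (Tx x)).
rewrite (elliptic_opM dA openT (cP' i) (cP' i) (Tx x)) (gradM (cP' i) (cP' i) (Tx x)).
rewrite grad_P grad_P' !(qADl, qADr, qAZl, qAZr) -/(a x) -/(b x) -/(e x).
have -> : (P i * P i) x = P i x * P i x by [].
have -> : (P' i * P' i) x = P' i x * P' i x by [].
have -> : (P i * P' i) x = P i x * P' i x by [].
rewrite -/(LP i x) -/(LP' i x) -/(La x) -/(Lb x) -/(Le x) /LQ_rest /Dt.
move: (LP i x) (LP' i x) (La x) (Lb x) (Le x) (a x) (b x) (e x) (P i x) (P' i x) => *.
move: (qA A x (grad e x) nu) (qA A x (grad b x) nu) (qA A x (grad b x) nu') => *.
move: (qA A x (grad a x) nu') => *.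
by ring.
Qed.

Let ord_LQ : ord D r 1 LQ_rest.
Proof.
have P0 : ord D r 0 P := ub2_ord uP.
have P0' : ord D r 0 P' := ub2_ord uP'.
have q1 u v (hu : vord D r 0 u) (hv : vord D r 0 v) : ord D r 0 (fun i x => qA A x (u i x) (v i x)).
  exact: oqA hu hv.
have vge := ub2_grad ue; have vgb := ub2_grad ub; have vga := ub2_grad ua.
have M1 F G : ord D r 1 F -> ord D r 0 G -> ord D r 1 (fun i x => F i x * G i x).
  exact: ordM.
have M0 F G : ord D r 0 F -> ord D r 0 G -> ord D r 0 (fun i x => F i x * G i x).
  exact: ordM0.
have t1 := M1 _ _ oP (ordB (ordD (M0 _ _ (ok 2) (M0 _ _ oe oLP)) (M0 _ _ P0 oLe))
   (M0 _ _ (ok 4) (q1 _ _ vge ov))).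
have t2 := M1 _ _ oP (ordD (ordB (M0 _ _ (ok (-2)) (M0 _ _ ob oLP'))
   (M0 _ _ (ok 2) (M0 _ _ P0' oLb))) (M0 _ _ (ok 4) (q1 _ _ vgb ov'))).
have t3 := M1 _ _ oP' (ordD (M0 _ _ (ok (-2)) (M0 _ _ ob oLP))
   (M0 _ _ (ok 4) (q1 _ _ vgb ov))).
have t4 := M1 _ _ oP' (ordB (ordD (M0 _ _ (ok 2) (M0 _ _ oa oLP')) (M0 _ _ P0' oLa))
   (M0 _ _ (ok 4) (q1 _ _ vga ov'))).
exact: (ordD (ordD t1 (ordD t2 t3)) t4).
Qed.

Let num i x := - (s i x * Q i x * LQ_rest i x) - 2 * (s i x * (qQQ i x - 4 * (Dt x * Q i x))) +
   Q i x * Q i x * elliptic_op A (s i) x + 2 * (Q i x * (qsQ i x - 2 * (Dt x * s i x))).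

Let oQ : ord D r 2 Q.
Proof.
exact: (ordD (ordD (ordM0 r_ge0 oe (ordM r_ge0 oP oP))
  (ordM0 r_ge0 (ok (-2)) (ordM0 r_ge0 ob (ordM r_ge0 oP oP'))))
  (ordM0 r_ge0 oa (ordM r_ge0 oP' oP'))).
Qed.

Let ord_num : ord D r 4 num.
Proof.
apply: ordD; first apply: ordD; first apply: ordB.
- by apply: ordN; exact: (ordM r_ge0 (ordM r_ge0 os oQ) ord_LQ).
- by apply: ordM0 => //; exact: (ordM r_ge0 os ord_qQQ).
- exact: (ordM r_ge0 (ordM r_ge0 oQ oQ) oLs).
- by apply: ordM0 => //; exact: (ordM r_ge0 oQ ord_qsQ).
Qed.

Let t := dot nu nu'.
Let kap := c^-1 * ((1 - t) / 4).
Let kap_gt0 : 0 < kap.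
Proof. by rewrite mulr_gt0 ?invr_gt0// divr_gt0// subr_gt0. Qed.

Let t_ge : -1 <= t.
Proof.
have : 0 <= dot (nu + nu') (nu + nu').
  by rewrite /dot sumr_ge0// => j _; rewrite -expr2 sqr_ge0.
rewrite dotDr !dotDl nu1 nu1' (dotC nu' nu) -/t; lra.
Qed.

(** [Q] is the form at [P nu' - P' nu], whose squared length is [(1 + t) / 2 * (P - P')^2 + (1 - t)
    / 2 * (P + P')^2]. As [-1 <= t < 1], this is comparable to [s ^+ 2]. *)
Let Q_bounds i x : 0 <= P i x -> 0 <= P' i x ->
  kap * s i x ^+ 2 <= Q i x <= c * s i x ^+ 2.
Proof.
move=> P0 P0'; have := Aell x (P i x *: nu' - P' i x *: nu).
have := Aup x (P i x *: nu' - P' i x *: nu).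
rewrite -scaleNr dotDr !dotDl !dotZl !dotZr nu1 nu1' (dotC nu' nu) -/t.
rewrite !(qADl, qADr, qAZl, qAZr) (qAC A x nu' nu) -/(a x) -/(b x) -/(e x).
rewrite QE /s -[(P i + P' i) x]/(P i x + P' i x).
move: (P i x) (P' i x) P0 P0' => p q p0 q0 H1 H2.
have -> : e x * (p * p) + (-2) * (b x * (p * q)) + a x * (q * q) =
   p * (p * e x + - q * b x) + (p * (- q * b x) + - q * (- q * a x)) by ring.
have pq : 0 <= p * q by rewrite mulr_ge0.
apply/andP; split; [refine (le_trans _ H2)|refine (le_trans H1 _)].
  rewrite /kap -mulrA ler_pM2l ?invr_gt0//.
  have t1 : 0 <= 1 - t by rewrite subr_ge0 ltW.
  have t2 : 0 <= 1 + t by have := t_ge; lra.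
  have h1 : 0 <= (1 - t) * (p - q) ^+ 2 by rewrite mulr_ge0// sqr_ge0.
  have h2 : 0 <= (1 + t) * (p - q) ^+ 2 by rewrite mulr_ge0// sqr_ge0.
  have h3 : 0 <= (1 - t) * (p * q) by rewrite mulr_ge0.
  have h4 : 0 <= (1 - t) * (p + q) ^+ 2 by rewrite mulr_ge0// sqr_ge0.
  rewrite !expr2 in h1 h2 h4 *; nra.
rewrite ler_pM2l// expr2.
have t2 : 0 <= (1 + t) * (p * q) by rewrite mulr_ge0//; have := t_ge; lra.
nra.
Qed.

(** Both shifted distances are positive here; thanks to the shift by [eps], the ridge itself lies in
    this open set. *)
Let U (i : T) := [set x | k - sval i < dot nu x] `&` [set x | k' - sval i < dot nu' x].
Let oU i : open (U i). Proof. by apply: openI; exact: open_halfspace. Qed.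

Let U_pos i x : U i x -> 0 < P i x /\ 0 < P' i x.
Proof. by rewrite /U/= PE PE' => -[h1 h2]; split; lra. Qed.

Let Q_gt0 i x : 0 < P i x -> 0 < P' i x -> 0 < Q i x.
Proof.
move=> p0 p0'; have /andP[+ _] := Q_bounds (ltW p0) (ltW p0').
by apply: lt_le_trans; rewrite mulr_gt0// exprn_gt0// addr_gt0.
Qed.

Let B (i : T) : V -> R := s i * (GRing.inv \o Q i).

Let dV i x : U i x -> is_derive (Q i x) (1 : R) GRing.inv ((fun y : R => - (y ^- 2)) (Q i x)).
Proof. by move=> /U_pos[p q]; apply: is_derive_inv; rewrite gt_eqF// Q_gt0. Qed.
Let dV2 i x : U i x -> is_derive (Q i x) (1 : R) (fun y : R => - (y ^- 2))
  ((fun y : R => 2 * y ^- 3) (Q i x)).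
Proof. by move=> /U_pos[p q]; apply: is_derive_inv2; rewrite gt_eqF// Q_gt0. Qed.

Let cQU i : C2 (U i) (Q i). Proof. exact: C2_sub (cQ i). Qed.
Let csU i : C2 (U i) (s i). Proof. exact: C2_sub (ub2_C2 us i). Qed.
Let cVU i : C2 (U i) (GRing.inv \o Q i).
Proof. exact: (C2_comp (h := GRing.inv) (h1 := fun y : R => - (y ^- 2))
  (h2 := fun y : R => 2 * y ^- 3) (@oU i) (@cQU i) (fun x => @dV i x) (fun x => @dV2 i x)). Qed.

Let LBE i x : U i x -> elliptic_op A (B i) x = num i x / Q i x ^+ 3.
Proof.
move=> Ux; have [p0 p0'] := U_pos Ux.
rewrite (elliptic_opM dA (@oU i) (@csU i) (@cVU i) Ux).
rewrite (elliptic_op_comp (h := GRing.inv) (h1 := fun y : R => - (y ^- 2))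
  (h2 := fun y : R => 2 * y ^- 3) dA (@oU i) (@cQU i) (fun x => @dV i x) (fun x => @dV2 i x) Ux).
rewrite (grad_comp (h := GRing.inv) (h1 := fun y : R => - (y ^- 2)) (@cQU i) (fun x => @dV i x) Ux) qAZr -/(qQQ i x) -/(qsQ i x).
rewrite LQE /num -[(GRing.inv \o Q i) x]/((Q i x)^-1).
have := Q_gt0 p0 p0'; move: (Q i x) (s i x) (elliptic_op A (s i) x) => q y z q0.
move: (LQ_rest i x) (qQQ i x) (qsQ i x) (Dt x) => *.
by field; rewrite gt_eqF.
Qed.

(** Since [Q] is comparable to [s ^+ 2], the function [s / Q] is comparable to [1 / s], and
    [num / Q ^+ 3] is of size [s^4 / s^6]. The three summands of the constant serve the lower bound,
    the upper bound and the operator bound, in this order. *)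
Lemma ridge_barrier : exists2 C : R, 0 < C & forall eps : R, 0 < eps <= 1 -> exists B,
  [/\ C2 ([set x | k - eps < dot nu x] `&` [set x | k' - eps < dot nu' x]) B,
    forall x, k <= dot nu x -> k' <= dot nu' x ->
      C^-1 / (dot nu x - k + eps + (dot nu' x - k' + eps)) <= B x <=
      C / (dot nu x - k + eps + (dot nu' x - k' + eps)) &
    forall x, D x -> `|elliptic_op A B x| <=
      C / (dot nu x - k + eps + (dot nu' x - k' + eps)) ^+ 2].
Proof.
have [K K0 HK] := ord_ge0 r_ge0 ord_num.
have c1 : 0 < kap^-1 by rewrite invr_gt0.
have c3 : 0 < kap ^- 3 by rewrite invr_gt0 exprn_gt0.
exists (c + kap^-1 + K * kap ^- 3) => [|eps he].
  by rewrite ltr_wpDr ?addr_gt0// mulr_ge0// ltW.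
have Kk : 0 <= K * kap ^- 3 by rewrite mulr_ge0// ltW.
pose i : T := exist _ eps he.
have e0 : 0 < eps by have /andP[] := he.
have sE x : s i x = dot nu x - k + eps + (dot nu' x - k' + eps).
  by rewrite -(PE i) -(PE' i).
exists (B i); split.
- exact: (C2M (@oU i) (@csU i) (@cVU i)).
- move=> x px px'; rewrite -sE.
  have p0 : 0 < P i x by rewrite PE ltr_wpDl ?subr_ge0.
  have p0' : 0 < P' i x by rewrite PE' ltr_wpDl ?subr_ge0.
  have s0 : 0 < s i x by rewrite addr_gt0.
  have q0 := Q_gt0 p0 p0'.
  have /andP[h1 h2] := Q_bounds (ltW p0) (ltW p0').
  rewrite -[B i x]/(s i x / Q i x).
  apply/andP; split.
    apply: (@le_trans _ _ (c^-1 / s i x)).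
      rewrite ler_pM2r ?invr_gt0// lef_pV2 ?posrE//; last first.
        by rewrite ltr_wpDr ?addr_gt0.
      by rewrite -addrA lerDl addr_ge0// ltW.
    have cs : c^-1 / s i x * Q i x <= s i x.
      rewrite mulrAC ler_pdivrMr// mulrC ler_pdivrMr// mulrC.
      by rewrite -expr2.
    by rewrite ler_pdivlMr.
  apply: (@le_trans _ _ (kap^-1 / s i x)); last first.
    rewrite ler_pM2r ?invr_gt0//.
    by rewrite -addrA addrCA lerDl addr_ge0// ltW.
  rewrite ler_pdivrMr// mulrAC ler_pdivlMr// [leRHS]mulrC ler_pdivlMr//.
  by rewrite -expr2 mulrC.
- move=> x Dx; rewrite -sE.
  have p0 := P_gt0 i Dx; have p0' := P_gt0' i Dx.
  have s0 : 0 < s i x by rewrite addr_gt0.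
  have q0 := Q_gt0 p0 p0'.
  have /andP[h1 h2] := Q_bounds (ltW p0) (ltW p0').
  have Ux : U i x.
    have h3 : 0 < dot nu x - k + sval i by rewrite -PE.
    have h4 : 0 < dot nu' x - k' + sval i by rewrite -PE'.
    by split; [move: h3|move: h4] => /=; lra.
  rewrite (LBE Ux) normrM (@ger0_norm _ (Q i x ^+ 3)^-1); last first.
    by rewrite invr_ge0 exprn_ge0// ltW.
  rewrite ler_pdivrMr ?exprn_gt0//.
  apply: (le_trans (HK i x Dx)); rewrite /r.
  apply: (@le_trans _ _ (K * kap ^- 3 / s i x ^+ 2 * (kap * s i x ^+ 2) ^+ 3)).
    rewrite le_eqVlt; apply/orP; left; apply/eqP; field.
    by rewrite !gt_eqF.
  apply: ler_pM.
  - by rewrite divr_ge0// exprn_ge0// ltW.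
  - by rewrite exprn_ge0// mulr_ge0 ?exprn_ge0// ltW.
  - by rewrite ler_pM2r ?invr_gt0 ?exprn_gt0// lerDr addr_ge0// ltW.
  - have h0 : 0 < kap * s i x ^+ 2 by rewrite mulr_gt0// exprn_gt0.
    by rewrite lerXn2r// nnegrE ltW.
Qed.

End ridge_barrier.
End barriers.
(** * Trigonometric approximation of periodic functions *)

Section trigonometric.
Context (R : realType).
Implicit Types s t x : R.

Definition cexp t : R[i] := Complex (cos t) (sin t).
Local Notation normc := ComplexField.Normc.normc.

Lemma cexpD s t : cexp (s + t) = cexp s * cexp t.
Proof.
rewrite /cexp cosD sinD; apply/eqP; rewrite eq_complex /=.
by rewrite eqxx /= [X in _ == X]addrC.
Qed.

Lemma cexp0 : cexp 0 = 1.
Proof. by rewrite /cexp cos0 sin0. Qed.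

Lemma cexp_sum (I : finType) (F : I -> R) : cexp (\sum_i F i) = \prod_i cexp (F i).
Proof. by apply: (big_morph cexp cexpD cexp0). Qed.

Lemma cexpMn t n : cexp (n%:R * t) = cexp t ^+ n.
Proof.
elim: n => [|n IH]; first by rewrite mul0r cexp0.
by rewrite exprS -IH -cexpD -[n.+1]add1n natrD mulrDl mul1r.
Qed.

Lemma cexpNK t : cexp (- t) * cexp t = 1.
Proof. by rewrite -cexpD addNr cexp0. Qed.

Lemma normc_cexp t : normc (cexp t) = 1.
Proof. by rewrite /= cos2Dsin2 sqrtr1. Qed.

Lemma cexp_2pi_nat (n : nat) : cexp (2 * pi * n%:R) = 1.
Proof.
rewrite [_ * n%:R]mulrC cexpMn (_ : cexp _ = 1) ?expr1n//.
by rewrite /cexp mulr_natl cos2pi sin2pi.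
Qed.

Lemma cexp_2pi_int (z : int) : cexp (2 * pi * z%:~R) = 1.
Proof.
case: z => n; first exact: cexp_2pi_nat.
rewrite NegzE rmorphN /= mulrN -[LHS]mulr1 -[X in _ * X](cexp_2pi_nat n.+1).
exact: cexpNK.
Qed.

Lemma normc_cexpB1 t : normc (cexp t - 1) = 2 * `|sin (t / 2)|.
Proof.
have E : (cos t - 1) ^+ 2 + (sin t - 0) ^+ 2 = (2 * sin (t / 2)) ^+ 2.
  have ht : t = (t / 2) *+ 2 by rewrite -mulr_natr divfK.
  rewrite {1 2}ht cos_mulr2n sin_mulr2n.
  have := cos2Dsin2 (t / 2); move: (cos (t / 2)) (sin (t / 2)) => u v H.
  have h : u ^+ 2 = 1 - v ^+ 2 by rewrite -H addrK.
  have -> : (u * v *+ 2 - 0) ^+ 2 = 4 * u ^+ 2 * v ^+ 2 by ring.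
  by rewrite h; ring.
have -> : normc (cexp t - 1) = Num.sqrt ((cos t - 1) ^+ 2 + (sin t - 0) ^+ 2) by [].
by rewrite E sqrtr_sqr normrM ger0_norm.
Qed.

(** With [y = x / 2]: [sin x = 2 sin y cos y], [sin y >= y cos y] by the mean value theorem, and
    [2 cos^2 y = 1 + cos x >= 1]. *)
Lemma sin_ge_half x : 0 <= x <= pi / 2 -> x / 2 <= sin x.
Proof.
move=> /andP[x0 x1].
have [->|xn0] := eqVneq x 0; first by rewrite mul0r sin0.
pose y := x / 2; have y0 : 0 < y by rewrite divr_gt0// lt_def xn0.
have yp : y <= pi / 2 / 2 by rewrite ler_pM2r.
have pi0 := pi_gt0 R.
have [z zy E] := @MVT R sin cos 0 y y0 (fun x _ => is_derive_sin x)
   (continuous_subspaceT (@continuous_sin R)).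
move: zy; rewrite in_itv /= => /andP[z0 zy].
have cz : cos y <= cos z.
  by rewrite ltW// ltr_cos// in_itv /=; lra.
have cy : 0 <= cos y by apply: cos_ge0_pihalf; lra.
have c2 : 0 <= cos x by apply: cos_ge0_pihalf; lra.
have xE : x = y *+ 2 by rewrite -mulr_natr divfK.
rewrite [in leRHS]xE sin_mulr2n -/y.
have sy : y * cos y <= sin y.
  by rewrite sin0 !subr0 in E; rewrite E mulrC ler_wpM2r// ltW.
have h : 1 <= cos y ^+ 2 *+ 2 by rewrite xE cos_mulr2n subr_ge0 in c2.
have h1 : cos y * (y * cos y) <= cos y * sin y by rewrite ler_wpM2l.
have : y * 1 <= y * (cos y ^+ 2 *+ 2) by rewrite ler_wpM2l// ltW.
rewrite mulr1 => h2; apply: (le_trans h2).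
have -> : y * (cos y ^+ 2 *+ 2) = (cos y * (y * cos y)) *+ 2.
  by move: (cos y) => u; ring.
by rewrite lerMn2r.
Qed.

(** A lower bound for the multiplier of a forward difference of step [1 / n]. The condition
    [2 |m| < n] keeps [pi |m| / n] in the range of [sin_ge_half] and excludes aliasing. *)
Lemma normc_cexpB1_ge (m : int) (n : nat) : (2 * absz m < n)%N ->
  (absz m)%:R / n%:R <= normc (cexp (2 * pi * (m%:~R / n%:R)) - 1).
Proof.
move=> mn; rewrite normc_cexpB1.
have n0 : 0 < n%:R :> R by rewrite ltr0n (leq_ltn_trans _ mn).
pose a : R := (absz m)%:R / n%:R.
have a0 : 0 <= a by rewrite divr_ge0// ler0n.
have a1 : 2 * a <= 1.
  by rewrite mulrA ler_pdivrMr// mul1r -natrM ler_nat ltnW.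
have -> : `|sin (2 * pi * (m%:~R / n%:R) / 2)| = sin (pi * a).
  have -> : 2 * pi * (m%:~R / n%:R) / 2 = pi * (m%:~R / n%:R) :> R by field; rewrite gt_eqF.
  have s0 : 0 <= sin (pi * a).
    have := pi_gt0 R => pi0.
    apply: sin_ge0_pi; rewrite mulr_ge0 ?(ltW pi0)//= ler_piMr ?(ltW pi0)//; lra.
  rewrite -(ger0_norm s0) /a; case: m {mn a a0 a1 s0} => k //.
  rewrite NegzE rmorphN /= mulNr mulrN sinN normrN; congr `|sin (pi * (_ / _))|.
have pi0 := pi_gt0 R; have pi2 := pi_ge2 R.
have H : pi * a / 2 <= sin (pi * a).
  apply: sin_ge_half; rewrite mulr_ge0 ?(ltW pi0)//=.
  have : pi * (2 * a) <= pi * 1 by rewrite ler_pM2l.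
  lra.
rewrite -/a; have : 2 * a <= pi * a by rewrite ler_wpM2r.
lra.
Qed.

(** A geometric sum of ratio [z] with [z ^+ n = 1]; for [l != j] the ratio is not 1 because
    [0 < |l - j| < n]. The shift [M] only contributes a common factor. *)
Lemma dft_orthogonality (n M : nat) (l j : 'I_n) :
  \sum_(k < n) cexp (2 * pi * ((k%:R - M%:R) * ((l%:R - j%:R) / n%:R))) =
  if l == j then n%:R else 0.
Proof.
have n0 : (0 < n)%N by apply: leq_ltn_trans (ltn_ord l).
have nR : n%:R != 0 :> R by rewrite pnatr_eq0 -lt0n.
case: eqVneq => [->|lj].
  under eq_bigr do rewrite subrr mul0r !mulr0 cexp0.
  by rewrite sumr_const card_ord.
pose z := cexp (2 * pi * ((l%:R - j%:R) / n%:R)).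
have E (k : 'I_n) : cexp (2 * pi * ((k%:R - M%:R) * ((l%:R - j%:R) / n%:R))) =
    cexp (- (M%:R * (2 * pi * ((l%:R - j%:R) / n%:R)))) * z ^+ k.
  by rewrite -cexpMn -cexpD; congr cexp; ring.
under eq_bigr do rewrite E; rewrite -mulr_sumr.
have zn : z ^+ n = 1.
  rewrite -cexpMn (_ : _ * _ = 2 * pi * ((l%:Z - j%:Z)%:~R)) ?cexp_2pi_int//.
  by rewrite rmorphB /= -!pmulrn; field.
have z1 : z - 1 != 0.
  suff : 0 < normc (z - 1).
    by apply: contraTneq => ->; rewrite ComplexField.Normc.normc0 ltxx.
  rewrite normc_cexpB1 mulr_gt0// normr_gt0.
  have -> : 2 * pi * ((l%:R - j%:R) / n%:R) / 2 = pi * ((l%:R - j%:R) / n%:R) :> R by field.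
  have n0R : 0 < n%:R :> R by rewrite ltr0n.
  have pi0 := pi_gt0 R.
  have S (u v : 'I_n) : (v < u)%N -> 0 < sin (pi * ((u%:R - v%:R) / n%:R) : R).
    move=> vu; apply: sin_gt0_pi; rewrite mulr_gt0 ?divr_gt0 ?subr_gt0 ?ltr_nat//=.
    rewrite gtr_pMr// (ltr_pdivrMr _ _ n0R) mul1r.
    by rewrite (@le_lt_trans _ _ u%:R) ?ltr_nat// gerBl ler0n.
  move: lj; rewrite -val_eqE /= neq_ltn => /orP[h|h]; last by rewrite gt_eqF// S.
  by rewrite -opprB mulNr mulrN sinN oppr_eq0 gt_eqF// S.
have /eqP := subrX1 z n; rewrite zn subrr eq_sym mulf_eq0 (negbTE z1) /= => /eqP ->.
by rewrite mulr0.
Qed.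

End trigonometric.

(** * Finite differences and bounds for periodic functions *)

Section periodic.
Context (R : realType) (d : nat).
Local Notation V := 'rV[R]_d.
Local Notation e_ := (@basis_vec R d).
Implicit Types (f g : V -> R) (x y v : V).

Definition incr (h : R) i f x := f (x + h *: e_ i) - f x.

Lemma incr_derive f v (h : R) i r : (forall x, derivable f x v) ->
  (forall x, derivable (iter r (incr h i) f) x v) /\
  (forall x, 'D_v (iter r (incr h i) f) x = iter r (incr h i) (fun x => 'D_v f x) x).
Proof.
move=> df; elim: r => [//|r [IH1 IH2]] /=.
have D x : derivable (fun y => iter r (incr h i) f (y + h *: e_ i)) x v.
  exact: derivable_translate.
split=> x; first exact: derivableB.
by rewrite /incr (deriveB (D x) (IH1 x)) derive_translate !IH2.
Qed.

(** Differences commute with derivatives, so the mean value theorem trades each difference for a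
    derivative and a factor [h]. *)
Lemma iter_incr_bound i (h : R) r f (K : R) : 0 <= h ->
  (forall s, (s < r)%N -> forall x, derivable (iter s (fun u x => 'D_(e_ i) u x) f) x (e_ i)) ->
  (forall x, `|iter r (fun u x => 'D_(e_ i) u x) f x| <= K) ->
  forall x, `|iter r (incr h i) f x| <= K * h ^+ r.
Proof.
move=> h0; elim: r f => [|r IH] f df Kf x; first by rewrite /= expr0 mulr1 Kf.
have df0 y : derivable f y (e_ i) by exact: (df 0).
have [D1 D2] := incr_derive h i r df0.
have [t _ E] := @line_mvt R d (iter r (incr h i) f) x (e_ i) h (fun t _ => D1 _).
rewrite iterS {1}/incr E D2 normrM (ger0_norm h0) exprS mulrCA ler_wpM2l//.
apply: IH => [s sr y|y]; last by rewrite -iterSr.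
by rewrite -iterSr; exact: df.
Qed.

Lemma class_C_iter k f i s : (s <= k)%N -> class_C k setT f ->
  class_C (k - s) setT (iter s (fun u x => 'D_(e_ i) u x) f).
Proof.
elim: s k f => [|s IH] k f sk cf; first by rewrite subn0.
case: k sk cf => // k sk [_ /(_ i)[_ cf]].
by rewrite iterSr subSS; exact: IH.
Qed.

Lemma class_C_continuous k f : class_C k setT f -> forall x, {for x, continuous f}.
Proof. by case: k => [|k] /= => [H x|[H _] x]; exact: H. Qed.

Lemma class_C_derivable k f i : class_C k.+1 setT f -> forall x, derivable f x (e_ i).
Proof. by move=> [_ /(_ i)[H _]] x; exact: H. Qed.

Lemma class_C_le k l f : (l <= k)%N -> class_C k setT f -> class_C l setT f.
Proof.
elim: l k f => [|l IH] [|k] f //; first by move=> _ [].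
move=> lk [cf H]; split => // i; have [H1 H2] := H i; split => //.
exact: IH H2.
Qed.

Lemma periodic_derive f v : Zd_periodic f -> Zd_periodic (fun x => 'D_v f x).
Proof.
move=> pf x m; rewrite -derive_translate; congr (derive _ x v).
by apply/funext => y; exact: pf.
Qed.

Lemma periodic_iter f v r : Zd_periodic f ->
  Zd_periodic (iter r (fun u x => 'D_v u x) f).
Proof. by move=> pf; elim: r => //= r IH; exact: periodic_derive. Qed.

Definition floor_vec x : 'rV[int]_d := map_mx Num.floor x.

Lemma frac_itv x i : 0 <= (x - map_mx intr (floor_vec x)) 0 i < 1.
Proof.
rewrite !mxE subr_ge0 Num.Theory.floor_le_tmp /= ltrBlDl.
by rewrite -[1]/(1%:~R) -intrD Num.Theory.floorD1_gt.
Qed.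

Lemma periodic_frac (T : Type) (f : V -> T) x : Zd_periodic f ->
  f (x - map_mx intr (floor_vec x)) = f x.
Proof. by move=> pf; rewrite -[in RHS](subrK (map_mx intr (floor_vec x)) x) pf. Qed.

Lemma periodic_bounded f : Zd_periodic f -> continuous f ->
  exists2 K : R, 0 <= K & forall x, `|f x| <= K.
Proof.
move=> pf cf.
have cC : compact [set v : V | forall i, `[0, 1]%classic (v 0 i)].
  by apply: (@rV_compact R d (fun=> `[0, 1]%classic)) => i; exact: segment_compact.
have cN : continuous (fun x => `|f x|).
  by move=> x; apply: continuous_comp; [exact: cf|exact: norm_continuous].
have [|c _ Hc] := EVT_max_rV _ cC (continuous_subspaceT cN).
  by exists 0 => i /=; rewrite mxE in_itv /= lexx ler01.
exists `|f c| => // x; rewrite -(periodic_frac x pf); apply: Hc; rewrite inE => i /=.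
by rewrite in_itv /=; have /andP[-> /ltW ->] := frac_itv x i.
Qed.

Lemma periodic_iter_bounded r f i : class_C r setT f -> Zd_periodic f ->
  exists2 K : R, 0 <= K & forall x, `|iter r (fun u x => 'D_(e_ i) u x) f x| <= K.
Proof.
move=> cf pf; apply: periodic_bounded; first exact: periodic_iter.
move=> x; have := class_C_iter i (leqnn r) cf.
by move=> /class_C_continuous; exact.
Qed.

Lemma periodic_lipschitz f : class_C 1 setT f -> Zd_periodic f ->
  exists2 L : R, 0 <= L & forall x y, `|f x - f y| <= L * \sum_i `|(x - y) 0 i|.
Proof.
move=> cf pf.
have /choice[K HK] : forall i, exists K : R, 0 <= K /\ forall x, `|'D_(e_ i) f x| <= K.
  by move=> i; have [K K0 HK] := periodic_iter_bounded i cf pf; exists K.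
exists (\sum_i K i) => [|x y]; first by apply: sumr_ge0 => i _; have [] := HK i.
have df z : differentiable f z by exact: (class_C1_differentiable openT cf).
have [t _ E] := @line_mvt R d f y (x - y) 1 (fun t _ => diff_derivable (df _)).
have yx : y + 1 *: (x - y) = x by rewrite scale1r addrC subrK.
rewrite yx in E; rewrite E mul1r (derive_sum_partial _ (df _)).
rewrite (le_trans (ler_norm_sum _ _ _))// mulr_sumr ler_sum// => i _.
rewrite normrM mulrC ler_wpM2r// (le_trans ((HK i).2 _))//.
by rewrite (bigD1 i)//= lerDl sumr_ge0// => j _; have [] := HK j.
Qed.

End periodic.

(** * Discrete Fourier coefficients and their decay *)

Section discrete_fourier.
Context (R : realType) (d : nat) (M : nat).
Local Notation V := 'rV[R]_d.
Local Notation e_ := (@basis_vec R d).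
Local Notation n := (M.*2.+1).
Local Notation J := {ffun 'I_d -> 'I_n}.
Local Notation normc := ComplexField.Normc.normc.
Implicit Types (f g : V -> R) (x y v : V) (j k l : J).

Definition node j : V := \row_i ((j i)%:R / n%:R).
(** With the odd number [2 M + 1] of nodes per axis the coordinates of a frequency range over
    [-M, ..., M], so that twice their modulus stays below the number of nodes. *)
Definition freq k : 'rV[int]_d := \row_i ((k i)%:Z - M%:Z).
Definition character (m : 'rV[int]_d) x : R[i] := cexp (2 * pi * dot (map_mx intr m) x).

Lemma characterD m x y : character m (x + y) = character m x * character m y.
Proof. by rewrite /character dotDr mulrDr cexpD. Qed.

Lemma character_int m (z : 'rV[int]_d) : character m (map_mx intr z) = 1.
Proof.
rewrite /character (_ : dot _ _ = (\sum_i m 0 i * z 0 i)%:~R) ?cexp_2pi_int//.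
by rewrite /dot rmorph_sum; apply: eq_bigr => i _; rewrite !mxE rmorphM.
Qed.

Lemma characterNK m x : character m (- x) * character m x = 1.
Proof. by rewrite -characterD addNr /character dot0r mulr0 cexp0. Qed.

Lemma normc_character m x : normc (character m x) = 1.
Proof. exact: normc_cexp. Qed.

Lemma node_orthogonality l j :
  \sum_k character (freq k) (node l - node j) = if l == j then n%:R ^+ d else 0.
Proof.
have E k : character (freq k) (node l - node j) = \prod_i cexp (2 * pi *
    (((k i)%:R - M%:R) * (((l i)%:R - (j i)%:R) / n%:R))).
  rewrite /character /dot mulr_sumr cexp_sum; apply: eq_bigr => i _.
  congr (cexp (_ * _)); rewrite [map_mx _ _ _ _]mxE /freq /node !mxE.
  by congr (_ * _); [rewrite rmorphB /= -!pmulrn|rewrite mulrBl].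
under eq_bigr do rewrite E.
rewrite -(bigA_distr_bigA (fun i (k : 'I_n) => cexp (2 * pi *
    ((k%:R - M%:R) * (((l i)%:R - (j i)%:R) / n%:R))))) /=.
under eq_bigr do rewrite dft_orthogonality.
case: eqVneq => [->|lj].
  under eq_bigr do rewrite eqxx.
  by rewrite prodr_const card_ord.
have [i li] : exists i, l i != j i.
  apply/existsP; apply: contraNT lj; rewrite negb_exists => /forallP H.
  by apply/eqP/ffunP => i; apply/eqP; have := H i; rewrite negbK.
by rewrite (bigD1 i)//= (negbTE li) mul0r.
Qed.

(** Interpolating [g] at the nodes replaces Fourier integrals by finite sums;
    summation by parts then plays the role of integration by parts. *)
Definition dft g k : R[i] :=
  (n%:R ^- d) * \sum_j (g (node j))%:C%C * character (freq k) (- node j).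

Lemma dft_inversion g l : \sum_k dft g k * character (freq k) (node l) = (g (node l))%:C%C.
Proof.
have E k : dft g k * character (freq k) (node l) = n%:R ^- d *
   \sum_j (g (node j))%:C%C * character (freq k) (node l - node j).
  rewrite /dft -mulrA; congr (_ * _); rewrite mulr_suml; apply: eq_bigr => j _.
  by rewrite -mulrA -characterD addrC.
under eq_bigr do rewrite E.
rewrite -mulr_sumr exchange_big /=.
have E2 j : \sum_k (g (node j))%:C%C * character (freq k) (node l - node j) =
   if l == j then (g (node j))%:C%C * n%:R ^+ d else 0.
  by rewrite -mulr_sumr node_orthogonality; case: eqP => // _; rewrite mulr0.
under eq_bigr do rewrite E2.
have nn : (n%:R : R[i]) ^+ d != 0 by rewrite expf_neq0// pnatr_eq0.
have lE j : (l == j) = pred1 l j by rewrite /= eq_sym.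
rewrite -big_mkcond (big_pred1 l lE).
by rewrite mulrCA mulVf// mulr1.
Qed.

(** One step along an axis permutes the nodes modulo the integer lattice; [z] records the
    wrap-around. *)
Lemma sum_node_shift (G : V -> R[i]) (i : 'I_d) : Zd_periodic G ->
  \sum_j G (node j + n%:R^-1 *: e_ i) = \sum_j G (node j).
Proof.
move=> pG.
pose s j : J := [ffun a => if a == i then ordS (j a) else j a].
pose s' j : J := [ffun a => if a == i then ord_pred (j a) else j a].
have sK : cancel s s'.
  by move=> j; apply/ffunP => a; rewrite !ffunE; case: eqP => // _; rewrite ordSK.
have s'K : cancel s' s.
  by move=> j; apply/ffunP => a; rewrite !ffunE; case: eqP => // _; rewrite ord_predK.
rewrite [RHS](reindex s); last by exists s' => j _; [exact: sK|exact: s'K].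
apply: eq_bigr => j _.
pose z : 'rV[int]_d := \row_a (if (a == i) && ((j i).+1 == n)%N then 1 else 0).
rewrite -(pG (node (s j)) z); congr G; apply/rowP => a.
rewrite /z /node !mxE /s ffunE; have [->|ai] := eqVneq a i; last by rewrite /= mulr0 !addr0.
rewrite /=.
have [jn|jn] := eqVneq (j i).+1 n.
  rewrite jn modnn mul0r add0r mulr1 -[X in _ + X]mul1r -mulrDl.
  by rewrite natr1 jn divff.
rewrite modn_small ?addr0; last by rewrite ltn_neqAle jn ltn_ord.
by rewrite mulr1 -[(j i).+1]addn1 natrD mulrDl mul1r.
Qed.

Let S g k := \sum_j (g (node j))%:C%C * character (freq k) (- node j).

Let S_incr g k i : Zd_periodic g ->
  S (incr n%:R^-1 i g) k = (cexp (2 * pi * ((freq k 0 i)%:~R / n%:R)) - 1) * S g k.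
Proof.
move=> pg.
have -> : S (incr n%:R^-1 i g) k = \sum_j (g (node j + n%:R^-1 *: e_ i))%:C%C *
     character (freq k) (- node j) - S g k.
  rewrite /S -sumrB; apply: eq_bigr => j _.
  by rewrite /incr rmorphB /= mulrBl.
rewrite mulrBl mul1r; congr (_ - _).
pose G x := (g x)%:C%C * character (freq k) (- x).
have pG : Zd_periodic G.
  move=> x m; rewrite /G pg opprD characterD; congr (_ * _).
  have := characterNK (freq k) (map_mx intr m); rewrite character_int mulr1 => ->.
  by rewrite mulr1.
rewrite /S -(sum_node_shift i pG) mulr_sumr; apply: eq_bigr => j _.
rewrite /G opprD characterD mulrCA; congr (_ * _).
rewrite [RHS]mulrCA -[LHS]mulr1; congr (_ * _).
have -> : cexp (2 * pi * ((freq k 0 i)%:~R / n%:R)) =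
    character (freq k) (n%:R^-1 *: e_ i).
  rewrite /character dotZr; congr (cexp (_ * _)).
  rewrite /dot (bigD1 i)//= !mxE !eqxx mulr1 big1 ?addr0; last first.
    by move=> a ai; rewrite !mxE (negbTE ai) mulr0.
  by rewrite mulrC.
by rewrite [RHS]mulrC characterNK.
Qed.

Lemma incr_periodic (h : R) i g : Zd_periodic g -> Zd_periodic (incr h i g).
Proof. by move=> pg x m; rewrite /incr addrAC !pg. Qed.

Let S_iter g k i r : Zd_periodic g ->
  S (iter r (incr n%:R^-1 i) g) k =
  (cexp (2 * pi * ((freq k 0 i)%:~R / n%:R)) - 1) ^+ r * S g k.
Proof.
elim: r g => [|r IH] g pg; first by rewrite mul1r.
by rewrite iterSr IH ?S_incr ?exprSr ?mulrA//; exact: incr_periodic.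
Qed.

Lemma normc_sum (I : finType) (F : I -> R[i]) : normc (\sum_i F i) <= \sum_i normc (F i).
Proof.
elim/big_ind2: _ => [|x1 x2 y1 y2 h1 h2|//].
  by rewrite ComplexField.Normc.normc0.
by rewrite (le_trans (le_normcD _ _))// lerD.
Qed.

Let normcX (z : R[i]) r : normc (z ^+ r) = normc z ^+ r.
Proof.
elim: r => [|r IH]; first by rewrite !expr0 ComplexField.Normc.normc1.
by rewrite !exprS ComplexField.Normc.normcM IH.
Qed.

Let normc_real (a : R) : normc (a%:C)%C = `|a|.
Proof. by rewrite /= expr0n /= addr0 sqrtr_sqr. Qed.

(** [r] differences multiply the coefficient by the power [r] of a multiplier of modulus at least
    [|k_i| / n], whereas the differences of [g] are at most [K / n^r]. The powers of [n] cancel, so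
    the bound does not depend on [M]. *)
Lemma dft_decay g k i r (K : R) : class_C r setT g -> Zd_periodic g ->
  (forall x, `|iter r (fun u x => 'D_(e_ i) u x) g x| <= K) ->
  (absz (freq k 0 i))%:R ^+ r * normc (dft g k) <= K.
Proof.
move=> cg pg HK.
have K0 : 0 <= K by apply: le_trans (HK 0).
have n0 : 0 < n%:R^-1 :> R by rewrite invr_gt0.
have B x : `|iter r (incr n%:R^-1 i) g x| <= K * n%:R^-1 ^+ r.
  apply: iter_incr_bound  => //.
  move=> s sr y; apply: (@class_C_derivable _ _ (r - s).-1).
  by rewrite prednK ?subn_gt0//; apply: class_C_iter => //; exact: ltnW.
set a : R := (absz (freq k 0 i))%:R.
have am : a / n%:R <= normc (cexp (2 * pi * ((freq k 0 i)%:~R / n%:R)) - 1).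
  apply: normc_cexpB1_ge; rewrite mxE.
  have := ltn_ord (k i); move: (nat_of_ord (k i)) => b; lia.
have SB : normc (S (iter r (incr n%:R^-1 i) g) k) <= n%:R ^+ d * (K * n%:R^-1 ^+ r).
  rewrite (le_trans (normc_sum _))//.
  apply: (@le_trans _ _ (\sum_(j : J) K * n%:R^-1 ^+ r)).
    apply: ler_sum => j _.
    by rewrite ComplexField.Normc.normcM normc_character mulr1 normc_real.
  by rewrite sumr_const card_ffun !card_ord -[leLHS]mulr_natl natrX.
rewrite (S_iter _ _ _ pg) ComplexField.Normc.normcM normcX in SB.
have nd : normc (dft g k) = (n%:R ^+ d)^-1 * normc (S g k).
  rewrite /dft ComplexField.Normc.normcM; congr (_ * _).
  rewrite ComplexField.Normc.normcV normcX; congr (_ ^+ _)^-1.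
  by rewrite -[n%:R](rmorph_nat (real_complex R)) normc_real ger0_norm.
have nd0 : 0 < n%:R ^+ d :> R by rewrite exprn_gt0.
have nr0 : 0 < n%:R ^+ r :> R by rewrite exprn_gt0.
rewrite nd mulrCA ler_pdivrMl//.
have S0 : 0 <= normc (S g k) by case: (S g k) => u v /=; exact: sqrtr_ge0.
have an : 0 <= a / n%:R by rewrite divr_ge0 ?ler0n.
have aX : (a / n%:R) ^+ r <= normc (cexp (2 * pi * ((freq k 0 i)%:~R / n%:R)) - 1) ^+ r.
  by apply: lerXn2r => //; rewrite nnegrE// (le_trans an).
have := le_trans (ler_wpM2r S0 aX) SB.
rewrite exprVn expr_div_n mulrA mulrAC ler_pdivrMr// divfK// gt_eqF//.
Qed.

End discrete_fourier.

(** * Approximation with weighted control of the coefficients *)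

Section trigonometric_approximation.
Context (R : realType) (d : nat).
Local Notation V := 'rV[R]_d.
Local Notation e_ := (@basis_vec R d).
Local Notation normc := ComplexField.Normc.normc.
Implicit Types (f g : V -> R) (x y v : V) (m : 'rV[int]_d).

(** Each term is at most an increment of [Phi], whose values lie in [[-2, 2]]; the sum telescopes to
    at most 4. *)
Lemma sum_inverse_squares (M : nat) :
  \sum_(k < M.*2.+1) (1 + `|k%:R - M%:R|) ^- 2 <= 4 :> R.
Proof.
pose Phi (t : R) := 2 * (t / (1 + `|t|)).
have Phi1 t : `|Phi t| <= 2.
  have h : 0 < 1 + `|t| by rewrite ltr_pwDl.
  rewrite /Phi 2!normrM normfV (gtr0_norm h) ger0_norm// ler_piMr//.
  by rewrite ler_pdivrMr// mul1r lerDr.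
have step (k : nat) : (1 + `|k%:R - M%:R|) ^- 2 <=
    Phi (k.+1%:R - M%:R) - Phi (k%:R - M%:R).
  have -> : k.+1%:R - M%:R = k%:R - M%:R + 1 :> R by rewrite -addn1 natrD addrAC.
  have [Mk|kM] := leqP M k.
    have : 0 <= k%:R - M%:R :> R by rewrite subr_ge0 ler_nat.
    move: (k%:R - M%:R) => t t0.
    have t1 : 0 < 1 + t by rewrite ltr_pwDl.
    have t2 : 0 < 2 + t by rewrite ltr_pwDl.
    rewrite /Phi !ger0_norm ?addr_ge0//.
    have -> : 2 * ((t + 1) / (1 + (t + 1))) - 2 * (t / (1 + t)) = 2 / ((1 + t) * (2 + t)).
      by field; apply/andP; split; lra.
    rewrite ler_pdivlMr ?mulr_gt0// mulrC ler_pdivrMr ?exprn_gt0//.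
    by nra.
  have [s [s0 ->]] : exists s : R, 0 <= s /\ k%:R - M%:R = - (1 + s).
    exists ((M - k.+1)%:R); split => //.
    by rewrite natrB// -addn1 natrD; ring.
  have -> : - (1 + s) + 1 = - s by rewrite opprD addrAC addNr add0r.
  rewrite /Phi !normrN !ger0_norm ?addr_ge0//.
  have s1 : 0 < 1 + s by rewrite ltr_pwDl.
  have s2 : 0 < 2 + s by rewrite ltr_pwDl.
  have -> : 2 * (- s / (1 + s)) - 2 * (- (1 + s) / (1 + (1 + s))) = 2 / ((1 + s) * (2 + s)).
    by field; apply/andP; split; lra.
  have -> : 1 + (1 + s) = 2 + s by ring.
  rewrite ler_pdivlMr ?mulr_gt0// mulrC ler_pdivrMr ?exprn_gt0//.
  by nra.
apply: le_trans (ler_sum _ (fun (k : 'I_(M.*2.+1)) _ => step k)) _.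
rewrite -(big_mkord xpredT (fun k => Phi (k.+1%:R - M%:R) - Phi (k%:R - M%:R))).
rewrite telescope_sumr// -[4]/((2 + 2)%:R) natrD lerD//.
  by rewrite (le_trans (ler_norm _))// Phi1.
by rewrite (le_trans (ler_norm _))// normrN Phi1.
Qed.

Lemma norm_sin_le (t : R) : `|sin t| <= `|t|.
Proof.
wlog t0 : t / 0 < t => [H|].
  have [t0|t0|->] := ltgtP t 0; last by rewrite sin0 normr0.
    by rewrite -(normrN t) -(normrN (sin t)) -sinN H// oppr_gt0.
  exact: H.
have [z _ E] := @MVT R sin cos 0 t t0 (fun (u : R) _ => is_derive_sin u)
   (continuous_subspaceT (@continuous_sin R)).
rewrite sin0 !subr0 in E; rewrite E normrM ler_piMl// ler_norml cos_geN1 cos_le1//.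
Qed.

Lemma normc_cexpB (s t : R) : normc (cexp s - cexp t) <= `|s - t|.
Proof.
have -> : cexp s - cexp t = cexp t * (cexp (s - t) - 1).
  by rewrite mulrBr mulr1 -cexpD [t + _]addrC subrK.
rewrite ComplexField.Normc.normcM normc_cexp mul1r normc_cexpB1.
have := norm_sin_le ((s - t) / 2); rewrite normrM [`|2^-1|]ger0_norm ?invr_ge0//.
by move: `|sin _| `|s - t| => a b; lra.
Qed.

Lemma dot_int_norm1 m y (h : R) : (forall i, `|y 0 i| <= h) ->
  `|dot (map_mx intr m) y| <= int_norm1 R m * h.
Proof.
move=> yh; rewrite (le_trans (ler_norm_sum _ _ _))// /int_norm1 mulr_suml ler_sum// => i _.
by rewrite normrM mxE ler_wpM2l.
Qed.

Lemma int_norm1_le m (a : nat) : (forall i, (absz (m 0%R i) <= a)%N) ->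
  int_norm1 R m <= d%:R * a%:R.
Proof.
move=> ma; rewrite (@le_trans _ _ (\sum_(i < d) a%:R))//.
  by apply: ler_sum => i _; rewrite -intr_norm -natr_absz ler_nat.
by rewrite sumr_const card_ord -[leLHS]mulr_natl.
Qed.

Lemma int_norm1_ge0 m : 0 <= int_norm1 R m.
Proof. by apply: sumr_ge0. Qed.

Lemma int_norm1_ge1 m : m != 0 -> 1 <= int_norm1 R m.
Proof.
move=> m0; have [i mi] : exists i, m 0 i != 0.
  apply/existsP; apply: contraNT m0; rewrite negb_exists => /forallP H.
  by apply/eqP/rowP => i; apply/eqP; have := H i; rewrite negbK mxE.
rewrite /int_norm1 (bigD1 i)//= ler_wpDr ?sumr_ge0//.
by rewrite -intr_norm -natr_absz ler1n absz_gt0.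
Qed.

(** Decay is used along the axis [i] where [|k_i|] is largest: [q] derivatives pay for the weight
    [|k|^q], and [2 d] more for the product, each factor of which is at most [(2 |k_i|)^2]. At
    [k = 0] the weight vanishes since [q > 0]. *)
Lemma dft_weighted_decay (M q : nat) g (K : R) (k : {ffun 'I_d -> 'I_(M.*2.+1)}) :
  (0 < d)%N -> (0 < q)%N -> class_C (q + 2 * d) setT g -> Zd_periodic g ->
  (forall i x, `|iter (q + 2 * d) (fun u x => 'D_(e_ i) u x) g x| <= K) ->
  normc (dft g k) * int_norm1 R (freq k) ^+ q <=
    (d%:R ^+ q * 4 ^+ d * K) * \prod_l (1 + `|(k l)%:R - M%:R|) ^- 2.
Proof.
move=> d0 q0 cg pg HK.
pose c : R := normc (dft g k).
have N0 : 0 <= c by rewrite /c; case: (dft g k) => u v /=; exact: sqrtr_ge0.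
rewrite -[normc _]/c.
have K0 : 0 <= K by apply: le_trans (HK (Ordinal d0) 0).
have kE l : (k l)%:R - M%:R = (freq k 0 l)%:~R :> R by rewrite mxE rmorphB /= -!pmulrn.
have P0 l : 0 < 1 + `|(k l)%:R - M%:R| :> R by rewrite ltr_pwDl.
rewrite prodfV ler_pdivlMr; last by apply: prodr_gt0 => l _; rewrite exprn_gt0.
have [k0|k0] := eqVneq (freq k) 0.
  rewrite k0 (_ : int_norm1 R 0 = 0) ?expr0n ?gtn_eqF//; last first.
    by rewrite /int_norm1 big1// => i _; rewrite mxE normr0.
  by rewrite mulr0 mul0r !mulr_ge0 ?exprn_ge0.
set X := \prod_l _.
pose i := [arg max_(i > Ordinal d0) absz (freq k 0 i)].
have ia l : (absz (freq k 0%R l) <= absz (freq k 0%R i))%N.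
  by rewrite /i; case: arg_maxnP => // j _; exact.
have : _ * c <= _ := dft_decay k cg pg (HK i).
set a := absz _ in ia *; move=> aK.
have a1 : 1 <= a%:R :> R.
  rewrite ler1n lt0n; apply: contraNneq k0 => a0.
  apply/eqP/rowP => l; apply/eqP; rewrite [X in _ == X]mxE -absz_eq0.
  by have := ia l; rewrite a0 leqn0.
have a0 : 0 <= a%:R :> R by [].
have H1 : int_norm1 R (freq k) ^+ q <= d%:R ^+ q * a%:R ^+ q.
  by rewrite -exprMn lerXn2r ?nnegrE ?int_norm1_ge0 ?mulr_ge0//; exact: int_norm1_le.
have H2 : X <= 4 ^+ d * a%:R ^+ (2 * d) :> R.
  rewrite (exprM _ 2 d) -exprMn -[in leRHS](card_ord d) -prodr_const ler_prod// => l _.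
  rewrite exprn_ge0 ?(ltW (P0 l))//= (_ : 4 = 2 ^+ 2) -?exprMn; last by rewrite -natrX.
  rewrite lerXn2r ?nnegrE ?mulr_ge0 ?(ltW (P0 l))//.
  rewrite kE -intr_norm -natr_absz mulr2n mulrDl mul1r lerD// ler_nat.
  exact: ia.
have X0 : 0 <= X.
  by apply: prodr_ge0 => l _; rewrite exprn_ge0// ltW.
have H3 : int_norm1 R (freq k) ^+ q * X <=
    (d%:R ^+ q * a%:R ^+ q) * (4 ^+ d * a%:R ^+ (2 * d)).
  by apply: ler_pM => //; rewrite exprn_ge0// int_norm1_ge0.
move: c (int_norm1 R (freq k) ^+ q) X N0 aK H3 {H1 H2 X0} => c u X N0 aK H3.
rewrite -[leLHS]mulrA; apply: (le_trans (ler_wpM2l N0 H3)).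
have -> : c * (d%:R ^+ q * a%:R ^+ q * (4 ^+ d * a%:R ^+ (2 * d))) =
    d%:R ^+ q * 4 ^+ d * (a%:R ^+ (q + 2 * d) * c).
  by rewrite exprD; ring.
by rewrite ler_wpM2l// mulr_ge0 ?exprn_ge0.
Qed.

(** The interpolant on a fine grid. The essential point is the order of the quantifiers: [K] is
    fixed before the accuracy [eta]. *)
Lemma trig_approximation (q : nat) g :
  (0 < d)%N -> (0 < q)%N -> class_C (q + 2 * d) setT g -> Zd_periodic g ->
  exists2 K : R, 0 <= K & forall eta : R, 0 < eta ->
  exists (I : finType) (a0 : R) (a th : I -> R) (m : I -> 'rV[int]_d),
  [/\ forall i, m i != 0, \sum_i `|a i| * int_norm1 R (m i) ^+ q <= K &
   forall x, `|g x - a0 - \sum_i a i * cos (2 * pi * dot (map_mx intr (m i)) x + th i)| <= eta].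
Proof.
move=> d0 q0 cg pg.
have /choice[K' HK'] : forall i, exists K : R, 0 <= K /\
    forall x, `|iter (q + 2 * d) (fun u x => 'D_(e_ i) u x) g x| <= K.
  by move=> i; have [K K0 HK] := periodic_iter_bounded i cg pg; exists K.
pose K := \sum_i K' i.
have HK i x : `|iter (q + 2 * d) (fun u x => 'D_(e_ i) u x) g x| <= K.
  rewrite (le_trans ((HK' i).2 _))// /K (bigD1 i)//= lerDl sumr_ge0// => j _.
  by have [] := HK' j.
(* The last factor is [sum_inverse_squares], once per coordinate. *)
pose K2 := d%:R ^+ q * 4 ^+ d * K * 4 ^+ d.
have K0 : 0 <= K by apply: sumr_ge0 => i _; have [] := HK' i.
have K20 : 0 <= K2 by rewrite !mulr_ge0 ?exprn_ge0.
have SK (M : nat) : \sum_(k : {ffun 'I_d -> 'I_(M.*2.+1)})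
    normc (dft g k) * int_norm1 R (freq k) ^+ q <= K2.
  apply: le_trans (ler_sum _ (fun k _ => dft_weighted_decay k d0 q0 cg pg HK)) _.
  rewrite -mulr_sumr ler_wpM2l ?mulr_ge0 ?exprn_ge0//.
  rewrite -(bigA_distr_bigA (fun (i : 'I_d) (l : 'I_(M.*2.+1)) =>
    (1 + `|l%:R - M%:R|) ^- 2 : R)).
  rewrite prodr_const card_ord lerXn2r ?nnegrE ?sum_inverse_squares//.
  by apply: sumr_ge0 => l _; rewrite invr_ge0 exprn_ge0// addr_ge0.
have [L L0 HL] := periodic_lipschitz (class_C_le (leq_trans q0 (leq_addr _ _)) cg) pg.
exists (2 * K2) => [|eta eta0]; first by rewrite mulr_ge0.
(* Moving to a nearby node costs [L * d / n] for [g] and [2 * pi * K2 / n] for the interpolant; [M]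
   is chosen so that the sum is at most [eta]. *)
pose B := (L * d%:R + 2 * pi * K2) / eta.
pose M := (Num.truncn B).+1; pose n := M.*2.+1.
have nB : (L * d%:R + 2 * pi * K2) / n%:R <= eta.
  rewrite ler_pdivrMr ?ltr0n// [leRHS]mulrC -ler_pdivrMr// -/B.
  have B0 : 0 <= B by rewrite divr_ge0 ?(ltW eta0)// addr_ge0 ?mulr_ge0// pi_ge0.
  rewrite (le_trans (ltW (truncnS_gt B)))// ler_nat /n -/M.
  by rewrite -addnn -addnS leq_addr.
pose J : finType := {ffun 'I_d -> 'I_n}.
(* A nonzero placeholder for the zero mode, which gets coefficient 0 in [a] and is collected in
   [a0]. *)
pose m1 : 'rV[int]_d := const_mx 1.
pose m (i : J * bool) := if freq i.1 == 0 then m1 else freq i.1.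
pose a (i : J * bool) : R := if freq i.1 == 0 then 0 else
  if i.2 then complex.Re (dft g i.1) else complex.Im (dft g i.1).
(* As [cos (y + pi / 2) = - sin y], the real part of one complex mode is a sum of two cosines,
   whence the index [J * bool] and the factor 2 in the bound. *)
pose th (i : J * bool) : R := if i.2 then 0 else pi / 2.
pose a0 : R := \sum_(k : J | freq k == 0) complex.Re (dft g k).
pose p x : R[i] := \sum_(k : J) dft g k * character (freq k) x.
have pE x : complex.Re (p x) =
   a0 + \sum_i a i * cos (2 * pi * dot (map_mx intr (m i)) x + th i).
  have -> : complex.Re (p x) = \sum_(k : J) complex.Re (dft g k * character (freq k) x).
    exact: (@raddf_sum _ _ (@complex.Re R)).
  rewrite -(pair_bigA _ (fun k b => a (k, b) * cos (2 * pi * dot (map_mx intr (m (k, b))) x + th (k, b)))) /=.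
  rewrite /a0 [in RHS]big_mkcond -big_split; apply: eq_bigr => k _ /=.
  rewrite big_bool /a /m /th /=; case: eqP => [k0|k0].
    rewrite !mul0r !addr0 k0 /character.
    rewrite (_ : dot _ _ = 0) ?mulr0 ?cexp0 ?mulr1//.
    by rewrite /dot big1// => l _; rewrite !mxE mul0r.
  rewrite add0r addr0 /character cosDpihalf; case: (dft g k) => u v /=.
  by rewrite mulrN.
exists (J * bool)%type, a0, a, th, m; split.
- move=> i; rewrite /m; case: (eqVneq (freq i.1) 0) => // _.
  by apply/eqP => /matrixP/(_ 0 (Ordinal d0)); rewrite !mxE.
- rewrite -(pair_bigA _ (fun k b => `|a (k, b)| * int_norm1 R (m (k, b)) ^+ q)) /=.
  rewrite (le_trans _ (ler_wpM2l _ (SK M)))// mulr_sumr ler_sum// => k _.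
  rewrite big_bool /a /m /=; have ik := exprn_ge0 q (int_norm1_ge0 (freq k)).
  have N0 : 0 <= normc (dft g k) by case: (dft g k) => u v /=; exact: sqrtr_ge0.
  case: eqP => _; first by rewrite normr0 !mul0r addr0 !mulr_ge0.
  rewrite -mulrDl mulrA ler_wpM2r// mulrDl mul1r lerD//.
    by case: (dft g k) => u v /=; rewrite -sqrtr_sqr ler_wsqrtr// lerDl sqr_ge0.
  by case: (dft g k) => u v /=; rewrite -sqrtr_sqr ler_wsqrtr// lerDr sqr_ge0.
- move=> x; rewrite -addrA -opprD -pE.
  pose z := x - map_mx intr (floor_vec x).
  have pp : p z = p x.
    apply: periodic_frac => y m'.
    by apply: eq_bigr => k _; rewrite characterD character_int mulr1.
  rewrite -(periodic_frac x pg) -pp -/z.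
  have zi i : 0 <= z 0 i < 1 := frac_itv x i.
  (* The node just below [z], where the interpolant equals [g]. *)
  pose l : J := [ffun i => inord (Num.truncn (n%:R * z 0 i))].
  have lz i : `|(z - node R l) 0 i| <= n%:R^-1.
    have /andP[z0 z1] := zi i.
    have nz : 0 <= n%:R * z 0 i by rewrite mulr_ge0.
    have ln : (Num.truncn (n%:R * z 0%R i) < n)%N.
      rewrite -(ltr_nat R) (@le_lt_trans _ _ (n%:R * z 0 i)) ?truncn_le//.
      by rewrite gtr_pMr.
    have /andP[t0 t1] := truncn_itv nz.
    have -> : (z - node R l) 0 i = (n%:R * z 0 i - (Num.truncn (n%:R * z 0 i))%:R) / n%:R.
      rewrite mxE [X in _ + X]mxE [X in _ - X]mxE ffunE inordK// mulrBl mulrAC divff ?mul1r// pnatr_eq0//.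
    rewrite normrM ger0_norm ?subr_ge0// ger0_norm ?invr_ge0// ler_piMl ?invr_ge0//.
    by rewrite lerBlDl natr1 ltW.
  have D1 : `|g z - g (node R l)| <= L * d%:R / n%:R.
    rewrite (le_trans (HL _ _))// -mulrA ler_wpM2l//.
    rewrite (le_trans (ler_sum _ (fun i _ => lz i)))//.
    by rewrite sumr_const card_ord -[leLHS]mulr_natl.
  have D2 : `|complex.Re (p (node R l)) - complex.Re (p z)| <= 2 * pi * K2 / n%:R.
    have -> : complex.Re (p (node R l)) - complex.Re (p z) = complex.Re (p (node R l) - p z).
      by case: (p (node R l)) => u v; case: (p z).
    have Nr (w : R[i]) : `|complex.Re w| <= normc w.
      by case: w => u v /=; rewrite -sqrtr_sqr ler_wsqrtr// lerDl sqr_ge0.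
    rewrite (le_trans (Nr _))// /p -sumrB (le_trans (normc_sum _))//.
    rewrite mulrAC (le_trans _ (ler_wpM2l _ (SK M)))//; last first.
      by rewrite divr_ge0// mulr_ge0// pi_ge0.
    rewrite mulr_sumr ler_sum// => k _.
    rewrite -mulrBr ComplexField.Normc.normcM mulrCA ler_wpM2l//.
      by case: (dft g k) => u v /=; exact: sqrtr_ge0.
    rewrite (le_trans (normc_cexpB _ _))// -mulrBr normrM ger0_norm ?mulr_ge0 ?pi_ge0//.
    rewrite -[leRHS]mulrA ler_wpM2l ?mulr_ge0 ?pi_ge0// distrC.
    rewrite -[- dot _ _]mulN1r -dotZr scaleN1r -dotDr [leRHS]mulrC.
    rewrite (le_trans (dot_int_norm1 _ lz))// ler_wpM2r ?invr_ge0//.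
    have [k0|k0] := eqVneq (freq k) 0; last by rewrite ler_eXnr// int_norm1_ge1.
    by rewrite [leLHS](_ : _ = 0) ?exprn_ge0 ?int_norm1_ge0// k0 /int_norm1 big1// => l' _;
      rewrite mxE normr0.
  have -> : g z - complex.Re (p z) = (g z - g (node R l)) + (complex.Re (p (node R l)) - complex.Re (p z)).
    by rewrite /p dft_inversion /= addrA subrK.
  rewrite (le_trans (ler_normD _ _))// (le_trans (lerD D1 D2))//.
  by rewrite -mulrDl.
Qed.

End trigonometric_approximation.

(** * Means over the torus *)

Section torus.
Context (R : realType).
Local Notation mu := (@lebesgue_measure R).
Local Notation cube n := (@unit_cube R n).

Lemma unit_cubeS n : @tuple_cons R n @^-1` cube n.+1 = `[0%R, 1%R]%classic `*` cube n.
Proof.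
apply/seteqP; split=> [[x t] H /=|[x t] [/= x01 H] i].
  split; first by have := H ord0; rewrite /= in_itv /= (tnth_nth 0).
  by move=> i; have := H (lift ord0 i); rewrite !(tnth_nth 0).
case: (unliftP ord0 i) => [j ->|->].
  by have := H j; rewrite !(tnth_nth 0).
by rewrite (tnth_nth 0) /=; rewrite /= in_itv /= in x01.
Qed.

Lemma measurable_unit_cube n : measurable (cube n).
Proof.
have -> : cube n = \big[setI/setT]_(i < n) ((fun t : n.-tuple R => tnth t i) @^-1` `[0%R, 1%R]%classic).
  apply/seteqP; split=> t.
    by move=> H; rewrite -bigcap_seq => i _ /=; rewrite in_itv /=; exact: H.
  by rewrite -bigcap_seq => H i; have := H i; rewrite /= in_itv /=; apply; rewrite mem_index_enum.
apply: bigsetI_measurable => i _; rewrite -[X in measurable X]setTI.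
by apply: (measurable_tnth i) => //; exact: measurable_itv.
Qed.

Lemma lebesgue_unit_cube n : lebesgue_tuple R n (cube n) = 1%E.
Proof.
elim: n => [|n IH].
  by rewrite /= diracE mem_set// => -[].
rewrite /= /cons_measure /pushforward unit_cubeS.
rewrite product_measure1E//; last exact: measurable_unit_cube.
have mu1 : mu `[0%R, 1%R]%classic = 1%E.
  by have := @lebesgue_measure_itv R `[0%R, 1%R]; rewrite /= lte_fin ltr01 oppr0 adde0.
by rewrite -[RHS]mule1; congr (_ * _)%E; [exact: mu1|exact: IH].
Qed.

Lemma integral_cos_period (m : int) (th : R) : m != 0 ->
  (\int[mu]_(x in `[0%R, 1%R]) (cos (2 * pi * (m%:~R * x) + th))%:E = 0)%E.
Proof.
move=> m0.
pose a : R := 2 * pi * m%:~R.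
have a0 : a != 0 by rewrite !mulf_neq0 ?intr_eq0// gt_eqF// pi_gt0.
pose F (x : R) := sin (a * x + th) / a.
have dF (x : R) : is_derive x (1 : R) F (cos (a * x + th)).
  have dg : is_derive x (1 : R) (fun y : R => a * y + th) a.
    by apply: is_derive_eq; rewrite addr0 -[RHS]mulr1.
  have dh := @is_derive1_comp R sin (fun y : R => a * y + th) x _ _ (is_derive_sin _) dg.
  have -> : F = a^-1 \*: (sin \o (fun y : R => a * y + th)).
    by apply/funext => y; rewrite /F /= mulrC.
  by apply: is_derive_eq; rewrite /GRing.scale /= mulrCA mulVf// mulr1.
have cF (x : R) : {for x, continuous F}.
  by apply: differentiable_continuous; apply/derivable1_diffP; have [] := dF x.
have fE x : cos (2 * pi * (m%:~R * x) + th) = cos (a * x + th) by rewrite /a mulrA.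
rewrite (@continuous_FTC2 R _ F) ?ltr01//.
- rewrite -EFinB /F mulr0 add0r mulr1 (_ : sin (a + th) = sin th) ?subrr//.
  have := cexpD a th; rewrite cexp_2pi_int mul1r => /(congr1 (@complex.Im R)).
  exact.
- apply: continuous_subspaceT => x; rewrite (funext fE).
  apply: continuous_comp; last exact: continuous_cos.
  by apply: cvgD; [apply: cvgM; [exact: cvg_cst|exact: cvg_id]|exact: cvg_cst].
- split; first by move=> x _; have [] := dF x.
  + by apply: cvg_at_right_filter; exact: cF.
  + by apply: cvg_at_left_filter; exact: cF.
- by move=> x _; rewrite fE derive1E; have [_ ->] := dF x.
Qed.

Definition phase n (m : 'I_n -> int) (th : R) (t : n.-tuple R) : R :=
  2 * pi * (\sum_i (m i)%:~R * tnth t i) + th.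

Lemma measurable_phase n (m : 'I_n -> int) th : measurable_fun setT (phase m th).
Proof.
apply: measurable_funD => //; apply: measurable_funM => //.
apply: measurable_sum => i; apply: measurable_funM => //; exact: measurable_tnth.
Qed.

Lemma measurable_cos_phase n (m : 'I_n -> int) th :
  measurable_fun setT (fun t => cos (phase m th t)).
Proof.
apply: measurableT_comp; last exact: measurable_phase.
by apply: continuous_measurable_fun; exact: continuous_cos.
Qed.

Lemma phase_cons n (m : 'I_n.+1 -> int) th x (t : n.-tuple R) :
  phase m th (tuple_cons (x, t)) =
  phase (fun i => m (lift ord0 i)) (2 * pi * ((m ord0)%:~R * x) + th) t.
Proof.
rewrite /phase big_ord_recl (tnth_nth 0) /= mulrDr -!addrA [RHS]addrCA.
congr (_ + (_ * _ + _)); apply: eq_bigr => i _; by rewrite !(tnth_nth 0).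
Qed.

Lemma integrable_cube n (f : n.-tuple R -> R) (K : R) : measurable_fun setT f ->
  (forall t, `|f t| <= K) -> (lebesgue_tuple R n).-integrable (cube n) (EFin \o f).
Proof.
move=> mf fK; have mc := @measurable_unit_cube n.
apply: measurable_bounded_integrable => //.
- by rewrite [ltLHS](lebesgue_unit_cube n) ltry.
- exact: measurable_funTS.
- exists K; split => [|M KM]; first exact: num_real.
  by move=> t _ /=; rewrite (le_trans (fK t))// ltW.
Qed.

(** Induction by Fubini. If a later frequency is nonzero, the later variables are integrated first,
    the contribution of the first variable being absorbed in [th]; otherwise the first frequency is
    nonzero and its variable goes first. *)
Lemma integral_cos_torus n (m : 'I_n -> int) th i : m i != 0 ->
  (\int[lebesgue_tuple R n]_(t in cube n) (cos (phase m th t))%:E = 0)%E.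
Proof.
elim: n m th i => [m th []//|n IH] m th i mi.
have mc := @measurable_unit_cube n.
pose f t := cos (phase m th t).
have f1 t : `|f t| <= 1 by rewrite ler_norml cos_geN1 cos_le1.
have mf : measurable_fun setT f := measurable_cos_phase m th.
pose fc := f \o @tuple_cons R n.
have mfc : measurable_fun setT fc.
  by apply: measurableT_comp => //; exact: measurable_tuple_cons.
pose D : set (measurableTypeR R * n.-tuple R) := `[0%R, 1%R]%classic `*` cube n.
have mD : measurable D by apply: measurableX => //; exact: measurable_itv.
have muD : ((mu \x lebesgue_tuple R n) D < +oo)%E.
  rewrite /D -(@unit_cubeS n); have := lebesgue_unit_cube n.+1.
  by rewrite /= /cons_measure /pushforward => ->; rewrite ltry.
have intfc : (mu \x lebesgue_tuple R n)%E.-integrable D (EFin \o fc).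
  apply: measurable_bounded_integrable => //; first exact: measurable_funTS.
  by exists 1; split => [|M KM]; [exact: num_real|move=> t _ /=]; rewrite (le_trans (f1 _))// ltW.
have E : (\int[lebesgue_tuple R n.+1]_(t in cube n.+1) (f t)%:E =
    \int[(mu \x lebesgue_tuple R n)%E]_(z in D) (fc z)%:E)%E.
  rewrite /= /cons_measure integral_pushforward ?unit_cubeS//.
  - exact: measurable_tuple_cons.
  - exact/measurable_EFinP.
  - exact: measurable_unit_cube.
rewrite E integral_mkcond.
pose g := (EFin \o fc) \_ D.
have ig : (mu \x lebesgue_tuple R n)%E.-integrable setT g := proj1 (integrable_mkcond _ mD) intfc.
have gE x y : g (x, y) = if (x \in `[0%R, 1%R]%classic) && (y \in cube n) then (fc (x, y))%:E else 0%E.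
  by rewrite /g patchE /D in_setX.
have [m'|m'] := pselect (exists i, m (lift ord0 i) != 0).
- have [j mj] := m'.
  rewrite -(integral12_prod_meas1 ig) integral0_eq// => x _.
  rewrite /fubini_F; under eq_integral do rewrite gE.
  case: (x \in _) => /=; last by rewrite integral0.
  rewrite -[RHS](IH (fun i => m (lift ord0 i)) (2 * pi * ((m ord0)%:~R * x) + th) _ mj).
  rewrite [RHS]integral_mkcond; apply: eq_integral => y _.
  by rewrite patchE /fc /f /= phase_cons.
have m0 : m ord0 != 0.
  by case: (unliftP ord0 i) mi => [j ->|-> //] mj; exfalso; apply: m'; exists j.
rewrite -(integral21_prod_meas1 ig) integral0_eq// => y _.
rewrite /fubini_G; under eq_integral do rewrite gE.
case: (y \in cube n); last by under eq_integral do rewrite andbF; rewrite integral0.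
rewrite -[RHS](integral_cos_period (2 * pi * (\sum_i (m (lift ord0 i))%:~R * tnth y i) + th) m0).
rewrite [RHS]integral_mkcond; apply: eq_integral => x _.
rewrite andbT patchE /fc /f /= phase_cons /phase.
by case: (_ \in _) => //; congr (cos _)%:E; rewrite addrCA addrA.
Qed.

Lemma Rintegral_trig n (I : Type) (s : seq I) (b : R) (a th : I -> R) (m : I -> 'I_n -> int) :
  (forall i, exists j, m i j != 0) ->
  Rintegral (lebesgue_tuple R n) (cube n)
    (fun t => b + \sum_(i <- s) a i * cos (phase (m i) (th i) t)) = b.
Proof.
move=> m0; have mc := @measurable_unit_cube n.
have c1 i t : `|cos (phase (m i) (th i) t)| <= 1 by rewrite ler_norml cos_geN1 cos_le1.
have ic i : (lebesgue_tuple R n).-integrable (cube n) (EFin \o (fun t => cos (phase (m i) (th i) t))).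
  by apply: integrable_cube (c1 i); exact: measurable_cos_phase.
elim: s => [|i s IH].
  under eq_Rintegral do rewrite big_nil addr0.
  by rewrite Rintegral_cst// [X in fine X](lebesgue_unit_cube n) mulr1.
under eq_Rintegral do rewrite big_cons addrCA.
rewrite RintegralD//.
- rewrite RintegralZl//= IH; have [j mj] := m0 i.
  by rewrite /Rintegral (integral_cos_torus _ mj) mulr0 add0r.
- apply: (@integrable_cube _ _ `|a i|).
    by apply: measurable_funM => //; exact: measurable_cos_phase.
  by move=> t; rewrite normrM ler_piMr.
- apply: (@integrable_cube _ _ (`|b| + \sum_(i <- s) `|a i|)).
    apply: measurable_funD => //; apply: measurable_sum => k.
    by apply: measurable_funM => //; exact: measurable_cos_phase.
  move=> t; rewrite (le_trans (ler_normD _ _))// lerD2l (le_trans (ler_norm_sum _ _ _))//.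
  by apply: ler_sum => k _; rewrite normrM ler_piMr.
Qed.

(** Integrate the two-sided inequality over the cube, which has measure 1; the cosines have mean
    zero. *)
Lemma torus_mean_error n (I : finType) (h : n.-tuple R -> R) (b eta : R) (a th : I -> R)
    (m : I -> 'I_n -> int) :
  measurable_fun setT h -> (forall i, exists j, m i j != 0) ->
  (forall t, `|h t - b - \sum_i a i * cos (phase (m i) (th i) t)| <= eta) ->
  `|b - Rintegral (lebesgue_tuple R n) (cube n) h| <= eta.
Proof.
move=> mh m0 H; have mc := @measurable_unit_cube n.
have mS e : measurable_fun setT (fun t => e + \sum_i a i * cos (phase (m i) (th i) t)).
  apply: measurable_funD => //; apply: measurable_sum => k.
  by apply: measurable_funM => //; exact: measurable_cos_phase.
have bS t : `|\sum_i a i * cos (phase (m i) (th i) t)| <= \sum_i `|a i|.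
  rewrite (le_trans (ler_norm_sum _ _ _))//; apply: ler_sum => k _.
  by rewrite normrM ler_piMr// ler_norml cos_geN1 cos_le1.
have iS e : (lebesgue_tuple R n).-integrable (cube n)
    (EFin \o (fun t => e + \sum_i a i * cos (phase (m i) (th i) t))).
  apply: (@integrable_cube _ _ (`|e| + \sum_i `|a i|)) => // t.
  by rewrite (le_trans (ler_normD _ _))// lerD2l.
have ih : (lebesgue_tuple R n).-integrable (cube n) (EFin \o h).
  apply: (@integrable_cube _ _ (eta + `|b| + \sum_i `|a i|)) => // t.
  have -> : h t = (h t - b - \sum_i a i * cos (phase (m i) (th i) t)) + b +
     \sum_i a i * cos (phase (m i) (th i) t) by ring.
  rewrite (le_trans (ler_normD _ _))// lerD// (le_trans (ler_normD _ _))// lerD2r//.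
have U : Rintegral (lebesgue_tuple R n) (cube n) h <= b + eta.
  rewrite -(Rintegral_trig (index_enum I) (b + eta) a th m0); apply: le_Rintegral => // t _.
  have := H t; rewrite ler_norml => /andP[_].
  by move: (\sum_i _) (h t) => u v; lra.
have L : b - eta <= Rintegral (lebesgue_tuple R n) (cube n) h.
  rewrite -(Rintegral_trig (index_enum I) (b - eta) a th m0); apply: le_Rintegral => // t _.
  have := H t; rewrite ler_norml => /andP[].
  by move: (\sum_i _) (h t) => u v; lra.
by move: (Rintegral _ _ _) L U => u; rewrite ler_norml => *; apply/andP; split; lra.
Qed.

(** Makes the data measurable for the product sigma-algebra on tuples: they are uniform limits of
    trigonometric polynomials, which are measurable by construction. *)
Lemma measurable_uniform_limit d (T : measurableType d) (h : T -> R) :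
  (forall eta : R, 0 < eta -> exists2 f : T -> R, measurable_fun setT f &
     forall t, `|h t - f t| <= eta) -> measurable_fun setT h.
Proof.
move=> H; have /choice[f Hf] : forall k : nat, exists f : T -> R, measurable_fun setT f /\
    forall t, `|h t - f t| <= k.+1%:R^-1.
  by move=> k; have [//|f ? ?] := H k.+1%:R^-1; exists f.
apply: (measurable_fun_cvg (fun k => (Hf k).1)) => t _.
apply/cvgrPdist_le => e e0; near=> k.
rewrite (le_trans ((Hf k).2 t))// ltW//.
by near: k; exact: near_infty_natSinv_lt (PosNum e0).
Unshelve. all: by end_near. Qed.

End torus.

(** * Powers of the distance to a hyperplane *)

Section integral_powers.
Context (R : realType).
Local Notation mu := (@lebesgue_measure R).
Local Open Scope ereal_scope.

(** Unlike [ge0_le_integral], this does not need measurability. *)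
Lemma ge0_integral_mono d (T : measurableType d) (m : {measure set T -> \bar R})
    (f g : T -> \bar R) : (forall t, 0 <= f t) -> (forall t, f t <= g t) ->
  \int[m]_t f t <= \int[m]_t g t.
Proof.
move=> f0 fg; rewrite !ge0_integralTE//; last by move=> t; exact: le_trans (fg t).
by apply: le_ereal_sup => _ [h hf <-]; exists h => // t; exact: le_trans (fg t).
Qed.

(** Only the majorant [G] has to be measurable; [f], which will be the difference of the solutions,
    is bounded through it. *)
Lemma Lnorm_le d (T : measurableType d) (m : {measure set T -> \bar R})
    (f G : T -> \bar R) (p K M : R) : (0 < p)%R -> (0 <= K)%R -> (0 <= M)%R ->
  measurable_fun setT G -> (forall t, 0 <= G t) -> \int[m]_t G t <= M%:E ->
  (forall t, `|f t| `^ p <= (K `^ p)%:E * G t) ->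
  Lnorm m p%:E f <= (K * M `^ p^-1)%:E.
Proof.
move=> p0 K0 M0 mG G0 GM fG; rewrite unlock.
have H : \int[m]_t `|f t| `^ p <= (K `^ p * M)%:E.
  apply: le_trans (ge0_integral_mono _ _ fG) _ => [t|]; first exact: poweR_ge0.
  rewrite ge0_integralZl_EFin ?powR_ge0// EFinM.
  by rewrite lee_pmul ?lee_fin ?powR_ge0// integral_ge0.
apply: le_trans (gt0_ler_poweR _ _ _ H) _.
- by rewrite invr_ge0 ltW.
- by rewrite in_itv /= leey integral_ge0// => t _; exact: poweR_ge0.
- by rewrite in_itv /= leey lee_fin mulr_ge0 ?powR_ge0.
by rewrite poweR_EFin lee_fin powRM ?powR_ge0// -powRrM divff ?gt_eqF// powRr1.
Qed.

Definition cbox n (B : R) : set (n.-tuple R) := [set t | forall i, (`|tnth t i| <= B)%R].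

Lemma cboxS n (B : R) : @tuple_cons R n @^-1` cbox B = `[(- B)%R, B]%classic `*` @cbox n B.
Proof.
apply/seteqP; split=> [[x t] H /=|[x t] [/= x01 H] i].
  split; first by have := H ord0; rewrite /= in_itv /= (tnth_nth 0%R) ler_norml.
  by move=> i; have := H (lift ord0 i); rewrite !(tnth_nth 0%R).
case: (unliftP ord0 i) => [j ->|->].
  by have := H j; rewrite !(tnth_nth 0%R).
by rewrite (tnth_nth 0%R) /= ler_norml; rewrite /= in_itv /= in x01.
Qed.

Lemma measurable_cbox n (B : R) : measurable (@cbox n B).
Proof.
have -> : @cbox n B = \big[setI/setT]_(i < n) ((fun t : n.-tuple R => tnth t i) @^-1` `[(- B)%R, B]%classic).
  apply/seteqP; split=> t; rewrite -bigcap_seq.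
    by move=> H i _ /=; rewrite in_itv /= -ler_norml; exact: H.
  by move=> H i; have := H i; rewrite /= in_itv /= -ler_norml; apply; rewrite mem_index_enum.
apply: bigsetI_measurable => i _; rewrite -[X in measurable X]setTI.
by apply: (measurable_tnth i) => //; exact: measurable_itv.
Qed.

Lemma lebesgue_itv_cc (a b : R) : (a <= b)%R -> mu `[a, b]%classic = (b - a)%:E.
Proof.
move=> ab; have := @lebesgue_measure_itv R `[a, b]; rewrite /= lte_fin => ->.
by case: ltgtP ab => // -> _; rewrite subrr.
Qed.

Lemma lebesgue_cbox n (B : R) : (0 <= B)%R -> lebesgue_tuple R n (cbox B) = ((2 * B) ^+ n)%:E.
Proof.
move=> B0; elim: n => [|n IH].
  by rewrite /= diracE mem_set// => -[].
rewrite /= /cons_measure /pushforward cboxS.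
rewrite product_measure1E//; last exact: measurable_cbox.
have m1 : mu `[(- B)%R, B]%classic = (2 * B)%:E.
  by rewrite lebesgue_itv_cc ?ge0_cp//; congr EFin; ring.
by rewrite exprS EFinM; congr (_ * _)%E; [exact: m1|exact: IH].
Qed.

Definition slab n (nu : 'rV[R]_n) (c B h : R) : set (n.-tuple R) :=
  cbox B `&` [set t | (0 < dot nu (rV_of_tuple t) - c <= h)%R].

Lemma dot_rV_of_tuple n (nu : 'rV[R]_n) t :
  dot nu (rV_of_tuple t) = (\sum_i nu 0 i * tnth t i)%R.
Proof. by apply: eq_bigr => i _; rewrite mxE. Qed.

Lemma measurable_dot n (nu : 'rV[R]_n) (c : R) :
  measurable_fun setT (fun t => dot nu (rV_of_tuple t) - c)%R.
Proof.
under eq_fun do rewrite dot_rV_of_tuple.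
apply: measurable_funB => //; apply: measurable_sum => i.
by apply: measurable_funM => //; exact: measurable_tnth.
Qed.

Lemma measurable_slab n (nu : 'rV[R]_n) (c B h : R) : measurable (slab nu c B h).
Proof.
apply: measurableI; first exact: measurable_cbox.
have := measurable_dot nu c => /(_ measurableT `]0%R, h]%classic (measurable_itv _)).
rewrite setTI; congr (measurable _); apply/seteqP; split=> t /=;
  by rewrite in_itv.
Qed.

(** For fixed last coordinates, the first one ranges over an interval of length [h / |a|], [a] being
    the first component of [nu]; Fubini over the box gives a measure linear in [h]. *)
Lemma lebesgue_slab n (nu : 'rV[R]_n.+1) (c B : R) : (0 <= B)%R -> (nu 0 ord0 != 0)%R ->
  exists2 C : R, (0 <= C)%R &
    forall h : R, (0 <= h)%R -> lebesgue_tuple R n.+1 (slab nu c B h) <= (C * h)%:E.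
Proof.
move=> B0 nu0; pose a : R := (nu 0 ord0)%R.
have a0 : (0 < `|a|)%R by rewrite normr_gt0.
exists ((2 * B) ^+ n / `|a|)%R => [|h h0]; first by rewrite divr_ge0 ?exprn_ge0 ?mulr_ge0.
pose A := @tuple_cons R n @^-1` slab nu c B h.
have mA : measurable A.
  rewrite -[A]setTI; apply: measurable_tuple_cons => //; exact: measurable_slab.
have -> : lebesgue_tuple R n.+1 (slab nu c B h) = \int[(mu \x lebesgue_tuple R n)]_z (\1_A z)%:E.
  by rewrite integral_indic// setIT.
rewrite fubini_tonelli2/=; last 2 first.
- exact/measurable_EFinP/measurable_indic.
- by move=> z; rewrite lee_fin.
pose r (y : n.-tuple R) := (\sum_i nu 0%R (lift ord0 i) * tnth y i - c)%R.
have dE x y : (dot nu (rV_of_tuple (tuple_cons (x, y))) - c = a * x + r y)%R.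
  rewrite dot_rV_of_tuple big_ord_recl (tnth_nth 0%R) /= /r -addrA; congr (_ + (_ - _))%R.
  by apply: eq_bigr => i _; rewrite !(tnth_nth 0%R).
apply: (@le_trans _ _ (\int[lebesgue_tuple R n]_y ((h / `|a|)%:E * (\1_(@cbox n B) y)%:E))).
  apply: ge0_integral_mono => y; rewrite /fubini_G.
    by apply: integral_ge0 => x _; rewrite lee_fin.
  have [yB|yB] := boolP (y \in @cbox n B); last first.
    have -> : \1_(@cbox n B) y = 0%R :> R by rewrite indicE (negbTE yB).
    rewrite mule0 integral0_eq// => x _; rewrite indicE memNset//= => -[]; rewrite -[cbox B _]/((tuple_cons (n:=n) @^-1` cbox B) (x, y)) cboxS.
    by move=> [_ yB'] _; move: yB; rewrite mem_set.
  have -> : \1_(@cbox n B) y = 1%R :> R by rewrite indicE yB.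
  rewrite mule1.
  pose lo : R := if (0 < a)%R then (- r y / a)%R else ((h - r y) / a)%R.
  pose hi : R := (lo + h / `|a|)%R.
  have lohi : (lo <= hi)%R by rewrite lerDl divr_ge0.
  apply: (@le_trans _ _ (\int[mu]_x (\1_(`[lo, hi]%classic) x)%:E)).
    apply: ge0_integral_mono => x; first by rewrite lee_fin.
    rewrite lee_fin !indicE; case: (boolP (_ \in A)) => [|_]; last by case: (_ \in _).
    rewrite inE => -[_ /=]; rewrite dE => /andP[d1 d2].
    rewrite mem_set//= in_itv /= /hi /lo; case: ifPn => a1.
      rewrite (gtr0_norm a1) -mulrDl ler_pdivrMr// ler_pdivlMr// [(x * a)%R]mulrC.
      by move: (a * x)%R d1 d2 => u; lra.
    have a2 : (a < 0)%R by rewrite lt_neqAle nu0 leNgt.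
    rewrite (ltr0_norm a2) invrN mulrN -mulrBl ler_ndivrMr// ler_ndivlMr// [(x * a)%R]mulrC.
    by move: (a * x)%R d1 d2 => u; lra.
  have E : mu `[lo, hi]%classic = (h / `|a|)%:E.
    by rewrite lebesgue_itv_cc// /hi addrAC subrr add0r.
  rewrite integral_indic ?setIT//.
  by rewrite -E; exact: lexx.
rewrite ge0_integralZl_EFin//.
- rewrite integral_indic ?setIT//; last exact: (@measurable_cbox n B).
  by rewrite [X in _ * X](lebesgue_cbox n B0) -EFinM lee_fin mulrC mulrA mulrAC.
- apply/measurable_EFinP; apply: measurable_indic; exact: (@measurable_cbox n B).
- by rewrite divr_ge0.
Qed.

(** On the layer where the distance lies between [H / 2^(j+1)] and [H / 2^j], the power is at most
    its value [w j] at the inner end. The series of [w j] times the indicators of slabs is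
    measurable, and [s < 1] makes its integral finite. *)
Lemma halfspace_power_majorant n (nu : 'rV[R]_n.+1) (c B s : R) :
  (0 <= B)%R -> (nu 0 ord0 != 0)%R -> (0 <= s < 1)%R ->
  exists G : n.+1.-tuple R -> \bar R, [/\ measurable_fun setT G, forall t, 0 <= G t,
    \int[lebesgue_tuple R n.+1]_t G t < +oo &
    forall t, cbox B t -> (0 < dot nu (rV_of_tuple t) - c)%R ->
      ((dot nu (rV_of_tuple t) - c) `^ (- s))%:E <= G t].
Proof.
move=> B0 nu0 /andP[s0 s1].
have [C C0 HC] := lebesgue_slab c B0 nu0.
pose H : R := (\sum_i `|nu 0%R i| * B + `|c| + 1)%R.
have H0 : (0 < H)%R.
  by rewrite ltr_wpDl// addr_ge0// sumr_ge0// => i _; rewrite mulr_ge0.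
have dH t : cbox B t -> (dot nu (rV_of_tuple t) - c <= H)%R.
  move=> tB; rewrite /H -addrA lerD//.
    rewrite dot_rV_of_tuple ler_sum// => i _.
    by rewrite (le_trans (ler_norm _))// normrM ler_wpM2l.
  by rewrite ler_wpDr// -normrN ler_norm.
(* dyadic decomposition of [0 < d <= H] *)
pose w j : R := ((H / 2 ^+ j.+1) `^ (- s))%R.
pose f j (t : n.+1.-tuple R) : \bar R := (w j)%:E * (\1_(slab nu c B (H / 2 ^+ j)) t)%:E.
have w0 j : (0 <= w j)%R by exact: powR_ge0.
have f0 j t : 0 <= f j t by rewrite mule_ge0// lee_fin.
have mi j : measurable_fun setT (fun t : n.+1.-tuple R => (\1_(slab nu c B (H / 2 ^+ j)) t : R)%:E).
  apply/measurable_EFinP; apply: measurable_indic; exact: measurable_slab.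
have mf j : measurable_fun setT (f j) by apply: measurable_funeM; exact: mi.
exists (fun t => \sum_(j <oo) f j t); split.
- by apply: ge0_emeasurable_sum => // j t _.
- by move=> t; apply: nneseries_ge0.
- rewrite integral_nneseries//.
  (* The ratio of the geometric series: weights grow like [2^(s j)] while slab measures are at most
     [C H / 2^j]. *)
  pose z : R := ((2 `^ s) / 2)%R.
  have z0 : (0 <= z)%R by rewrite divr_ge0 ?powR_ge0.
  have z1 : (z < 1)%R.
    rewrite ltr_pdivrMr// mul1r /powR pnatr_eq0 /= -[ltRHS]lnK ?posrE// ltr_expR.
    by rewrite gtr_pMl// ln_gt0 ?ltr1n.
  pose a : R := (H `^ (- s) * 2 `^ s * (C * H))%R.
  have a0 : (0 <= a)%R by rewrite !mulr_ge0 ?powR_ge0// ltW.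
  have If j : \int[lebesgue_tuple R n.+1]_t f j t <= (a * z ^+ j)%:E.
    rewrite ge0_integralZl_EFin//.
    rewrite integral_indic ?setIT//; last exact: measurable_slab.
    have h0 : (0 <= H / 2 ^+ j)%R by rewrite divr_ge0 ?exprn_ge0// ltW.
    apply: (le_trans (lee_wpmul2l _ (HC _ h0))); first by rewrite lee_fin.
    rewrite -EFinM lee_fin /w powRM ?invr_ge0 ?exprn_ge0 ?(ltW H0)//.
    have -> : ((2 ^- j.+1) `^ (- s) = (2 `^ s) ^+ j.+1 :> R)%R.
      rewrite -!powR_mulrn ?powR_ge0// -powRN -!powRrM; congr (_ `^ _)%R; ring.
    rewrite /a /z exprMn exprVn exprS le_eqVlt; apply/orP; left; apply/eqP; ring.
  apply: le_lt_trans (_ : (a / (1 - z))%:E < +oo); last by rewrite ltry.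
  apply: lime_le; first by apply: is_cvg_nneseries => j _ _; exact: integral_ge0.
  apply: nearW => k; apply: (@le_trans _ _ (\sum_(0 <= j < k) (a * z ^+ j)%:E)).
    by apply: lee_sum => j _.
  rewrite sumEFin lee_fin.
  have := @geometric_seriesE R a z (negbT (lt_eqF z1)).
  move=> /(congr1 (fun u => u k)); rewrite /series /= => ->.
  by rewrite ler_wpM2r ?invr_ge0 ?subr_ge0 ?(ltW z1)// ler_piMr// gerBl exprn_ge0.
- move=> t tB; set d := (dot _ _ - c)%R => d0.
  have ex : exists m, (H / 2 ^+ m < d)%R.
    exists (Num.bound (H / d)%R); rewrite ltr_pdivrMr ?exprn_gt0// mulrC -ltr_pdivrMr//.
    exact: upper_nthrootP.
  have [m Hm mmin] := ex_minnP ex.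
  case: m Hm mmin => [|j] Hm mmin.
    by move: Hm; rewrite expr0 divr1 ltNge dH.
  have dj : (d <= H / 2 ^+ j)%R by rewrite leNgt; apply/negP => /mmin; rewrite ltnn.
  apply: (@le_trans _ _ (f j t)).
    rewrite /f indicE mem_set//; last by split => //=; rewrite -/d d0.
    rewrite mule1 lee_fin /w !powRN lef_pV2 ?posrE ?powR_gt0 ?divr_gt0 ?exprn_gt0//.
    by rewrite ge0_ler_powR ?nnegrE ?divr_ge0 ?exprn_ge0 ?(ltW d0) ?(ltW H0)// ltW.
  rewrite (nneseriesD1 (n := j))//.
  by rewrite leeDl// nneseries_ge0.
Qed.

End integral_powers.

(** * Comparison in a polygon *)

Section comparison.
Context (R : realType) (d : nat).
Local Notation V := 'rV[R]_d.
Local Notation e_ := (@basis_vec R d).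
Variable A : V -> 'M[R]_d.
Hypothesis A2 : forall k l, C2 setT (fun x => A x k l).

Let dA i j (x : V) : differentiable (fun y => A y i j) x := (A2 i j (I : setT x)).1.

Lemma elliptic_op_sum (U : set V) (I : Type) (s : seq I) (a : I -> R) (f : I -> V -> R) :
  open U -> (forall i, C2 U (f i)) ->
  C2 U (fun x => \sum_(i <- s) a i * f i x) /\
  forall x, U x -> elliptic_op A (fun x => \sum_(i <- s) a i * f i x) x =
    \sum_(i <- s) a i * elliptic_op A (f i) x.
Proof.
move=> oU cf; elim: s => [|i s [IH1 IH2]].
  have -> : (fun x : V => \sum_(i <- [::]) a i * f i x) = cst 0.
    by apply/funext => x; rewrite big_nil.
  split; first exact: C2_cst.
  by move=> x Ux; rewrite (elliptic_op_cst dA 0 Ux) big_nil.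
have -> : (fun x : V => \sum_(i <- i :: s) a i * f i x) =
    cst (a i) * f i + (fun x => \sum_(i <- s) a i * f i x).
  by apply/funext => x; rewrite big_cons.
have ci : C2 U (cst (a i) * f i) by apply: (C2M oU) => //; exact: C2_cst.
split; first exact: C2D.
by move=> x Ux; rewrite (elliptic_opD dA oU ci IH1 Ux) (elliptic_opZ dA oU _ (cf i) Ux) IH2// big_cons.
Qed.

Variable c : R.
Hypothesis c0 : 0 < c.
Hypothesis Aell : forall x (xi : V), c^-1 * dot xi xi <= qA A x xi xi.

(** The maximum principle for [s * (w - F) - W] with [s = 1] and [s = -1]. The strict excess of the
    operator on [W] pays for [F] not solving the equation. *)
Lemma comparison (D U : set V) (w F W : V -> R) :
  open D -> bounded_set D -> open U -> closure D `<=` U ->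
  C2 D w -> {within closure D, continuous w} -> C2 U F -> C2 U W ->
  (forall x, D x -> elliptic_op A w x = 0) ->
  (forall x, D x -> `|elliptic_op A F x| < elliptic_op A W x) ->
  (forall x, boundary D x -> `|w x - F x| <= W x) ->
  forall x, D x -> `|w x - F x| <= W x.
Proof.
move=> oD bD oU DU cw ctw cF cW Lw LF wb.
have DU' : D `<=` U by apply: subset_trans DU; exact: subset_closure.
have H (s : R) : `|s| = 1 -> forall x, D x -> s * (w x - F x) <= W x.
  move=> s1.
  have cwD : C2 D (cst s * w) by apply: (C2M oD) => //; exact: C2_cst.
  have cFU : C2 U (cst (- s) * F) by apply: (C2M oU) => //; exact: C2_cst.
  have cWU : C2 U (cst (- 1) * W) by apply: (C2M oU) => //; exact: C2_cst.
  pose G := cst (- s) * F + cst (- 1) * W.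
  have cG : C2 U G by exact: C2D.
  pose z := cst s * w + G.
  have zE x : z x = s * (w x - F x) - W x.
    have -> : z x = s * w x + (- s * F x + (- 1) * W x) by [].
    by ring.
  have zD : forall x, D x -> z x <= 0.
    apply: (max_principle dA c0 Aell oD bD).
    - by apply: (C2D oD cwD); exact: C2_sub cG.
    - have cG' : {within closure D, continuous G}.
        apply: continuous_in_subspaceT => x; rewrite inE => /DU Ux.
        exact: (C2_continuous cG Ux).
      move=> x; apply: cvgD; last exact: cG'.
      by apply: cvgM; [exact: cvg_cst|exact: ctw].
    - move=> x Dx; have Ux := DU' _ Dx.
      rewrite (elliptic_opD dA oD cwD (C2_sub DU' cG) Dx) (elliptic_opD dA oU cFU cWU Ux).
      rewrite (elliptic_opZ dA oD _ cw Dx) (elliptic_opZ dA oU _ cF Ux) (elliptic_opZ dA oU _ cW Ux).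
      rewrite Lw// mulr0 add0r mulN1r subr_lt0 (le_lt_trans _ (LF _ Dx))//.
      by rewrite (le_trans (ler_norm _))// normrM normrN s1 mul1r.
    - move=> x bx; rewrite zE subr_le0 (le_trans _ (wb _ bx))//.
      by rewrite (le_trans (ler_norm _))// normrM s1 mul1r.
  by move=> x Dx; have := zD x Dx; rewrite zE subr_le0.
move=> x Dx; rewrite ler_norml; apply/andP; split.
  by have := H (- 1) (normrN1 _) x Dx; rewrite mulN1r lerNl.
by have := H 1 (normr1 _) x Dx; rewrite mul1r.
Qed.

Lemma qA_diag x (xi : V) : qA A x xi xi = \sum_i \sum_j A x i j * xi 0 i * xi 0 j.
Proof. by rewrite /qA; apply: eq_bigr => i _; apply: eq_bigr => j _; field. Qed.

Lemma class_C2_bounded (D : set V) (f : V -> R) : bounded_set D -> class_C 2 setT f ->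
  exists K : R, forall x, D x ->
    [/\ `|f x| <= K, forall m, `|grad f x 0 m| <= K & forall m n, `|hess f x m n| <= K].
Proof.
move=> bD cf.
have cD : compact (closure D).
  by apply: bounded_closed_compact; [exact: bounded_closure|exact: closed_closure].
have B (g : V -> R) : (forall x, {for x, continuous g}) ->
    exists K : R, 0 <= K /\ forall x, D x -> `|g x| <= K.
  move=> cg; have cN : continuous (fun x => `|g x|).
    by move=> x; apply: continuous_comp; [exact: cg|exact: norm_continuous].
  have [D0|/set0P[x0 Dx0]] := eqVneq D set0.
    by exists 0; split=> // x; rewrite D0.
  have [|y _ Hy] := EVT_max_rV _ cD (continuous_subspaceT cN).
    by exists x0; exact: subset_closure.
  by exists `|g y|; split=> // x Dx; apply: Hy; rewrite inE; exact: subset_closure.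
have [K0 [K00 HK0]] := B f (class_C_continuous cf).
have /choice[K1 HK1] m : exists K : R, 0 <= K /\ forall x, D x -> `|'D_(e_ m) f x| <= K.
  by apply: B; apply: (@class_C_continuous _ _ 1); have [_ /(_ m)[]] := cf.
have /choice[K2 HK2] (mn : 'I_d * 'I_d) : exists K : R, 0 <= K /\
    forall x, D x -> `|'D_(e_ mn.1) ('D_(e_ mn.2) f) x| <= K.
  apply: B; apply: (@class_C_continuous _ _ 0).
  by have [_ /(_ mn.2)[_ [_ /(_ mn.1)[]]]] := cf.
have s1 : 0 <= \sum_m K1 m by apply: sumr_ge0 => i _; have [] := HK1 i.
have s2 : 0 <= \sum_m K2 m by apply: sumr_ge0 => i _; have [] := HK2 i.
exists (K0 + \sum_m K1 m + \sum_m K2 m) => x Dx; split.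
- by rewrite -addrA ler_wpDr ?addr_ge0// HK0.
- move=> m; rewrite gradE ler_wpDr// ler_wpDl// (le_trans ((HK1 m).2 _ Dx))//.
  by rewrite (bigD1 m)//= lerDl sumr_ge0// => i _; have [] := HK1 i.
- move=> m n; rewrite hessE ler_wpDl ?addr_ge0// (le_trans ((HK2 (m, n)).2 _ Dx))//.
  by rewrite (bigD1 (m, n))//= lerDl sumr_ge0// => i _; have [] := HK2 i.
Qed.

End comparison.

(** * Geometry of the polygon *)

Section polygon.
Context (R : realType) (d N : nat).
Local Notation V := 'rV[R]_d.
Implicit Types (nu : 'I_N -> V) (c : 'I_N -> R).

Lemma polygon_open nu c : open (polygon nu c).
Proof.
rewrite openE => x Dx.
suff : \forall y \near x, forall k, c k < dot (nu k) y by [].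
have nx k : nbhs x [set y | c k < dot (nu k) y].
  by apply: open_nbhs_nbhs; split; [exact: open_halfspace|exact: Dx].
exact: (@filter_forall _ _ (fun k y => c k < dot (nu k) y) (nbhs x) _ nx).
Qed.

Lemma closure_polygon nu c x : closure (polygon nu c) x -> forall k, c k <= dot (nu k) x.
Proof.
move=> cx k; have cl : closed [set x : V | c k <= dotl (nu k) x].
  exact: (@closed_comp _ _ (dotl (nu k)) [set y | c k <= y]
    (fun x _ => @dotl_continuous _ _ (nu k) x) (@closed_ge _ _)).
have := closureS (_ : polygon nu c `<=` [set x : V | c k <= dotl (nu k) x]) cx.
by rewrite -(closure_id _).1//; apply=> y Dy; exact: ltW (Dy k).
Qed.

Lemma boundary_polygon nu c x : boundary (polygon nu c) x ->
  (forall k, c k <= dot (nu k) x) /\ exists k, dot (nu k) x = c k.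
Proof.
move=> [cx nDx]; have H := closure_polygon cx; split => //.
apply: contrapT => nk; apply: nDx; rewrite (interior_id _).1; last exact: polygon_open.
move=> k; rewrite lt_neqAle H andbT eq_sym; apply/eqP => E; apply: nk; by exists k.
Qed.

(** Otherwise the two unit normals coincide; a point of the face [j] then gives [c k < c j], and a
    point of the face [k] the reverse. *)
Lemma dot_normals_lt1 nu c j k : bounded_convex_polygonal nu c -> j != k ->
  dot (nu j) (nu k) < 1.
Proof.
move=> [nu1 _ _ fc] jk; rewrite ltNge; apply/negP => H.
have E : nu j = nu k.
  apply/eqP; rewrite -subr_eq0; apply: contraT => /dot_gt0.
  have -> : dot (nu j - nu k) (nu j - nu k) = 2 - 2 * dot (nu j) (nu k).
    rewrite -[nu j - nu k]/(nu j + - nu k) -scaleN1r !(dotDl, dotDr, dotZl, dotZr) !nu1.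
    by rewrite [dot (nu k) _]dotC; ring.
  by lra.
have [x [xj xj']] := fc j; have [y [yk yk']] := fc k.
have : c k < dot (nu k) x by apply: xj'; rewrite eq_sym.
have : c j < dot (nu j) y by exact: yk'.
by rewrite {1}E yk -E xj => h1 h2; have := lt_trans h1 h2; rewrite ltxx.
Qed.

End polygon.

(** * Correctors for Diophantine normals *)

Section diophantine.
Context (R : realType) (d : nat).
Local Notation V := 'rV[R]_d.
Implicit Types (nu v : V) (m : 'rV[int]_d).

Definition frequency m : V := (2 * pi) *: map_mx intr m.
Definition tangential nu v : V := v - dot v nu *: nu.

Lemma dot_tangential nu v x : dot (tangential nu v) x = dot v x - dot v nu * dot nu x.
Proof. by rewrite /tangential -scaleN1r dotDl !dotZl; ring. Qed.

Lemma dot_tangential_normal nu v : dot nu nu = 1 -> dot (tangential nu v) nu = 0.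
Proof. by move=> nu1; rewrite dot_tangential nu1 mulr1 subrr. Qed.

Lemma dot_ge0 v : 0 <= dot v v.
Proof. by apply: sumr_ge0 => i _; rewrite -expr2 sqr_ge0. Qed.

Lemma coord_le_sqrt_dot v i : `|v 0 i| <= Num.sqrt (dot v v).
Proof.
rewrite -sqrtr_sqr ler_wsqrtr// /dot (bigD1 i)//= expr2 lerDl.
by apply: sumr_ge0 => j _; rewrite -expr2 sqr_ge0.
Qed.

Lemma sqrt_dot_le v : Num.sqrt (dot v v) <= \sum_i `|v 0 i|.
Proof.
have S0 : 0 <= \sum_i `|v 0 i| by exact: sumr_ge0.
rewrite -[leRHS]ger0_norm// -sqrtr_sqr ler_wsqrtr// expr2 mulr_suml.
apply: ler_sum => i _; rewrite (le_trans (ler_norm _))// normrM ler_wpM2l//.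
by rewrite (bigD1 i)//= lerDl sumr_ge0.
Qed.

Lemma tangential_frequency_le nu m : dot nu nu = 1 ->
  Num.sqrt (dot (tangential nu (frequency m)) (tangential nu (frequency m))) <=
  2 * pi * int_norm1 R m.
Proof.
move=> nu1; set v := frequency m.
apply: (@le_trans _ _ (Num.sqrt (dot v v))).
  rewrite ler_wsqrtr// dot_tangential [dot v (tangential _ _)]dotC [dot nu (tangential _ _)]dotC.
  by rewrite dot_tangential_normal// mulr0 subr0 dot_tangential [dot nu v]dotC gerBl -expr2 sqr_ge0.
apply: (le_trans (sqrt_dot_le v)); rewrite mulr_sumr; apply: ler_sum => i _.
by rewrite !mxE normrM ger0_norm// mulr_ge0// pi_ge0.
Qed.

(** The minor [w_i nu_j - w_j nu_i] does not see the normal component of the frequency and equals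
    [2 pi (m_i nu_j - m_j nu_i)]. This is [2 pi] times the product of [nu] with an integer vector
    [m'], to which the Diophantine condition applies. *)
Lemma tangential_frequency_ge nu (tau : R) (t : nat) : (1 < d)%N -> dot nu nu = 1 ->
  diophantine tau nu -> tau <= t%:R ->
  exists2 C : R, 0 < C & forall m, m != 0 ->
    C / int_norm1 R m ^+ t <=
    Num.sqrt (dot (tangential nu (frequency m)) (tangential nu (frequency m))).
Proof.
move=> d1 nu1 [tau0 [C C0 HC]] taut; exists C => // m m0.
have [i mi] : exists i, m 0 i != 0.
  apply/existsP; apply: contraNT m0; rewrite negb_exists => /forallP H.
  by apply/eqP/rowP => i; apply/eqP; have := H i; rewrite negbK mxE.
have [j ji] : exists j : 'I_d, j != i.
  have [i0|i0] := eqVneq (i : nat) 0%N.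
    by exists (Ordinal d1); rewrite -val_eqE /= i0.
  by exists (Ordinal (ltnW d1)); rewrite -val_eqE /= eq_sym.
(* Nonzero because [m 0 i] is, and with [int_norm1] at most that of [m], since its entries are, up
   to sign, two entries of [m] exchanged. *)
pose m' : 'rV[int]_d := \row_l (if l == j then m 0 i else if l == i then - m 0 j else 0).
have m'0 : m' != 0.
  by apply: contraNneq mi => /rowP/(_ j); rewrite !mxE eqxx => ->.
have M'1 := int_norm1_ge1 R m'0.
have M'M : int_norm1 R m' <= int_norm1 R m.
  rewrite /int_norm1 [leRHS](reindex_inj (@perm_inj _ (tperm i j))) /=.
  apply: ler_sum => l _; rewrite mxE; case: (eqVneq l j) => [->|lj]; first by rewrite tpermR.
  case: (eqVneq l i) => [->|li]; last by rewrite normr0.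
  by rewrite tpermL rmorphN normrN.
have dE : dot (map_mx intr m') nu = (m 0 i)%:~R * nu 0 j - (m 0 j)%:~R * nu 0 i.
  rewrite /dot (bigD1 j)//= (bigD1 i)/=; last by rewrite eq_sym.
  rewrite big1 ?addr0 => [|l /andP[lj li]].
    by rewrite !mxE eqxx eq_sym (negbTE ji) eqxx rmorphN mulNr.
  by rewrite !mxE (negbTE lj) (negbTE li) mul0r.
set v := frequency m; set w := tangential nu v.
have wE : w 0 i * nu 0 j - w 0 j * nu 0 i = 2 * pi * dot (map_mx intr m') nu.
  by rewrite dE /w /tangential; move: (dot v nu) => u; rewrite !mxE; ring.
have nu_le l : `|nu 0 l| <= 1 by have := coord_le_sqrt_dot nu l; rewrite nu1 sqrtr1.
have W : `|w 0 i * nu 0 j - w 0 j * nu 0 i| <= 2 * Num.sqrt (dot w w).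
  rewrite (le_trans (ler_normB _ _))// mulrDl mul1r !normrM.
  by rewrite lerD// -[leRHS]mulr1 ler_pM// coord_le_sqrt_dot.
have H := HC _ m'0.
have M0 : 0 < int_norm1 R m by exact: lt_le_trans (le_trans M'1 M'M).
have P : (int_norm1 R m ^+ t)^-1 <= int_norm1 R m' `^ (- tau).
  rewrite powRN lef_pV2 ?posrE ?powR_gt0 ?exprn_gt0//; last exact: lt_le_trans M'1.
  rewrite -powR_mulrn ?(ltW M0)//.
  apply: (@le_trans _ _ (int_norm1 R m `^ tau)).
    by rewrite ge0_ler_powR ?nnegrE ?(ltW tau0) ?(ltW M0)// (le_trans _ M'1).
  by rewrite ler_powR// (le_trans M'1).
have H2 : C / int_norm1 R m ^+ t <= `|dot (map_mx intr m') nu|.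
  by rewrite (le_trans _ (ltW H))// ler_pM2l.
have pi1 : 1 <= pi :> R by rewrite (le_trans _ (pi_ge2 R))// ler1n.
rewrite wE normrM [`|2 * pi|]ger0_norm ?mulr_ge0 ?pi_ge0// -mulrA ler_pM2l// in W.
rewrite (le_trans H2)// (le_trans _ W)// ler_peMl//.
Qed.

End diophantine.

(** * Rational bounds for exponential layers *)

Section exponential_decay.
Context (R : realType).
Implicit Types (lam eps c t s : R).

Lemma expRN_le s : 0 <= s -> expR (- s) <= (1 + s)^-1.
Proof.
move=> s0; have s1 : 0 < 1 + s by rewrite ltr_pwDl.
by rewrite expRN lef_pV2 ?posrE ?expR_gt0// expR_ge1Dx.
Qed.

(** [(1 + s / 3)^3 <= exp s], hence [(1 + s)^3 <= (3 + s)^3 <= 27 exp s]. *)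
Lemma expRN_le2 s : 0 <= s -> expR (- s) * (1 + s) <= 27 * (1 + s)^-1 ^+ 2.
Proof.
move=> s0; have s1 : 0 < 1 + s by rewrite ltr_pwDl.
have H : (1 + s) ^+ 3 <= 27 * expR s.
  have -> : expR s = expR (s / 3) ^+ 3 by rewrite -expRM_natl; congr expR; field.
  have : 0 <= 1 + s / 3 <= expR (s / 3) by rewrite expR_ge1Dx addr_ge0// divr_ge0.
  move=> /andP[h0 h1]; have := lerXn2r 3 h0 (le_trans h0 h1) h1.
  move: (expR _) => u h2.
  apply: (@le_trans _ _ (27 * (1 + s / 3) ^+ 3)); last by rewrite ler_pM2l.
  have -> : 27 * (1 + s / 3) ^+ 3 = (3 + s) ^+ 3 by field.
  by rewrite lerXn2r ?nnegrE ?addr_ge0// lerD2r ler1n.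
rewrite expRN exprVn ler_pdivlMr ?exprn_gt0// -mulrA -exprS mulrC ler_pdivrMr ?expR_gt0//.
Qed.

Lemma one_plus_inv_le lam eps c t : 0 < lam -> 0 < eps -> 0 < c -> 0 <= t ->
  (1 + lam / eps / c * t)^-1 <= (1 + c / lam) * (eps / (t + eps)).
Proof.
move=> l0 e0 c0 t0; have te : 0 < t + eps by rewrite ltr_wpDl.
have s0 : 0 <= lam / eps / c * t by rewrite mulr_ge0// !divr_ge0// ltW.
rewrite -[leLHS]mul1r ler_pdivrMr ?ltr_pwDl// mulrA mulrAC ler_pdivlMr// mul1r.
have -> : (1 + c / lam) * eps * (1 + lam / eps / c * t) = t + eps + (c / lam * eps + lam / c * t).
  by field; rewrite !gt_eqF.
by rewrite lerDl addr_ge0// mulr_ge0 ?divr_ge0// ltW.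
Qed.

Lemma exp_layer_le lam eps c t : 0 < lam -> 0 < eps -> 0 < c -> 0 <= t ->
  expR (- (lam / eps / c * t)) <= (1 + c / lam) * (eps / (t + eps)).
Proof.
move=> l0 e0 c0 t0; apply: le_trans (one_plus_inv_le l0 e0 c0 t0).
by apply: expRN_le; rewrite mulr_ge0// !divr_ge0// ltW.
Qed.

(** The operator bound of the corrector in terms of the common profile. The dependence on [lam], in
    both directions, stays explicit in order to be traded later for a power of [|m|]. *)
Lemma exp_layer_le2 lam eps c t : 0 < lam -> 0 < eps -> 0 < c -> 0 <= t ->
  expR (- (lam / eps / c * t)) * (lam / eps + (lam / eps) ^+ 2 * t) <=
  27 * (1 + c) * (lam + 2 * c + c ^+ 2 / lam) * (eps / (t + eps) ^+ 2).
Proof.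
move=> l0 e0 c0 t0; have te : 0 < t + eps by rewrite ltr_wpDl.
pose s := lam / eps / c * t.
have s0 : 0 <= s by rewrite mulr_ge0// !divr_ge0// ltW.
have s1 : 0 < 1 + s by rewrite ltr_pwDl.
have L0 : 0 < lam / eps by rewrite divr_gt0.
have E1 : lam / eps + (lam / eps) ^+ 2 * t = lam / eps * (1 + c * s).
  by rewrite /s; field; rewrite !gt_eqF.
have H1 : 1 + c * s <= (1 + c) * (1 + s) by nra.
have H2 := expRN_le2 s0; have H3 := one_plus_inv_le l0 e0 c0 t0.
rewrite -/s in H3 *.
have H4 : (1 + s)^-1 ^+ 2 <= ((1 + c / lam) * (eps / (t + eps))) ^+ 2.
  by rewrite lerXn2r ?nnegrE ?invr_ge0 ?(ltW s1)// mulr_ge0 ?addr_ge0 ?divr_ge0 ?ltW.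
apply: (@le_trans _ _ (lam / eps * (1 + c) * (expR (- s) * (1 + s)))).
  have -> : lam / eps * (1 + c) * (expR (- s) * (1 + s)) =
    lam / eps * expR (- s) * ((1 + c) * (1 + s)) by ring.
  by rewrite E1 mulrCA mulrA ler_wpM2l// mulr_ge0 ?expR_ge0// ltW.
apply: (@le_trans _ _ (lam / eps * (1 + c) * (27 * ((1 + c / lam) * (eps / (t + eps))) ^+ 2))).
  apply: ler_wpM2l; first by rewrite mulr_ge0 ?(ltW L0)// addr_ge0// ltW.
  by apply: (le_trans H2); rewrite ler_pM2l.
by rewrite le_eqVlt; apply/orP; left; apply/eqP; field; rewrite !gt_eqF.
Qed.

End exponential_decay.

(** * The corrector of one Fourier mode on one face *)

Section phase_corrector.
Context (R : realType) (d : nat).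
Local Notation V := 'rV[R]_d.
Variable A : V -> 'M[R]_d.
Hypothesis A2 : forall k l, C2 setT (fun x => A x k l).
Variable c : R.
Hypothesis c0 : 0 < c.
Hypothesis Aell : forall x (xi : V), c^-1 * dot xi xi <= qA A x xi xi.
Hypothesis Aup : forall x (xi : V), qA A x xi xi <= c * dot xi xi.
Variable D : set V.
Hypothesis bD : bounded_set D.
Hypothesis AD : forall k l, exists K : R, forall x, D x ->
  [/\ `|A x k l| <= K, forall m, `|grad (fun x => A x k l) x 0 m| <= K &
      forall m n, `|hess (fun x => A x k l) x m n| <= K].

(** [corrector_exists] at frequency [lam / eps] along the unit tangential part of the mode. As [lam]
    is at most a multiple of [|m|] and [1 / lam] at most one of [|m|^t], the power [t.+1] covers
    both. *)
Lemma phase_corrector (nu : V) (k0 tau : R) (t : nat) : (1 < d)%N -> dot nu nu = 1 ->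
  (forall x, D x -> k0 < dot nu x) -> diophantine tau nu -> tau <= t%:R ->
  exists2 C : R, 0 <= C & forall (m : 'rV[int]_d) (th eps : R), m != 0 -> 0 < eps ->
  exists F : V -> R, [/\ C2 setT F,
    forall x, k0 <= dot nu x ->
      `|F x| <= C * int_norm1 R m ^+ t.+1 * (eps / (dot nu x - k0 + eps)),
    forall x, dot nu x = k0 -> F x = cos (2 * pi * dot (map_mx intr m) (eps^-1 *: x) + th) &
    forall x, D x -> `|elliptic_op A F x| <=
      C * int_norm1 R m ^+ t.+1 * (eps / (dot nu x - k0 + eps) ^+ 2)].
Proof.
move=> d1 nu1 pD dio taut.
have [C0 C00 HC] := corrector_exists A2 c0 Aell Aup bD AD nu1 pD.
have [kap kap0 Hk] := tangential_frequency_ge d1 nu1 dio taut.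
pose C1 : R := 1 + c / kap; pose C2' : R := C0 * (27 * (1 + c) * (2 * pi + 2 * c + c ^+ 2 / kap)).
have pi0 := pi_ge0 R; have c0' := ltW c0.
have C10 : 0 <= C1 by rewrite addr_ge0// divr_ge0// ltW.
have ck0 : 0 <= c ^+ 2 / kap by rewrite divr_ge0 ?sqr_ge0// ltW.
have C20 : 0 <= C2'.
  by rewrite /C2' mulr_ge0// mulr_ge0 ?mulr_ge0 ?addr_ge0// mulr_ge0.
exists (C1 + C2') => [|m th eps m0 e0]; first by rewrite addr_ge0.
pose M := int_norm1 R m; have M1 : 1 <= M := int_norm1_ge1 R m0.
have M0 : 0 < M by exact: lt_le_trans M1.
have Mt1 : 1 <= M ^+ t by rewrite exprn_ege1.
set w := tangential nu (frequency R m) : V.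
pose lam := Num.sqrt (dot w w).
have lam1 : lam <= 2 * pi * M by exact: tangential_frequency_le.
have lam2 : kap / M ^+ t <= lam by exact: Hk.
have lam0 : 0 < lam by apply: lt_le_trans lam2; rewrite divr_gt0// exprn_gt0.
have ilam : lam^-1 <= M ^+ t / kap.
  by rewrite -[leRHS]invrK lef_pV2 ?posrE ?invr_gt0 ?divr_gt0 ?exprn_gt0// invf_div.
have lam_sq : lam ^+ 2 = dot w w by rewrite sqr_sqrtr// dot_ge0.
pose omega : V := lam^-1 *: w.
have om1 : dot omega omega = 1.
  by rewrite /omega dotZl dotZr -lam_sq; field; rewrite gt_eqF.
have omn : dot omega nu = 0 by rewrite /omega dotZl dot_tangential_normal// mulr0.
have L0 : 0 < lam / eps by rewrite divr_gt0.
(* On the face, [dot nu x = k0], so the normal part of the frequency only adds a constant phase. *)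
pose th' := th + dot (frequency R m) nu * k0 / eps.
have [F [F2 F1 F0 FL]] := HC omega (lam / eps) th' om1 omn L0.
have B1 : 1 + c / lam <= (C1 + C2') * M ^+ t.+1.
  have h1 : c / lam <= c / kap * M ^+ t by rewrite -mulrA [_^-1 * _]mulrC ler_wpM2l.
  have h2 : M ^+ t <= M ^+ t.+1 by rewrite exprS ler_peMl// (le_trans _ Mt1).
  apply: (@le_trans _ _ (C1 * M ^+ t)).
    by rewrite /C1 mulrDl mul1r lerD.
  apply: (@le_trans _ _ (C1 * M ^+ t.+1)); first by rewrite ler_wpM2l.
  by rewrite ler_wpM2r ?exprn_ge0 ?(ltW M0)// lerDl.
have B2 : C0 * (27 * (1 + c) * (lam + 2 * c + c ^+ 2 / lam)) <= (C1 + C2') * M ^+ t.+1.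
  have Mt0 : 0 <= M ^+ t.+1 by rewrite exprn_ge0// ltW.
  apply: (@le_trans _ _ (C2' * M ^+ t.+1)); last by rewrite ler_wpM2r// lerDr.
  have hM : M <= M ^+ t.+1 by rewrite exprS ler_peMr// ltW.
  have h1 : 1 <= M ^+ t.+1 by rewrite exprn_ege1.
  have h2 : M ^+ t <= M ^+ t.+1 by rewrite exprS ler_peMl// (le_trans _ Mt1).
  have h3 : c ^+ 2 / lam <= c ^+ 2 / kap * M ^+ t.+1.
    rewrite -mulrA ler_wpM2l ?sqr_ge0// (le_trans ilam)// mulrC ler_wpM2l// invr_ge0 ltW//.
  have h4 : lam + 2 * c + c ^+ 2 / lam <= (2 * pi + 2 * c + c ^+ 2 / kap) * M ^+ t.+1.
    rewrite [leRHS]mulrDl lerD// [leRHS]mulrDl lerD//.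
      by rewrite (le_trans lam1)// ler_wpM2l// mulr_ge0.
    by rewrite -[2 * c * _]mulrA ler_wpM2l// ler_peMr.
  have -> : C2' * M ^+ t.+1 =
      C0 * (27 * (1 + c) * ((2 * pi + 2 * c + c ^+ 2 / kap) * M ^+ t.+1)).
    by rewrite /C2'; move: (M ^+ _) => u; ring.
  by rewrite ler_wpM2l// ler_wpM2l// mulr_ge0// addr_ge0.
exists F; split => //.
- move=> x hx; apply: (le_trans (F1 x hx)).
  have t0 : 0 <= dot nu x - k0 by rewrite subr_ge0.
  apply: (le_trans (exp_layer_le lam0 e0 c0 t0)).
  by rewrite ler_wpM2r// divr_ge0 ?(ltW e0)// addr_ge0// ltW.
- move=> x hx; rewrite F0//; congr cos.
  rewrite /th' /omega dotZl dot_tangential hx dotZr [dot (frequency R m) x]dotZl.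
  by move: (dot (frequency R m) nu) => u; field; rewrite !gt_eqF.
- move=> x Dx; apply: (le_trans (FL x Dx)).
  have t0 : 0 <= dot nu x - k0 by rewrite subr_ge0 ltW// pD.
  rewrite -mulrA; apply: (le_trans (ler_wpM2l C00 (exp_layer_le2 lam0 e0 c0 t0))).
  rewrite [leLHS]mulrA ler_wpM2r// divr_ge0 ?(ltW e0)// exprn_ge0// addr_ge0// ltW//.
Qed.

End phase_corrector.

Lemma sum_pair (R : realType) (I J : finType) (G : I * J -> R) :
  \sum_ij G ij = \sum_i \sum_j G (i, j).
Proof. by rewrite pair_bigA; apply: eq_bigr => -[]. Qed.

(** [I] indexes the modes and [J] the faces: the weighted coefficient sum takes care of the modes
    and leaves one sum of profiles over the faces. *)
Lemma sum_pair_bound (R : realType) (I J : finType) (a M : I -> R) (g : I * J -> R)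
    (B y : J -> R) (C K : R) :
  0 <= C -> (forall i, 0 <= M i) -> (forall k, 0 <= y k) -> (forall k, B k <= C) ->
  \sum_i `|a i| * M i <= K -> (forall ik, `|g ik| <= B ik.2 * M ik.1 * y ik.2) ->
  `|\sum_ik a ik.1 * g ik| <= C * K * \sum_k y k.
Proof.
move=> C0 M0 y0 BC aK gB; rewrite (le_trans (ler_norm_sum _ _ _))//.
apply: (@le_trans _ _ (\sum_(ik : I * J) (`|a ik.1| * M ik.1) * (C * y ik.2))).
  apply: ler_sum => ik _; rewrite normrM -mulrA ler_wpM2l// (le_trans (gB _))//.
  by rewrite [B _ * _]mulrC -mulrA ler_wpM2l// ler_wpM2r.
rewrite sum_pair /= -big_distrlr /= -mulr_sumr mulrA [C * K]mulrC ler_wpM2r ?ler_wpM2r//.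
exact: sumr_ge0.
Qed.

(** * The pointwise estimate *)

Section layer_bound.
Context (R : realType) (d N : nat).
Local Notation V := 'rV[R]_d.
Variable A : V -> 'M[R]_d.
Hypothesis A2 : forall k l, C2 setT (fun x => A x k l).
Variable c : R.
Hypothesis c0 : 0 < c.
Hypothesis Aell : forall x (xi : V), c^-1 * dot xi xi <= qA A x xi xi.
Hypothesis Aup : forall x (xi : V), qA A x xi xi <= c * dot xi xi.
Variables (nu : 'I_N -> V) (off : 'I_N -> R).
Local Notation D := (polygon nu off).
Hypothesis AD : forall k l, exists K : R, forall x, D x ->
  [/\ `|A x k l| <= K, forall m, `|grad (fun x => A x k l) x 0 m| <= K &
      forall m n, `|hess (fun x => A x k l) x m n| <= K].
Hypothesis bcp : bounded_convex_polygonal nu off.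
Local Notation dist k x := (dot (nu k) x - off k).

Let dA i j (x : V) : differentiable (fun y => A y i j) x := (A2 i j (I : setT x)).1.
Let bD : bounded_set D. Proof. by case: bcp. Qed.
Let nu1 k : dot (nu k) (nu k) = 1. Proof. by case: bcp => + _ _ _; exact. Qed.
Let pD k x : D x -> off k < dot (nu k) x. Proof. exact. Qed.

(** The ridge barrier in terms of single distances: on the face [j] the distance to [j] vanishes and
    the lower bound involves the distance to [k] alone. For [j = k] the zero function serves, so
    that sums may run over all pairs. *)
Lemma pair_barrier (j k : 'I_N) : exists2 C : R, 0 < C & forall eps : R, 0 < eps <= 1 ->
  exists B : V -> R, [/\ C2 (polygon nu (fun k => off k - eps)) B,
    forall x, (forall l, off l <= dot (nu l) x) -> 0 <= B x <= C / (dist j x + eps),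
    forall x, (forall l, off l <= dot (nu l) x) -> dot (nu j) x = off j -> j != k ->
      (2 * C)^-1 / (dist k x + eps) <= B x &
    forall x, D x -> `|elliptic_op A B x| <= C / (dist j x + eps) ^+ 2].
Proof.
have [jk|jk] := eqVneq j k.
  exists 1 => // eps /andP[e0 _]; exists (cst 0).
  have pos x : (forall l, off l <= dot (nu l) x) -> 0 <= dist j x + eps.
    by move=> H; rewrite addr_ge0 ?subr_ge0// ltW.
  split; [exact: C2_cst| |by []|].
  - by move=> x /pos H; rewrite lexx /= mul1r invr_ge0.
  - move=> x Dx; rewrite (elliptic_op_cst dA 0 Dx) normr0 mul1r invr_ge0 exprn_ge0//.
    by apply: pos => l; exact/ltW/pD.
have [C C0 HC] := ridge_barrier A2 c0 Aell Aup bD AD (nu1 j) (nu1 k) (dot_normals_lt1 bcp jk)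
  (@pD j) (@pD k).
exists C => // eps he; have [B [B1 B2 B3]] := HC eps he; have /andP[e0 _] := he.
exists B; split.
- by apply: C2_sub B1 => x H; split; exact: H.
- move=> x H; have /andP[h1 h2] := B2 x (H j) (H k).
  have pj : 0 <= dist j x by rewrite subr_ge0.
  have pk : 0 <= dist k x by rewrite subr_ge0.
  move: (dist j x) (dist k x) pj pk h1 h2 => u v u0 v0 h1 h2; apply/andP; split.
    by rewrite (le_trans _ h1)// divr_ge0 ?invr_ge0 ?(ltW C0)// !addr_ge0// ltW.
  have ue : 0 < u + eps by rewrite ltr_wpDl.
  have ve : 0 < v + eps by rewrite ltr_wpDl.
  by rewrite (le_trans h2)// ler_pM2l// lef_pV2 ?posrE// ?lerDl ?(ltW ve)// addr_gt0.
- move=> x H xj jk'; have /andP[h1 _] := B2 x (H j) (H k).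
  apply: (le_trans _ h1); have pk : 0 <= dist k x by rewrite subr_ge0.
  rewrite xj subrr add0r; move: (dist k x) pk {h1} => v v0.
  have ve : 0 < v + eps by rewrite ltr_wpDl.
  have -> : (2 * C)^-1 / (v + eps) = C^-1 / (2 * (v + eps)) by field; rewrite !gt_eqF.
  rewrite ler_wpM2l ?invr_ge0 ?(ltW C0)// lef_pV2 ?posrE ?(addr_gt0 e0 ve) ?mulr_gt0//.
  by rewrite mulrDl mul1r lerD2r lerDr.
- move=> x Dx; apply: (le_trans (B3 x Dx)).
  have pj : 0 < dist j x by rewrite subr_gt0 pD.
  have pk : 0 < dist k x by rewrite subr_gt0 pD.
  move: (dist j x) (dist k x) pj pk => u v u0 v0.
  rewrite ler_pM2l// lef_pV2 ?posrE ?exprn_gt0 ?addr_gt0//.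
  by rewrite lerXn2r ?nnegrE ?addr_ge0 ?(ltW u0) ?(ltW v0) ?(ltW e0)// lerDl addr_ge0 ?ltW.
Qed.

Variables (tau : 'I_N -> R) (t : nat).
Hypothesis d1 : (1 < d)%N.
Hypothesis dio : forall j, diophantine (tau j) (nu j).
Hypothesis taut : forall j, tau j <= t%:R.
Hypothesis N0 : (0 < N)%N.

(** [Q] and [C] precede [eps] and the trigonometric sum, whose only trace in the estimate is the
    weighted bound [K], not the number of modes. *)
Lemma layer_bound : exists2 Q : R, 0 < Q & exists2 C : R, 0 <= C &
  forall eps : R, 0 < eps <= 1 ->
  forall (I : finType) (a th : I -> R) (m : I -> 'rV[int]_d) (K eta : R) (w : V -> R),
  (forall i, m i != 0) -> \sum_i `|a i| * int_norm1 R (m i) ^+ t.+1 <= K ->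
  C2 D w -> {within closure D, continuous w} ->
  (forall x, D x -> elliptic_op A w x = 0) ->
  (forall x, boundary D x -> `|w x -
     \sum_i a i * cos (2 * pi * dot (map_mx intr (m i)) (eps^-1 *: x) + th i)| <= eta) ->
  forall x, D x -> `|w x| <= eta + C * (K + 1) *
    (eps * ln (Q / eps) + \sum_k eps / (dist k x + eps)).
Proof.
have /choice[Cc HCc] k : exists C : R, 0 <= C /\ forall (m : 'rV[int]_d) (th eps : R), m != 0 -> 0 < eps ->
  exists F : V -> R, [/\ C2 setT F,
    forall x, off k <= dot (nu k) x ->
      `|F x| <= C * int_norm1 R m ^+ t.+1 * (eps / (dist k x + eps)),
    forall x, dot (nu k) x = off k -> F x = cos (2 * pi * dot (map_mx intr m) (eps^-1 *: x) + th) &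
    forall x, D x -> `|elliptic_op A F x| <=
      C * int_norm1 R m ^+ t.+1 * (eps / (dist k x + eps) ^+ 2)].
  have [C ? ?] := phase_corrector A2 c0 Aell Aup bD AD d1 (nu1 k) (@pD k) (dio k) (taut k).
  by exists C.
have /choice[q Hq] k : exists q : R * R, (0 < q.1 /\ 0 < q.2) /\ forall eps : R, 0 < eps <= 1 ->
    exists S0 : V -> R, [/\ C2 [set x | off k - eps < dot (nu k) x] S0,
      forall x, off k <= dot (nu k) x -> 0 <= S0 x <= ln (q.2 / eps) &
      forall x, D x -> q.1 / (dist k x + eps) ^+ 2 <= elliptic_op A S0 x].
  by have [q ? ?] := log_barrier A2 c0 Aell bD AD (nu1 k) (@pD k); exists q.
have /choice[Cr HCr] (jk : 'I_N * 'I_N) : exists C : R, 0 < C /\ forall eps : R, 0 < eps <= 1 ->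
  exists B : V -> R, [/\ C2 (polygon nu (fun k => off k - eps)) B,
    forall x, (forall l, off l <= dot (nu l) x) -> 0 <= B x <= C / (dist jk.1 x + eps),
    forall x, (forall l, off l <= dot (nu l) x) -> dot (nu jk.1) x = off jk.1 -> jk.1 != jk.2 ->
      (2 * C)^-1 / (dist jk.2 x + eps) <= B x &
    forall x, D x -> `|elliptic_op A B x| <= C / (dist jk.1 x + eps) ^+ 2].
  by have [C ? ?] := pair_barrier jk.1 jk.2; exists C.
(* In the strength [al] of the logarithmic barriers, [C] pays for the correctors, [C3] for the
   operator on the pair barriers, and 1 for strictness. *)
pose C := \sum_k Cc k; pose C3 := \sum_jk 2 * C * Cr jk ^+ 2; pose al := C + C3 + 1.
(* The summand 1 in [Q] keeps [ln (Q / eps)] nonnegative for [eps <= 1]. *)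
pose C4 := \sum_k al / (q k).1; pose Q := 1 + \sum_k (q k).2.
have Cc0 k : 0 <= Cc k by have [] := HCc k.
have CcC k : Cc k <= C by rewrite /C (bigD1 k)//= lerDl sumr_ge0.
have C_0 : 0 <= C by exact: sumr_ge0.
have C30 : 0 <= C3 by apply: sumr_ge0 => jk _; rewrite mulr_ge0 ?sqr_ge0// mulr_ge0.
have al0 : 0 < al by rewrite ltr_pwDr// addr_ge0.
have q1 k : 0 < (q k).1 by have [[]] := Hq k.
have q2 k : 0 < (q k).2 by have [[]] := Hq k.
have C40 : 0 <= C4 by apply: sumr_ge0 => k _; rewrite divr_ge0 ?ltW.
have Q0 : 0 < Q by rewrite ltr_pwDl// sumr_ge0// => k _; exact: ltW.
have qQ k : (q k).2 <= Q.
  by rewrite /Q (bigD1 k)//= addrCA lerDl addr_ge0// sumr_ge0// => l _; exact: ltW.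
exists Q => //; exists (C + C3 + C4); first by rewrite !addr_ge0.
move=> eps he I a th m K eta w m0 aK cw ctw Lw wb.
have /andP[e0 e1] := he.
have /choice[F HF] (ik : I * 'I_N) := (HCc ik.2).2 (m ik.1) (th ik.1) eps (m0 ik.1) e0.
have /choice[S HS] k := (Hq k).2 eps he.
have /choice[B HB] jk := (HCr jk).2 eps he.
(* [K1] is positive even if [K = 0], as the strict inequality requires. *)
pose K1 := K + 1; pose U := polygon nu (fun k => off k - eps).
have oU : open U by exact: polygon_open.
have DU : closure D `<=` U.
  by move=> x /closure_polygon H k; rewrite (lt_le_trans _ (H k))// ltrBlDr ltrDl.
have DU' : D `<=` U by apply: subset_trans DU; exact: subset_closure.
have K0 : 0 <= K by apply: le_trans aK; apply: sumr_ge0 => i _; rewrite mulr_ge0// exprn_ge0// int_norm1_ge0.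
have K10 : 0 < K1 by rewrite ltr_pwDr.
pose Phi x := \sum_ik a ik.1 * F ik x.
pose WS x := \sum_k (K1 * eps * al / (q k).1) * S k x.
(* With this weight the lower bound of a pair barrier on the face [j] becomes exactly
   [C * K1 * eps / (d_k + eps)]. *)
pose WB x := \sum_jk (2 * K1 * eps * C * Cr jk) * B jk x.
have b0 jk : 0 <= 2 * K1 * eps * C * Cr jk.
  by rewrite !mulr_ge0 ?(ltW K10) ?(ltW e0)//; have [/ltW] := HCr jk.
have s0 k : 0 <= K1 * eps * al / (q k).1 by rewrite divr_ge0 ?(ltW (q1 k))// !mulr_ge0 ?ltW.
have [cP LP] := elliptic_op_sum A2 (index_enum _) (fun ik : I * 'I_N => a ik.1) oU
  (fun ik => C2_sub (@subsetT _ U) (let: And4 p _ _ _ := HF ik in p)).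
have cS k : C2 U (S k) by have [h _ _] := HS k; apply: C2_sub h => x Ux; exact: Ux.
have [cWS LWS] := elliptic_op_sum A2 (index_enum _) (fun k => K1 * eps * al / (q k).1) oU cS.
have [cWB LWB] := elliptic_op_sum A2 (index_enum _) (fun jk => 2 * K1 * eps * C * Cr jk) oU
  (fun jk => let: And4 p _ _ _ := HB jk in p).
have pos k x : (forall l, off l <= dot (nu l) x) -> 0 < dist k x + eps.
  by move=> H; rewrite ltr_wpDl// subr_ge0.
have y0 k x : (forall l, off l <= dot (nu l) x) -> 0 <= eps / (dist k x + eps).
  by move=> H; rewrite divr_ge0 ?(ltW e0)// ltW// pos.
have M0 i : 0 <= int_norm1 R (m i) ^+ t.+1 by rewrite exprn_ge0// int_norm1_ge0.
have DC x : D x -> forall l, off l <= dot (nu l) x by move=> Dx l; exact/ltW/pD.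
have CK x (y : 'I_N -> R) : (forall k, 0 <= y k) -> x <= C * K * \sum_k y k ->
    x <= C * K1 * \sum_k y k.
  move=> y00 h; rewrite (le_trans h)// ler_wpM2r ?sumr_ge0// ler_wpM2l// lerDl//.
have P0 jk : 0 <= 2 * C * Cr jk ^+ 2 * K1.
  by apply: mulr_ge0 (ltW K10); apply: mulr_ge0 (sqr_ge0 _); exact: mulr_ge0.
have WB1 x : (forall l, off l <= dot (nu l) x) ->
    WB x <= C3 * K1 * \sum_k eps / (dist k x + eps).
  move=> H; rewrite /C3 !mulr_suml; apply: ler_sum => jk _.
  have [Cr0 _] := HCr jk; have [_ + _ _] := HB jk => /(_ x H)/andP[_ h].
  apply: (le_trans (ler_wpM2l (b0 jk) h)).
  have -> : 2 * K1 * eps * C * Cr jk * (Cr jk / (dist jk.1 x + eps)) =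
     2 * C * Cr jk ^+ 2 * K1 * (eps / (dist jk.1 x + eps)).
    by move: (dist jk.1 x + eps) => u; ring.
  rewrite ler_wpM2l//.
  by rewrite (bigD1 jk.1)//= lerDl sumr_ge0// => l _; exact: y0.
have main : forall x, D x -> `|w x - Phi x| <= WS x + WB x + eta.
  pose W : V -> R := WS + WB + cst eta.
  suff : forall x, D x -> `|w x - Phi x| <= W x by [].
  have cW : C2 U W by apply: (C2D oU); [exact: C2D|exact: C2_cst].
  apply: (@comparison _ _ A A2 c c0 Aell D U w Phi W (@polygon_open _ _ _ _ _) bD oU DU cw ctw cP cW Lw).
  - move=> x Dx; have Ux := DU' _ Dx; have H := DC x Dx.
    pose z k := eps / (dist k x + eps) ^+ 2.
    have z0 k : 0 < z k by rewrite divr_gt0// exprn_gt0// pos.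
    have Z0 : 0 < \sum_k z k.
      rewrite (bigD1 (Ordinal N0))//= ltr_pwDl// sumr_ge0// => l _; exact: ltW.
    have -> : elliptic_op A W x = elliptic_op A WS x + elliptic_op A WB x.
      rewrite /W (elliptic_opD dA oU (C2D oU cWS cWB) (@C2_cst _ _ U eta) Ux).
      by rewrite (elliptic_opD dA oU cWS cWB Ux) (elliptic_op_cst dA eta Ux) addr0.
    have E1 : `|elliptic_op A Phi x| <= C * K1 * \sum_k z k.
      apply: CK => [k|]; first exact: ltW.
      rewrite LP//; apply: (sum_pair_bound (B := Cc) C_0 M0 _ CcC aK) => [k|ik]; first exact: ltW.
      by have [_ _ _ h] := HF ik; exact: h.
    have E2 : K1 * al * \sum_k z k <= elliptic_op A WS x.
      rewrite LWS// mulr_sumr; apply: ler_sum => k _.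
      have [_ _ /(_ _ Dx) h] := HS k; apply: le_trans (ler_wpM2l (s0 k) h).
      rewrite le_eqVlt; apply/orP; left; apply/eqP; rewrite /z.
      move: (dist k x + eps) (gt_eqF (pos k x H)) (gt_eqF (q1 k)) => u /negbT u1 /negbT q10.
      by field; rewrite u1 q10.
    have E3 : `|elliptic_op A WB x| <= K1 * C3 * \sum_k z k.
      rewrite LWB// (le_trans (ler_norm_sum _ _ _))// [K1 * C3]mulrC /C3 !mulr_suml.
      apply: ler_sum => jk _; have [Cr0 _] := HCr jk; have [_ _ _ /(_ _ Dx) h] := HB jk.
      rewrite normrM (ger0_norm (b0 jk)); apply: (le_trans (ler_wpM2l (b0 jk) h)).
      have -> : 2 * K1 * eps * C * Cr jk * (Cr jk / (dist jk.1 x + eps) ^+ 2) =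
         2 * C * Cr jk ^+ 2 * K1 * z jk.1.
        by rewrite /z; move: (dist jk.1 x + eps) => u; ring.
      rewrite ler_wpM2l//.
      by rewrite (bigD1 jk.1)//= lerDl sumr_ge0// => l _; exact: ltW.
    apply: (le_lt_trans E1); have := E3; rewrite ler_norml => /andP[E4 _].
    apply: lt_le_trans (lerD E2 E4); rewrite -mulrBl ltr_pM2r// mulrC -mulrBr ltr_pM2l//.
    by rewrite /al addrAC addrK ltrDl.
  - move=> x /[dup] bx /boundary_polygon [H [j xj]].
    have -> : W x = WS x + WB x + eta by [].
    (* On the face [j] the correctors of [j] reproduce the data exactly; only those of the other
       faces leave an error. *)
    pose y k := if k == j then 0 else eps / (dist k x + eps).
    have yy0 k : 0 <= y k by rewrite /y; case: eqP => // _; exact: y0.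
    pose g (ik : I * 'I_N) := if ik.2 == j then 0 else F ik x.
    have E1 : `|\sum_ik a ik.1 * g ik| <= C * K1 * \sum_k y k.
      apply: CK => //; apply: (sum_pair_bound (B := Cc) C_0 M0 yy0 CcC aK) => ik.
      rewrite /g /y; case: eqP => _; first by rewrite normr0 mulr0.
      by have [_ h _ _] := HF ik; exact: h.
    have E2 : Phi x = \sum_i a i * cos (2 * pi * dot (map_mx intr (m i)) (eps^-1 *: x) + th i) +
        \sum_ik a ik.1 * g ik.
      rewrite /Phi !sum_pair -big_split; apply: eq_bigr => i _ /=.
      rewrite (bigD1 j)//= [in RHS](bigD1 j)//= {1}/g eqxx mulr0 add0r.
      congr (_ + _); first by have [_ _ h _] := HF (i, j); rewrite h.
      by apply: eq_bigr => k /negbTE kj; rewrite /g /= kj.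
    have E3 : C * K1 * \sum_k y k <= WB x.
      have Bx jk : 0 <= B jk x by have [_ /(_ x H)/andP[]] := HB jk.
      rewrite /WB sum_pair [leRHS](bigD1 j)//= ler_wpDr ?sumr_ge0//.
        by move=> l _; apply: sumr_ge0 => k _; rewrite mulr_ge0.
      rewrite mulr_sumr; apply: ler_sum => k _; rewrite /y; case: eqVneq => [_|kj].
        by rewrite mulr0 mulr_ge0.
      have [_ _ + _] := HB (j, k) => /(_ x H xj); rewrite eq_sym kj => /(_ isT) h.
      apply: le_trans (ler_wpM2l (b0 (j, k)) h) => /=; have [Cr0 _] := HCr (j, k).
      rewrite le_eqVlt; apply/orP; left; apply/eqP.
      move: (dist k x + eps) (gt_eqF (pos k x H)) (gt_eqF Cr0) => u /negbT u1 /negbT Cr1.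
      by field; rewrite u1 Cr1.
    have E4 : 0 <= WS x.
      by apply: sumr_ge0 => k _; rewrite mulr_ge0//; have [_ /(_ x (H k))/andP[]] := HS k.
    have := wb x bx; rewrite E2 opprD addrA; move: (\sum_i _) => u hu.
    rewrite (le_trans (ler_normB _ _))// [leRHS]addrC lerD//.
    by rewrite (le_trans E1)// (le_trans E3)// lerDr.
move=> x Dx; have H := DC x Dx.
have E1 : `|Phi x| <= C * K1 * \sum_k eps / (dist k x + eps).
  apply: CK => [k|]; first exact: y0.
  apply: (sum_pair_bound (B := Cc) C_0 M0 _ CcC aK) => [k|ik]; first exact: y0.
  by have [_ h _ _] := HF ik; exact: h.
have E2 : WS x <= K1 * C4 * (eps * ln (Q / eps)).
  rewrite /C4 [K1 * _]mulrC !mulr_suml; apply: ler_sum => k _.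
  have [_ /(_ x (H k))/andP[_ h] _] := HS k.
  apply: (le_trans (ler_wpM2l (s0 k) h)).
  have h2 : ln ((q k).2 / eps) <= ln (Q / eps).
    by rewrite ler_ln ?posrE ?divr_gt0// ler_pM2r ?invr_gt0.
  apply: (le_trans (ler_wpM2l (s0 k) h2)).
  by rewrite le_eqVlt; apply/orP; left; apply/eqP; move: (ln _) ((q k).1^-1) => u v; ring.
have E3 := WB1 x H.
have E4 : 0 <= eps * ln (Q / eps).
  rewrite mulr_ge0 ?(ltW e0)// ln_ge0// ler_pdivlMr// mul1r (le_trans e1)// /Q lerDl.
  by rewrite sumr_ge0// => k _; exact: ltW.
have Y0 : 0 <= \sum_k eps / (dist k x + eps) by apply: sumr_ge0 => k _; exact: y0.
have E5 : `|w x| <= `|Phi x| + (WS x + WB x + eta).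
  by rewrite -(subrK (Phi x) (w x)) (le_trans (ler_normD _ _))// addrC lerD2l main.
apply: (le_trans E5); move: (\sum_k _) Y0 E1 E3 (eps * _) E4 E2 => Y Y0 E1 E3 L L0 E2.
apply: (@le_trans _ _ (C * K1 * Y + (K1 * C4 * L + C3 * K1 * Y + eta))).
  by rewrite !lerD.
have h1 := mulr_ge0 (mulr_ge0 (addr_ge0 C_0 C30) (ltW K10)) L0.
have h2 := mulr_ge0 (mulr_ge0 C40 (ltW K10)) Y0.
have -> : C * K1 * Y + (K1 * C4 * L + C3 * K1 * Y + eta) = eta + (C + C3 + C4) * (K + 1) * (L + Y)
   - ((C + C3) * K1 * L + C4 * K1 * Y) by rewrite /K1; ring.
by rewrite gerBl addr_ge0.
Qed.

End layer_bound.

(** * From layer profiles to powers of the distance *)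

Section power_bounds.
Context (R : realType).
Implicit Types (eps s Q y : R).

(** From [ln y <= y^r / r] with [r = 1 - s] and [y = Q / eps]. *)
Lemma mul_ln_le_powR eps s Q : 0 < eps -> 0 < Q -> s < 1 ->
  eps * ln (Q / eps) <= Q `^ (1 - s) / (1 - s) * eps `^ s.
Proof.
move=> e0 Q0 s1; have r0 : 0 < 1 - s by rewrite subr_gt0.
have Qe : 0 < Q / eps by rewrite divr_gt0.
have H : ln (Q / eps) <= (Q / eps) `^ (1 - s) / (1 - s).
  rewrite ler_pdivlMr// mulrC -ln_powR.
  by rewrite ltW// ln_sublinear// powR_gt0.
apply: (le_trans (ler_wpM2l (ltW e0) H)).
have -> : (Q / eps) `^ (1 - s) = Q `^ (1 - s) * eps `^ (s - 1).
  rewrite powRM ?invr_ge0 ?(ltW Q0) ?(ltW e0)// -powR_inv1 ?(ltW e0)// -powRrM.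
  by rewrite mulN1r opprB.
have -> : eps `^ s = eps * eps `^ (s - 1).
  rewrite -[X in X * _]powRr1 ?(ltW e0)// -powRD; last by rewrite (gt_eqF e0) implybT.
  by rewrite addrC subrK.
by rewrite le_eqVlt; apply/orP; left; apply/eqP; field; rewrite gt_eqF.
Qed.

(** The profile is at most 1, hence at most its own power of exponent [s]; then [eps] is dropped
    from the denominator. *)
Lemma layer_le_powR eps s y : 0 < eps -> 0 <= s <= 1 -> 0 < y ->
  eps / (y + eps) <= eps `^ s * y `^ (- s).
Proof.
move=> e0 /andP[s0 s1] y0.
have ye : 0 < y + eps by rewrite addr_gt0.
have r0 : 0 < eps / (y + eps) by rewrite divr_gt0.
have r1 : eps / (y + eps) <= 1 by rewrite ler_pdivrMr// mul1r lerDr ltW.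
have -> : eps `^ s * y `^ (- s) = (eps / y) `^ s.
  by rewrite powRM ?invr_ge0 ?(ltW e0) ?(ltW y0)// -powR_inv1 ?(ltW y0)// -powRrM mulN1r.
apply: (@le_trans _ _ ((eps / (y + eps)) `^ s)); first by rewrite ger1_powR ?r0.
rewrite ge0_ler_powR ?nnegrE ?divr_ge0 ?(ltW e0) ?(ltW y0) ?(ltW ye)//.
by rewrite ler_pM2l// lef_pV2 ?posrE// lerDl ltW.
Qed.

Lemma powR_sum_le (N : nat) (y : 'I_N -> R) (p : R) : 0 <= p -> (forall k, 0 <= y k) ->
  (1 + \sum_k y k) `^ p <= N.+1%:R `^ p * (1 + \sum_k y k `^ p).
Proof.
move=> p0 y0; pose z := \big[Num.max/1]_k y k.
have S0 k : 0 <= y k `^ p by exact: powR_ge0.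
have zp : z `^ p <= 1 + \sum_k y k `^ p.
  rewrite /z; elim/big_ind: _ => [|u v hu hv|k _].
  - by rewrite powR1 lerDl sumr_ge0.
  - by case: (leP u v).
  - by rewrite (bigD1 k)//= addrCA lerDl addr_ge0// sumr_ge0.
have z1 : 1 <= z by exact: bigmax_ge_id.
have yz k : y k <= z by exact: le_bigmax.
apply: (@le_trans _ _ ((N.+1%:R * z) `^ p)).
  rewrite ge0_ler_powR ?nnegrE ?mulr_ge0 ?addr_ge0 ?sumr_ge0 ?(le_trans _ z1)//.
  rewrite -natr1 mulrDl mul1r addrC lerD//.
  rewrite (le_trans (ler_sum _ (fun k _ => yz k)))//.
  by rewrite sumr_const card_ord -[leLHS]mulr_natl.
by rewrite powRM ?(le_trans _ z1)// ler_wpM2l ?powR_ge0.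
Qed.

End power_bounds.

(** * The pointwise estimate for real boundary data *)

Section real_difference.
Context (R : realType) (d N : nat).
Local Notation V := 'rV[R]_d.
Variables (A : V -> 'M[R]_d) (nu : 'I_N -> V) (off : 'I_N -> R).
Local Notation D := (polygon nu off).
Local Notation dist k x := (dot (nu k) x - off k).
Local Notation cube := (@unit_cube R d).

(** The approximability at every accuracy is there to make [h] measurable; the estimate itself
    concerns one given approximation. *)
Lemma torus_mean_approximation (h : V -> R) :
  (forall eta : R, 0 < eta -> exists (I : finType) (a0 : R) (a th : I -> R) (m : I -> 'rV[int]_d),
    (forall i, m i != 0) /\
    forall x, `|h x - a0 - \sum_i a i * cos (2 * pi * dot (map_mx intr (m i)) x + th i)| <= eta) ->
  forall (eta : R) (I : finType) (a0 : R) (a th : I -> R) (m : I -> 'rV[int]_d),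
    (forall i, m i != 0) ->
    (forall x, `|h x - a0 - \sum_i a i * cos (2 * pi * dot (map_mx intr (m i)) x + th i)| <= eta) ->
  `|a0 - Rintegral (lebesgue_tuple R d) cube (fun t => h (rV_of_tuple t))| <= eta.
Proof.
move=> H.
have E (I : finType) (a th : I -> R) (m : I -> 'rV[int]_d) (t : d.-tuple R) :
    \sum_i a i * cos (2 * pi * dot (map_mx intr (m i)) (rV_of_tuple t) + th i) =
    \sum_i a i * cos (phase (fun j => m i 0 j) (th i) t).
  apply: eq_bigr => i _; rewrite /phase dot_rV_of_tuple.
  by under eq_bigr do rewrite mxE.
have mh : measurable_fun setT (fun t : d.-tuple R => h (rV_of_tuple t)).
  apply: measurable_uniform_limit => eta eta0.
  have [I [a0 [a [th [m [_ Hh]]]]]] := H _ eta0.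
  exists (fun t => a0 + \sum_i a i * cos (phase (fun j => m i 0 j) (th i) t)).
    apply: measurable_funD => //; apply: measurable_sum => k.
    by apply: measurable_funM => //; exact: measurable_cos_phase.
  by move=> t; rewrite opprD addrA -E.
move=> eta I a0 a th m m0 Hh.
apply: (torus_mean_error (a := a) (th := th) (m := fun i j => m i 0 j) mh).
  move=> i; apply: contrapT => nj; have := m0 i; apply/negP; rewrite negbK.
  apply/eqP/rowP => j; rewrite mxE; apply: contrapT => /eqP mj; apply: nj; by exists j.
by move=> t; rewrite -E.
Qed.

Variables (tau : 'I_N -> R) (t : nat).
Hypothesis d1 : (1 < d)%N.
Hypothesis N0 : (0 < N)%N.
Hypothesis bcp : bounded_convex_polygonal nu off.
Hypothesis dio : forall j, diophantine (tau j) (nu j).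
Hypothesis taut : forall j, tau j <= t%:R.
Hypothesis Aell : uniformly_elliptic A.
Hypothesis AC : forall i j, class_C 2 setT (fun x => A x i j).

Lemma real_difference_bound (h : V -> R) (s : R) : 0 < s < 1 ->
  class_C (t.+1 + 2 * d) setT h -> Zd_periodic h ->
  exists2 K : R, 0 <= K & forall eps : R, 0 < eps <= 1 -> forall u v : V -> R,
    real_dirichlet_solution A D (fun x => h (eps^-1 *: x)) u ->
    real_dirichlet_solution A D
      (fun=> Rintegral (lebesgue_tuple R d) cube (fun t => h (rV_of_tuple t))) v ->
    forall x, D x -> `|u x - v x| <= K * eps `^ s * (1 + \sum_k dist k x `^ (- s)).
Proof.
move=> /andP[s0 s1] ch ph.
have [_ _ bD _] := bcp; have oD := @polygon_open _ _ _ nu off.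
have A2 k l : C2 setT (fun x => A x k l) by apply: class_C2_C2 => //; exact: openT.
have dA i j (x : V) : differentiable (fun y => A y i j) x := (@A2 i j x I).1.
have [c c0 Aq] := Aell.
have Alo x (xi : V) : c^-1 * dot xi xi <= qA A x xi xi by rewrite qA_diag; have /andP[] := Aq x xi.
have Aup x (xi : V) : qA A x xi xi <= c * dot xi xi by rewrite qA_diag; have /andP[] := Aq x xi.
have AD k l := class_C2_bounded bD (AC k l).
have [Q Q0 [C C0 HC]] := layer_bound A2 c0 Alo Aup AD bcp d1 dio taut N0.
have [K K0 HK] := trig_approximation (ltnW d1) (ltn0Sn t) ch ph.
pose B := C * (K + 1); have B0 : 0 <= B by rewrite mulr_ge0// addr_ge0.
pose q := Q `^ (1 - s) / (1 - s).
have q0 : 0 <= q by rewrite divr_ge0 ?powR_ge0// subr_ge0 ltW.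
exists (2 + B * q + B) => [|eps he u v [cu ctu Lu bu] [cv ctv Lv bv] x Dx].
  by rewrite !addr_ge0// mulr_ge0.
have /andP[e0 e1] := he.
have approx eta (eta0 : 0 < eta) :
    exists (I : finType) (a0 : R) (a th : I -> R) (m : I -> 'rV[int]_d),
    (forall i, m i != 0) /\
    forall x, `|h x - a0 - \sum_i a i * cos (2 * pi * dot (map_mx intr (m i)) x + th i)| <= eta.
  have [J [a0 [a [th [m [m0 _ Hh]]]]]] := HK eta eta0.
  by exists J, a0, a, th, m.
(* Accuracy [eps] is harmless since [eps <= eps^s]. One [eps] from the approximation and one from
   replacing [a0] by the mean make up the boundary error [2 * eps]. *)
have [J [a0 [a [th [m [m0 aK Hh]]]]]] := HK eps e0.
have mean := torus_mean_approximation approx m0 Hh.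
set mu := Rintegral _ _ _ in mean bv.
pose w := u + cst (- 1) * v.
have wE y : w y = u y - v y by rewrite -[v y]mul1r -mulNr.
have cu2 := class_C2_C2 oD cu; have cv2 := class_C2_C2 oD cv.
have cv3 : C2 D (cst (- 1) * v) by apply: (C2M oD) => //; exact: C2_cst.
have cw : C2 D w by exact: C2D.
have ctw : {within closure D, continuous w}.
  move=> y; apply: cvgD; first exact: ctu.
  by apply: cvgM; [exact: cvg_cst|exact: ctv].
have Lw y : D y -> elliptic_op A w y = 0.
  move=> Dy; rewrite (elliptic_opD dA oD cu2 cv3 Dy) (elliptic_opZ dA oD _ cv2 Dy).
  by rewrite Lu// Lv// mulr0 addr0.
have wb y : boundary D y -> `|w y -
     \sum_i a i * cos (2 * pi * dot (map_mx intr (m i)) (eps^-1 *: y) + th i)| <= 2 * eps.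
  move=> by_; rewrite wE bu// bv//; have := Hh (eps^-1 *: y).
  move: (\sum_i _) (h _) mean => S hy mean h1.
  have -> : hy - mu - S = (hy - a0 - S) + (a0 - mu) by ring.
  by rewrite mulrDl mul1r (le_trans (ler_normD _ _))// lerD.
have := HC eps he J a th m K (2 * eps) w m0 aK cw ctw Lw wb x Dx.
rewrite wE => /le_trans; apply; rewrite -/B.
pose E := eps `^ s; pose Y := \sum_k dist k x `^ (- s).
have E0 : 0 <= E by exact: powR_ge0.
have Y0 : 0 <= Y by apply: sumr_ge0 => k _; exact: powR_ge0.
have h1 : eps <= E by rewrite ger1_powR ?e0// ltW.
have h2 : eps * ln (Q / eps) <= q * E by exact: mul_ln_le_powR.
have h3 : \sum_k eps / (dist k x + eps) <= E * Y.
  rewrite mulr_sumr; apply: ler_sum => k _; apply: layer_le_powR => //.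
    by rewrite (ltW s0) ltW.
  by rewrite subr_gt0; exact: Dx.
rewrite -/E -/Y; move: (eps * ln _) (\sum_k _ / _) h2 h3 => u1 u2 h2 h3.
apply: (@le_trans _ _ (2 * E + B * (q * E + E * Y))).
  by rewrite lerD ?ler_wpM2l ?lerD.
have P1 := mulr_ge0 B0 E0; have P2 := mulr_ge0 E0 Y0.
have P3 := mulr_ge0 (mulr_ge0 B0 q0) P2.
have -> : (2 + B * q + B) * E * (1 + Y) = 2 * E + B * (q * E + E * Y) + (B * E + 2 * (E * Y) + B * q * (E * Y)).
  by ring.
by rewrite lerDl !addr_ge0// mulr_ge0.
Qed.

End real_difference.

(** * Integrability of the pointwise bound *)

Section polygon_powers.
Context (R : realType) (n N : nat) (nu : 'I_N -> 'rV[R]_n.+1) (off : 'I_N -> R).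
Local Notation D := (polygon nu off).
Local Notation dist k x := (dot (nu k) x - off k).
Local Notation leb := (lebesgue_tuple R n.+1).
Local Open Scope ereal_scope.

(** By [powR_sum_le] the power [p] falls on each term, giving exponents [- (s * p)] that are
    integrable across each hyperplane; the constant 1 is covered by the indicator of a box
    containing the domain. *)
Lemma polygon_power_majorant (s p : R) : bounded_set D ->
  (forall k, (nu k 0 ord0 != 0)%R) -> (0 <= s)%R -> (0 < p)%R -> (s * p < 1)%R ->
  exists G : n.+1.-tuple R -> \bar R, exists2 M : R, (0 <= M)%R &
    [/\ measurable_fun setT G, forall t, 0 <= G t, \int[leb]_t G t <= M%:E &
    forall t, D (rV_of_tuple t) ->
      (((1 + \sum_k dist k (rV_of_tuple t) `^ (- s)) `^ p)%R)%:E <= G t].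
Proof.
move=> [B [_ HB]] nu0 s0 p0 sp.
pose b : R := (`|B| + 1)%R.
have b0 : (0 <= b)%R by rewrite addr_ge0.
have Db t : D (rV_of_tuple t) -> cbox b t.
  move=> Dt i; have : (`|rV_of_tuple t| <= b)%R.
    by apply: HB => //; rewrite /b (le_lt_trans (ler_norm B))// ltrDl.
  by apply: le_trans; have := coord_le_normrV (rV_of_tuple t) i; rewrite mxE.
have sp01 : (0 <= s * p < 1)%R by rewrite sp mulr_ge0// ltW.
have /choice[G HG] : forall k, exists G : n.+1.-tuple R -> \bar R, [/\ measurable_fun setT G,
    forall t, 0 <= G t, \int[leb]_t G t < +oo &
    forall t, cbox b t -> (0 < dist k (rV_of_tuple t))%R ->
      ((dist k (rV_of_tuple t)) `^ (- (s * p)))%:E <= G t].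
  by move=> k; exact: halfspace_power_majorant.
have mG k : measurable_fun setT (G k) by have [] := HG k.
have G0 k t : 0 <= G k t by have [] := HG k.
have mc := @measurable_cbox R n.+1 b.
pose c0 : R := (N.+1%:R `^ p)%R; have c00 : (0 <= c0)%R by exact: powR_ge0.
pose i1 t : \bar R := (\1_(@cbox R n.+1 b) t : R)%:E.
have mi1 : measurable_fun setT i1 by apply/measurable_EFinP; exact: measurable_indic.
have i10 t : 0 <= i1 t by rewrite lee_fin.
have mS : measurable_fun setT (fun t => \sum_k G k t) by apply: emeasurable_sum.
have S0 t : 0 <= \sum_k G k t by apply: sume_ge0.
pose F t := c0%:E * (i1 t + \sum_k G k t).
have mF : measurable_fun setT F.
  by apply: measurable_funeM; apply: emeasurable_funD.
have F0 t : 0 <= F t by rewrite mule_ge0// adde_ge0.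
have Foo : \int[leb]_t F t < +oo.
  rewrite ge0_integralZl_EFin//; last 2 first.
  - by move=> t _; rewrite adde_ge0.
  - by apply: emeasurable_funD.
  rewrite ge0_integralD// ge0_integral_sum//.
  rewrite lte_mul_pinfty// lte_add_pinfty//.
    rewrite integral_indic// setIT [X in X < _](lebesgue_cbox n.+1 b0) ltry//.
  by apply: lte_sum_pinfty => k _; have [] := HG k.
have If : \int[leb]_t F t \is a fin_num.
  by rewrite ge0_fin_numE// integral_ge0.
exists F, (fine (\int[leb]_t F t)); first by rewrite fine_ge0// integral_ge0.
split => //; first by rewrite fineK.
move=> t Dt; have tb := Db _ Dt.
apply: (@le_trans _ _ (c0%:E * (1%:E + \sum_k ((dist k (rV_of_tuple t) `^ (- (s * p)))%R)%:E))).
  rewrite sumEFin -EFinD -EFinM lee_fin.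
  rewrite (le_trans (powR_sum_le (ltW p0) _))//; first by move=> k; exact: powR_ge0.
  by under eq_bigr do rewrite -powRrM mulNr.
rewrite lee_wpmul2l ?lee_fin// leeD//.
  by rewrite /i1 indicE mem_set.
apply: lee_sum => k _; have [_ _ _] := HG k; apply=> //.
by rewrite subr_gt0; exact: Dt.
Qed.

End polygon_powers.

Lemma normc_le (R : realType) (z : R[i]) :
  ComplexField.Normc.normc z <= `|complex.Re z| + `|complex.Im z|.
Proof.
case: z => a b /=.
rewrite -[leRHS]ger0_norm ?addr_ge0// -sqrtr_sqr ler_wsqrtr//.
by rewrite sqrrD !real_normK ?num_real// addrAC lerDl mulrn_wge0// mulr_ge0.
Qed.

Theorem theorem1p2 (R : realType) (d : nat) (hd : (2 <= d)%N)
    (N : nat) (tau : 'I_N -> R) :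
  exists k : nat,
  forall (nu : 'I_N -> 'rV[R]_d) (c : 'I_N -> R) (alpha : R)
    (A : 'rV[R]_d -> 'M[R]_d) (g : 'rV[R]_d -> R[i]),
  bounded_convex_polygonal nu c ->
  (forall j, diophantine (tau j) (nu j)) ->
  0 < alpha ->
  is_max_dihedral_angle nu c (pi / (1 + alpha)) ->
  uniformly_elliptic A ->
  Zd_periodic g ->
  (forall i j, class_C k [set: 'rV[R]_d] (fun x => A x i j)) ->
  class_C k [set: 'rV[R]_d] (fun x => complex.Re (g x)) ->
  class_C k [set: 'rV[R]_d] (fun x => complex.Im (g x)) ->
  forall p delta : R, 1 <= p -> 0 < delta ->
  exists C : R,
  forall eps : R, 0 < eps <= 1 ->
  forall u_eps u_0 : 'rV[R]_d -> R[i],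
  dirichlet_solution A (polygon nu c) (fun x => g (eps^-1 *: x)) u_eps ->
  dirichlet_solution A (polygon nu c) (fun=> torus_mean g) u_0 ->
  (Lp_norm p (polygon nu c) (fun x => u_eps x - u_0 x)%R
     <= (C * eps `^ (Num.min (gamma_exponent d alpha) p^-1 - delta))%:E)%E.
Proof.
case: d hd => // n hd.
(* One integer above all the Diophantine exponents. *)
pose t := (\sum_j (Num.truncn (tau j)).+1)%N.
have taut j : tau j <= t%:R.
  by rewrite (le_trans (ltW (truncnS_gt _)))// ler_nat /t (bigD1 j)//= leq_addr.
(* A corrector loses [t + 1] powers of the frequency; twice the dimension more derivatives make the
   sum over frequencies converge. *)
exists (t.+1 + 2 * n.+1)%N.
move=> nu c alpha A g bcp dio alpha0 ang ell pg AC gRe gIm p delta p1 delta0.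
have N0 : (0 < N)%N by have [[j _] _] := ang; exact: leq_ltn_trans (ltn_ord j).
have [_ _ bD _] := bcp.
have p0 : 0 < p by exact: lt_le_trans p1.
(* The second entry keeps [s] positive when [delta >= p^-1]; both entries lie strictly below
   [p^-1]. *)
pose s : R := Num.max (p^-1 - delta) (p^-1 / 2).
have ip0 : 0 < p^-1 by rewrite invr_gt0.
have ip1 : p^-1 <= 1 by rewrite invf_le1.
have s0 : 0 < s by rewrite lt_max divr_gt0// orbT.
have sp : s < p^-1.
  by rewrite gt_max ltrBlDr ltrDl delta0 /= ltr_pdivrMr// ltr_pMr// ltr1n.
have AC2 i j : class_C 2 setT (fun x => A x i j).
  by apply: class_C_le (AC i j); rewrite addSn ltnS (leq_trans _ (leq_addl _ _))// muln_gt0.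
have s01 : 0 < s < 1 by rewrite s0 (lt_le_trans sp).
have [K1 K10 H1] := real_difference_bound hd N0 bcp dio taut ell AC2 s01 gRe
  (fun x m => congr1 _ (pg x m)).
have [K2 K20 H2] := real_difference_bound hd N0 bcp dio taut ell AC2 s01 gIm
  (fun x m => congr1 _ (pg x m)).
(* The Diophantine condition at the first unit vector; [lebesgue_slab] slices along this
   coordinate. *)
have nu0 k : nu k 0 ord0 != 0.
  have [_ [C C0 HC]] := dio k; pose m : 'rV[int]_n.+1 := delta_mx 0 ord0.
  have m0 : m != 0 by apply/eqP => /matrixP/(_ 0 ord0); rewrite !mxE.
  have := HC m m0; apply: contraTneq => nk.
  rewrite /dot big1 ?normr0 => [|i _].
    by rewrite -leNgt mulr_ge0 ?powR_ge0// ltW.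
  by rewrite !mxE eqxx; case: eqVneq => [->|_]; rewrite ?nk ?mulr0 ?mul0r.
have sp1 : s * p < 1 by rewrite -ltr_pdivlMr// div1r.
have [G [M M0 [mG G0 GM DG]]] := polygon_power_majorant bD nu0 (ltW s0) p0 sp1.
exists ((K1 + K2) * M `^ p^-1) => eps he u_eps u_0 [uRe uIm] [vRe vIm].
have /andP[e0 e1] := he.
pose K : R := (K1 + K2) * eps `^ s.
have K0 : 0 <= K by rewrite mulr_ge0 ?powR_ge0// addr_ge0.
have B x : polygon nu c x -> ComplexField.Normc.normc (u_eps x - u_0 x) <=
    K * (1 + \sum_k (dot (nu k) x - c k) `^ (- s)).
  move=> Dx; have h1 := H1 eps he _ _ uRe vRe x Dx; have h2 := H2 eps he _ _ uIm vIm x Dx.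
  apply: (@le_trans _ _ (`|complex.Re (u_eps x) - complex.Re (u_0 x)| +
                         `|complex.Im (u_eps x) - complex.Im (u_0 x)|)).
    apply: le_trans (normc_le _) _; by case: (u_eps x) => a b; case: (u_0 x).
  by rewrite (le_trans (lerD h1 h2))// -!mulrDl.
apply: (@le_trans _ _ (K * M `^ p^-1)%:E).
  rewrite /Lp_norm; apply: (Lnorm_le p0 K0 M0 mG G0 GM) => T.
  rewrite patchE; case: ifPn => [|_].
    rewrite inE => DT; have := B _ DT.
    set z : R := ComplexField.Normc.normc _; move=> zK.
    have z0 : 0 <= z by rewrite /z; case: (_ - _) => a b /=; exact: sqrtr_ge0.
    have -> : (`|z%:E| = z%:E)%E by rewrite /= ger0_norm.
    rewrite poweR_EFin.
    apply: (le_trans _ (lee_wpmul2l _ (DG _ DT))); last by rewrite lee_fin powR_ge0.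
    rewrite -EFinM lee_fin -powRM//; last first.
      by rewrite addr_ge0// sumr_ge0// => k _; exact: powR_ge0.
    by rewrite ge0_ler_powR ?nnegrE ?(ltW p0)// (le_trans z0).
  have -> : (point : \bar R) = 0%E by [].
  rewrite abse0 poweR0r ?gt_eqF// mule_ge0// lee_fin powR_ge0//.
rewrite lee_fin /K mulrAC ler_wpM2l ?mulr_ge0 ?addr_ge0 ?powR_ge0//.
(* As [eps <= 1], it remains to compare exponents: the claimed one is at most [p^-1 - delta], hence
   at most [s]. *)
rewrite ger_powR ?e0//.
rewrite (@le_trans _ _ (p^-1 - delta))// ?le_max ?lexx//.
by rewrite lerD2r ge_min lexx orbT.
Qed.
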